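(* Let $K$ be a finite flag simplicial complex such that the real moment-angle complex $\mathcal{R}_K$ is a closed manifold. Then the group $G=\pi_1(\mathcal{R}_K)$ acts properly, cocompactly, and isometrically on a finite-dimensional CAT(0) space.
   Context: Let $K$ be a finite simplicial complex on the vertex set $[m]=\{1,\dots,m\}$. $K$ is called flag if every finite set of vertices which are pairwise connected by edges spans a simplex of $K$. With $D^1=[-1,1]$ and $S^0=\{\pm1\}$, the real moment-angle complex of $K$ is $$\mathcal{R}_K=\bigcup_{I\in K}\left(\prod_{i\in I} D^1\times\prod_{j\in [m]\setminus I} S^0\right)\subseteq [-1,1]^m,$$ the union being over all simplices $I\subseteq[m]$ of $K$. *)

(* Defs.v *)
From HB Require Import structures.
From mathcomp Require Import all_boot all_order all_algebra generic_quotient.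
From mathcomp Require Import all_classical all_reals all_analysis.
From mathcomp Require Import homotopy lra.

Set Implicit Arguments.
Unset Strict Implicit.
Unset Printing Implicit Defensive.

Import Order.TTheory GRing.Theory Num.Theory.
Import numFieldNormedType.Exports.

Local Open Scope classical_set_scope.
Local Open Scope ring_scope.
Local Open Scope quotient_scope.

(* A simplicial complex on the vertex set [m] is given by its set of simplices,
   the empty one included; every i : 'I_m is a vertex (no ghost vertices). *)
Definition simplicial_complex (m : nat) (K : {set {set 'I_m}}) : Prop :=
  [/\ finset.set0 \in K,
      forall i : 'I_m, [set i]%SET \in K
    & forall I J : {set 'I_m}, I \in K -> J \subset I -> J \in K].

Definition flag_complex (m : nat) (K : {set {set 'I_m}}) : Prop :=
  forall I : {set 'I_m},
    (forall i j, i \in I -> j \in I -> i != j -> [set i; j]%SET \in K) ->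
    I \in K.

Definition real_moment_angle (R : realType) (m : nat) (K : {set {set 'I_m}}) :
    set 'rV[R]_m :=
  \bigcup_(I in [set` K])
    [set x : 'rV[R]_m |
      (forall i, i \in I -> x ord0 i \in `[-1, 1]) /\
      (forall j, j \notin I -> x ord0 j = 1 \/ x ord0 j = -1)].
Arguments real_moment_angle R {m} K.

Definition homeomorphic (X Y : topologicalType) : Prop :=
  exists (f : X -> Y) (g : Y -> X),
    [/\ continuous f, continuous g, cancel f g & cancel g f].

Definition topological_manifold (R : realType) (n : nat) (X : topologicalType) :
    Prop :=
  [/\ hausdorff_space X, @second_countable X
    & forall x : X, exists (U : set X) (V : set 'rV[R]_n),
        [/\ open U, U x, open V & homeomorphic U V]].

Definition closed_manifold (R : realType) (X : topologicalType) : Prop :=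
  compact [set: X] /\ exists n, topological_manifold R n X.

Section UnitInterval.
Context {R : realType}.

Definition unit_itv : Type := set_type (`[0 : R, 1]%classic).

HB.instance Definition _ := Topological.copy unit_itv
  (set_type (`[0 : R, 1]%classic)).

Lemma clamp_subproof (x : R) :
  Num.max 0 (Num.min 1 x) \in (`[0 : R, 1]%classic : set R).
Proof.
rewrite inE /= in_itv /= le_max lexx /= ge_max ler01 /=.
by rewrite ge_min lexx.
Qed.

Definition clamp (x : R) : unit_itv :=
  exist (fun y => y \in (`[0, 1]%classic : set R)) _ (clamp_subproof x).

Definition itv_val (s : unit_itv) : R := \val s.

Lemma clampE (x : R) : itv_val (clamp x) = Num.max 0 (Num.min 1 x).
Proof. by []. Qed.

Lemma itv_val_inj : injective itv_val.
Proof. exact: val_inj. Qed.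

Lemma unit_itvP (s : unit_itv) : 0 <= itv_val s <= 1.
Proof. by case: s => s /= h; have := set_mem h; rewrite /= in_itv. Qed.

Lemma val_clamp (x : R) : 0 <= x <= 1 -> itv_val (clamp x) = x.
Proof. by move=> /andP[h0 h1]; rewrite clampE (min_r h1) (max_r h0). Qed.

Lemma clampK (s : unit_itv) : clamp (itv_val s) = s.
Proof. by apply: itv_val_inj; rewrite val_clamp// unit_itvP. Qed.

Lemma clamp_le0 (x : R) : x <= 0 -> clamp x = clamp 0.
Proof.
move=> h; apply: itv_val_inj.
by rewrite !clampE !min_r ?ler01 ?(le_trans h)// max_l// maxxx.
Qed.

Lemma clamp_ge1 (x : R) : 1 <= x -> clamp x = clamp 1.
Proof. by move=> h; apply: itv_val_inj; rewrite !clampE minxx min_l. Qed.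

Lemma clamp01_neq : clamp 0 != clamp 1.
Proof.
apply/eqP => /(congr1 itv_val); rewrite !val_clamp ?lexx ?ler01//.
by move/eqP; rewrite eq_sym oner_eq0.
Qed.

HB.instance Definition _ := isBiPointed.Build unit_itv clamp01_neq.

Lemma itv_zeroE : zero = clamp 0. Proof. by []. Qed.
Lemma itv_oneE : one = clamp 1. Proof. by []. Qed.

Lemma continuous_unit_itv (X : topologicalType) (f : X -> unit_itv) :
  continuous (fun x => itv_val (f x)) -> continuous f.
Proof. exact: (@continuous_comp_initial _ X R set_val f). Qed.

Lemma continuous_val : continuous itv_val.
Proof. exact: initial_continuous. Qed.

Lemma continuous_clamp : continuous clamp.
Proof.
apply: continuous_unit_itv => x /=.
apply: continuous_max; first exact: cvg_cst.
by apply: continuous_min; [exact: cvg_cst|exact: cvg_id].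
Qed.

End UnitInterval.
Arguments unit_itv : clear implicits.

Section PathHomotopy.
Context {R : realType} {T : topologicalType}.
Local Notation I := (unit_itv R).
Local Notation paths x y := {path I from x to y}.

Definition path_homotopic (x y : T) (f g : paths x y) : Prop :=
  exists H : I * I -> T,
    [/\ continuous H,
        forall s, H (s, zero) = f s,
        forall s, H (s, one) = g s,
        forall t, H (zero, t) = x
      & forall t, H (one, t) = y].

Lemma glue_continuous (X : topologicalType) (u : X -> R) (c : R) (f g : X -> T) :
  continuous u -> continuous f -> continuous g ->
  (forall z, u z = c -> f z = g z) ->
  continuous (fun z => if u z <= c then f z else g z).
Proof.
move=> cu cf cg fg.
set A : set X := [set z | u z <= c]; set B : set X := [set z | c <= u z].
have cA : closed A by move/continuous_closedP: cu => /(_ _ (@closed_le R c)).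
have cB : closed B by move/continuous_closedP: cu => /(_ _ (@closed_ge R c)).
apply/continuous_subspace_setT.
have -> : [set: X] = A `|` B.
  by apply/seteqP; split=> z // _; case: (leP (u z) c) => [h|/ltW h]; [left|right].
apply: withinU_continuous => //.
- apply: (@subspace_eq_continuous _ _ _ f); last exact: continuous_subspaceT.
  by move=> z; rewrite inE /A /= /from_subspace => ->.
- apply: (@subspace_eq_continuous _ _ _ g); last exact: continuous_subspaceT.
  move=> z; rewrite inE /B /= /from_subspace => h.
  by case: leP => // h'; rewrite fg//; apply/le_anti; rewrite h h'.
Qed.

Definition extend (f : I -> T) (r : R) : T := f (clamp r).

Lemma extend_continuous (f : I -> T) : continuous f -> continuous (extend f).
Proof. by move=> cf r; apply: continuous_comp; [exact: continuous_clamp|exact: cf]. Qed.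

Lemma extend_le0 (f : I -> T) r : r <= 0 -> extend f r = f zero.
Proof. by move=> h; rewrite /extend clamp_le0. Qed.

Lemma extend_ge1 (f : I -> T) r : 1 <= r -> extend f r = f one.
Proof. by move=> h; rewrite /extend clamp_ge1. Qed.

Lemma continuous_affine (X : topologicalType) (a : X -> R) (c d : R) :
  continuous a -> continuous (fun w => c * a w + d).
Proof.
by move=> ca w; apply: cvgD; [apply: cvgMl_tmp; exact: ca|exact: cvg_cst]. Qed.

Lemma continuous_scale (X : topologicalType) (a : X -> R) (c : R) :
  continuous a -> continuous (fun w => c * a w).
Proof. by move=> ca w; apply: cvgMl_tmp; exact: ca. Qed.

Lemma continuous_add (X : topologicalType) (a b : X -> R) :
  continuous a -> continuous b -> continuous (fun w => a w + b w).
Proof. by move=> ca cb w; apply: cvgD; [exact: ca|exact: cb]. Qed.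

Lemma continuous_mul (X : topologicalType) (a b : X -> R) :
  continuous a -> continuous b -> continuous (fun w => a w * b w).
Proof. by move=> ca cb w; apply: cvgM; [exact: ca|exact: cb]. Qed.

Lemma continuous_maxf (X : topologicalType) (a b : X -> R) :
  continuous a -> continuous b -> continuous (fun w => Num.max (a w) (b w)).
Proof. by move=> ca cb w; apply: (@continuous_max R X a b); [exact: ca|exact: cb]. Qed.

Lemma continuous_minf (X : topologicalType) (a b : X -> R) :
  continuous a -> continuous b -> continuous (fun w => Num.min (a w) (b w)).
Proof. by move=> ca cb w; apply: (@continuous_min R X a b); [exact: ca|exact: cb]. Qed.

Lemma continuous_csub (X : topologicalType) (a : X -> R) (c : R) :
  continuous a -> continuous (fun w => c - a w).
Proof. by move=> ca w; apply: cvgB; [exact: cvg_cst|exact: ca]. Qed.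

Lemma continuous_pairf (X Y Z : topologicalType) (a : X -> Y) (b : X -> Z) :
  continuous a -> continuous b -> continuous (fun w => (a w, b w)).
Proof. by move=> ca cb w; apply: cvg_pair; [exact: ca|exact: cb]. Qed.

Lemma continuous_compf (X Y Z : topologicalType) (a : X -> Y) (b : Y -> Z) :
  continuous a -> continuous b -> continuous (fun w => b (a w)).
Proof. by move=> ca cb w; apply: continuous_comp; [exact: ca|exact: cb]. Qed.

Lemma continuous_fst (X Y : topologicalType) : continuous (@fst X Y).
Proof. by move=> w; exact: cvg_fst. Qed.

Lemma continuous_snd (X Y : topologicalType) : continuous (@snd X Y).
Proof. by move=> w; exact: cvg_snd. Qed.

Section Concat.
Context {x y z : T} (f : paths x y) (g : paths y z).

Definition concat_fun (s : I) : T :=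
  if itv_val s <= 2^-1 :> R then f (clamp (2 * itv_val s))
  else g (clamp (2 * itv_val s - 1)).

Lemma concat_continuous : continuous concat_fun.
Proof.
apply: (@glue_continuous I itv_val 2^-1
  (fun s => extend f (2 * itv_val s)) (fun s => extend g (2 * itv_val s - 1))).
- exact: continuous_val.
- move=> s; apply: (@continuous_comp I R T (fun s => 2 * itv_val s) (extend f)); last first.
    by apply: extend_continuous; exact: cts_fun.
  by apply: continuous_scale; exact: continuous_val.
- move=> s; apply: (@continuous_comp I R T (fun s => 2 * itv_val s - 1) (extend g)); last first.
    by apply: extend_continuous; exact: cts_fun.
  by apply: continuous_affine; exact: continuous_val.
- move=> s ->; rewrite extend_ge1 ?extend_le0 ?path_one ?path_zero//; lra.
Qed.

Lemma extend_concat r : extend concat_fun r =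
  if r <= 2^-1 then extend f (2 * r) else extend g (2 * r - 1).
Proof.
rewrite {1}/extend /concat_fun.
have [h0|h0] := leP r 0.
  rewrite (clamp_le0 h0) val_clamp ?lexx ?ler01// mulr0 invr_ge0 ler0n.
  rewrite -[f _]/(extend f 0) !extend_le0// ?ifT//; lra.
have [h1|h1] := leP 1 r.
  rewrite (clamp_ge1 h1) val_clamp ?lexx ?ler01//.
  rewrite !ifF; [|lra|lra].
  rewrite -[g (clamp _)]/(extend g (2 * 1 - 1)) !extend_ge1//; lra.
by rewrite val_clamp// (ltW h0) (ltW h1).
Qed.

Lemma concat_zero : concat_fun zero = x.
Proof.
rewrite -[concat_fun _]/(extend concat_fun 0) extend_concat ifT; last lra.
by rewrite extend_le0 ?path_zero// mulr0.
Qed.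

Lemma concat_one : concat_fun one = z.
Proof.
rewrite -[concat_fun _]/(extend concat_fun 1) extend_concat ifF; last lra.
by rewrite extend_ge1 ?path_one//; lra.
Qed.

HB.instance Definition _ := isContinuous.Build I T concat_fun concat_continuous.
HB.instance Definition _ := isPath.Build I T x z concat_fun concat_zero concat_one.

Definition concat : paths x z := concat_fun.

End Concat.

Definition flip (s : I) : I := clamp (1 - itv_val s).

Lemma flip_continuous : continuous flip.
Proof.
move=> s; apply: (@continuous_comp I R I (fun s => 1 - itv_val s) clamp); last first.
  exact: continuous_clamp.
by apply: continuous_csub; exact: continuous_val.
Qed.

Section Reverse.
Context {x y : T} (f : paths x y).

Definition reverse_fun (s : I) : T := f (flip s).

Lemma reverse_continuous : continuous reverse_fun.
Proof.
move=> s; apply: (@continuous_comp I I T flip f); first exact: flip_continuous.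
exact: cts_fun.
Qed.

Lemma reverse_zero : reverse_fun zero = y.
Proof.
rewrite /reverse_fun /flip itv_zeroE val_clamp ?lexx ?ler01// subr0.
by rewrite -itv_oneE path_one.
Qed.

Lemma reverse_one : reverse_fun one = x.
Proof.
rewrite /reverse_fun /flip itv_oneE val_clamp ?lexx ?ler01// subrr.
by rewrite -itv_zeroE path_zero.
Qed.

HB.instance Definition _ := isContinuous.Build I T reverse_fun reverse_continuous.
HB.instance Definition _ :=
  isPath.Build I T y x reverse_fun reverse_zero reverse_one.

Definition reverse : paths y x := reverse_fun.

End Reverse.

Definition const_path (x : T) : paths x x := cst x.

Lemma path_homotopic_refl x y (f : paths x y) : path_homotopic f f.
Proof.
exists (fun p => f p.1); split=> //.
- by apply: continuous_compf; [exact: continuous_fst|exact: cts_fun].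
- by move=> ?; rewrite path_zero.
- by move=> ?; rewrite path_one.
Qed.

Lemma path_homotopic_sym x y (f g : paths x y) :
  path_homotopic f g -> path_homotopic g f.
Proof.
move=> [H [cH H0 H1 Hx Hy]]; exists (fun p => H (p.1, flip p.2)); split=> //.
- apply: (continuous_compf (a := fun p : I * I => (p.1, flip p.2))) => //.
  apply: continuous_pairf; first exact: continuous_fst.
  by apply: continuous_compf; [exact: continuous_snd|exact: flip_continuous].
- by move=> s; rewrite -H1/= /flip val_clamp ?lexx ?ler01// subr0.
- by move=> s; rewrite -H0/= /flip val_clamp ?lexx ?ler01// subrr.
Qed.

Lemma continuous_pair_clamp (X : topologicalType) (H : I * I -> T)
    (a b : X -> R) : continuous H -> continuous a -> continuous b ->
  continuous (fun w => H (clamp (a w), clamp (b w))).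
Proof.
move=> cH ca cb.
apply: (continuous_compf (a := fun w => (clamp (a w), clamp (b w)))) => //.
by apply: continuous_pairf; apply: continuous_compf => //;
  exact: continuous_clamp.
Qed.

Lemma continuous_val1 : continuous (fun p : I * I => itv_val p.1).
Proof.
by apply: continuous_compf; [exact: continuous_fst|exact: continuous_val].
Qed.

Lemma continuous_val2 : continuous (fun p : I * I => itv_val p.2).
Proof.
by apply: continuous_compf; [exact: continuous_snd|exact: continuous_val].
Qed.

Lemma path_homotopic_trans x y (f g h : paths x y) :
  path_homotopic f g -> path_homotopic g h -> path_homotopic f h.
Proof.
move=> [H [cH H0 H1 Hx Hy]] [K [cK K0 K1 Kx Ky]].
exists (fun p => if itv_val p.2 <= 2^-1 :> R
  then H (clamp (1 * itv_val p.1 + 0), clamp (2 * itv_val p.2 + 0))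
  else K (clamp (1 * itv_val p.1 + 0), clamp (2 * itv_val p.2 - 1))).
split.
- apply: (@glue_continuous _ (fun p : I * I => itv_val p.2)).
  + exact: continuous_val2.
  + by apply: continuous_pair_clamp => //; apply: continuous_affine;
      [exact: continuous_val1|exact: continuous_val2].
  + by apply: continuous_pair_clamp => //; apply: continuous_affine;
      [exact: continuous_val1|exact: continuous_val2].
  + move=> p ->; rewrite divff ?pnatr_eq0// !addr0 subrr.
    by rewrite -itv_oneE -itv_zeroE H1 K0.
- move=> s /=; rewrite val_clamp ?lexx ?ler01// ifT; last lra.
  by rewrite mulr0 !addr0 mul1r clampK -itv_zeroE H0.
- move=> s /=; rewrite val_clamp ?lexx ?ler01// ifF; last lra.
  rewrite addr0 mul1r clampK (_ : 2 * 1 - 1 = 1); last lra.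
  by rewrite -itv_oneE K1.
- move=> t /=; rewrite val_clamp ?lexx ?ler01// mulr0 addr0.
  by rewrite -itv_zeroE Hx Kx; case: ifP.
- move=> t /=; rewrite val_clamp ?lexx ?ler01// mul1r addr0.
  by rewrite -itv_oneE Hy Ky; case: ifP.
Qed.

Lemma concat_homotopic x y z (f f' : paths x y) (g g' : paths y z) :
  path_homotopic f f' -> path_homotopic g g' ->
  path_homotopic (concat f g) (concat f' g').
Proof.
move=> [H [cH H0 H1 Hx Hy]] [K [cK K0 K1 Kx Ky]].
exists (fun p => if itv_val p.1 <= 2^-1 :> R
  then H (clamp (2 * itv_val p.1 + 0), clamp (1 * itv_val p.2 + 0))
  else K (clamp (2 * itv_val p.1 - 1), clamp (1 * itv_val p.2 + 0))).
split.
- apply: (@glue_continuous _ (fun p : I * I => itv_val p.1)).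
  + exact: continuous_val1.
  + by apply: continuous_pair_clamp => //; apply: continuous_affine;
      [exact: continuous_val1|exact: continuous_val2].
  + by apply: continuous_pair_clamp => //; apply: continuous_affine;
      [exact: continuous_val1|exact: continuous_val2].
  + move=> p ->; rewrite divff ?pnatr_eq0// !addr0 subrr.
    by rewrite -itv_oneE -itv_zeroE Hy Kx.
- move=> s /=; rewrite /concat_fun; rewrite (@val_clamp R 0) ?lexx ?ler01//.
  by rewrite mulr0 !addr0 -itv_zeroE H0 K0.
- move=> s /=; rewrite /concat_fun; rewrite (@val_clamp R 1) ?lexx ?ler01//.
  by rewrite mulr1 !addr0 -itv_oneE H1 K1.
- move=> t /=; rewrite val_clamp ?lexx ?ler01// ifT; last lra.
  by rewrite mulr0 addr0 -itv_zeroE Hx.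
- move=> t /=; rewrite val_clamp ?lexx ?ler01// ifF; last lra.
  rewrite (_ : 2 * 1 - 1 = 1); last lra.
  by rewrite -itv_oneE Ky.
Qed.

Lemma reverse_homotopic x y (f g : paths x y) :
  path_homotopic f g -> path_homotopic (reverse f) (reverse g).
Proof.
move=> [H [cH H0 H1 Hx Hy]]; exists (fun p => H (flip p.1, p.2)); split=> //.
- apply: (continuous_compf (a := fun p : I * I => (flip p.1, p.2))) => //.
  apply: continuous_pairf; last exact: continuous_snd.
  by apply: continuous_compf; [exact: continuous_fst|exact: flip_continuous].
- by move=> s; exact: H0.
- by move=> s; exact: H1.
- by move=> t; rewrite /= /flip val_clamp ?lexx ?ler01// subr0 -itv_oneE Hy.
- by move=> t; rewrite /= /flip val_clamp ?lexx ?ler01// subrr -itv_zeroE Hx.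
Qed.

(* Two paths running through the same path h, with parametrisations a and b
   that agree at the endpoints, are homotopic. *)
Lemma reparam_homotopic x y u v (f g : paths x y) (h : paths u v) (a b : R -> R) :
  continuous a -> continuous b -> a 0 = b 0 -> a 1 = b 1 ->
  (forall s : I, f s = extend h (a (itv_val s))) ->
  (forall s : I, g s = extend h (b (itv_val s))) ->
  path_homotopic f g.
Proof.
move=> ca cb ab0 ab1 fE gE.
exists (fun p => extend h
  ((1 - itv_val p.2) * a (itv_val p.1) + itv_val p.2 * b (itv_val p.1))).
have ca1 : continuous (fun p : I * I => a (itv_val p.1)).
  by apply: continuous_compf => //; exact: continuous_val1.
have cb1 : continuous (fun p : I * I => b (itv_val p.1)).
  by apply: continuous_compf => //; exact: continuous_val1.
split.
- apply: continuous_compf; last by apply: extend_continuous; exact: cts_fun.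
  apply: continuous_add; apply: continuous_mul => //; last first.
    exact: continuous_val2.
  by apply: continuous_csub; exact: continuous_val2.
- by move=> s; rewrite /= val_clamp ?lexx ?ler01// subr0 mul1r mul0r addr0 fE.
- by move=> s; rewrite /= val_clamp ?lexx ?ler01// subrr mul1r mul0r add0r gE.
- move=> t /=; rewrite val_clamp ?lexx ?ler01// -ab0 -mulrDl subrK mul1r.
  by rewrite -[X in a X](@val_clamp R 0) ?lexx ?ler01// -fE path_zero.
- move=> t /=; rewrite val_clamp ?lexx ?ler01// -ab1 -mulrDl subrK mul1r.
  by rewrite -[X in a X](@val_clamp R 1) ?lexx ?ler01// -fE path_one.
Qed.

Lemma extendE x y (f : paths x y) (s : I) : f s = extend f (itv_val s).
Proof. by rewrite /extend clampK. Qed.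

Lemma extend_cst x r : extend (const_path x) r = x.
Proof. by []. Qed.

Lemma concatA_homotopic x y z w (f : paths x y) (g : paths y z) (h : paths z w) :
  path_homotopic (concat f (concat g h)) (concat (concat f g) h).
Proof.
apply: (@reparam_homotopic _ _ _ _ _ _ (concat f (concat g h)) id
  (fun r => Num.min (2 * r) (Num.min (r + 4^-1) (2^-1 * r + 2^-1)))).
- by move=> r; exact: cvg_id.
- move=> r; apply: continuous_min; first by apply: cvgMl_tmp; exact: cvg_id.
  apply: continuous_min; first by apply: cvgD; [exact: cvg_id|exact: cvg_cst].
  by apply: continuous_affine => ?; exact: cvg_id.
- by rewrite mulr0 !add0r mulr0 add0r min_l// le_min; apply/andP; split; lra.
- by rewrite !mulr1 (_ : 2^-1 + 2^-1 = 1) ?(min_r (y := 1)) ?min_r//; lra.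
- by move=> s; rewrite extendE.
move=> s; rewrite extendE !extend_concat.
have /andP[s0 s1] := unit_itvP s; set r : R := itv_val s in s0 s1 *.
have [h2|h2] := leP r 2^-1.
- have -> : Num.min (r + 4^-1) (2^-1 * r + 2^-1) = r + 4^-1 by rewrite min_l//; lra.
  have [h4|h4] := leP (2 * r) 2^-1.
  + by rewrite min_l ?h4//; lra.
  + rewrite min_r; last lra.
    have [h5|h5] := leP (r + 4^-1) 2^-1; first by exfalso; lra.
    rewrite ifT; last lra.
    by congr extend; lra.
- have -> : Num.min (r + 4^-1) (2^-1 * r + 2^-1) = 2^-1 * r + 2^-1 by rewrite min_r//; lra.
  rewrite min_r; last lra.
  rewrite !ifF; [|lra|lra].
  by congr extend; lra.
Qed.

Lemma concat1p_homotopic x y (f : paths x y) :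
  path_homotopic (concat (const_path x) f) f.
Proof.
apply: (@reparam_homotopic _ _ _ _ _ _ f (fun r => Num.max 0 (2 * r - 1)) id).
- apply: continuous_maxf; first exact: cst_continuous.
  by apply: continuous_affine => ?; exact: cvg_id.
- by move=> r; exact: cvg_id.
- by rewrite max_l//; lra.
- by rewrite max_r//; lra.
- move=> s; rewrite extendE extend_concat extend_cst.
  have [h|h] := leP (itv_val s) (2^-1 : R).
  + by rewrite max_l ?extend_le0 ?path_zero//; lra.
  + by rewrite max_r//; lra.
- by move=> s; rewrite extendE.
Qed.

Lemma concatp1_homotopic x y (f : paths x y) :
  path_homotopic (concat f (const_path y)) f.
Proof.
apply: (@reparam_homotopic _ _ _ _ _ _ f (fun r => Num.min 1 (2 * r)) id).
- apply: continuous_minf; first exact: cst_continuous.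
  by apply: continuous_scale => ?; exact: cvg_id.
- by move=> r; exact: cvg_id.
- by rewrite min_r//; lra.
- by rewrite min_l//; lra.
- move=> s; rewrite extendE extend_concat extend_cst.
  have [h|h] := leP (itv_val s) (2^-1 : R).
  + by rewrite min_r//; lra.
  + by rewrite min_l ?extend_ge1 ?path_one//; lra.
- by move=> s; rewrite extendE.
Qed.

Lemma extend_reverse x y (f : paths x y) r :
  extend (reverse f) r = extend f (1 - r).
Proof.
rewrite {1}/extend /= /reverse_fun /flip.
have [h0|h0] := leP r 0.
  rewrite (clamp_le0 h0) val_clamp ?lexx ?ler01// subr0 extend_ge1//; lra.
have [h1|h1] := leP 1 r.
  rewrite (clamp_ge1 h1) val_clamp ?lexx ?ler01// subrr extend_le0//; lra.
by rewrite val_clamp// (ltW h0) (ltW h1).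
Qed.

Lemma concatpV_homotopic x y (f : paths x y) :
  path_homotopic (concat f (reverse f)) (const_path x).
Proof.
apply: (@reparam_homotopic _ _ _ _ _ _ f
  (fun r => Num.min (2 * r) (2 - 2 * r)) (fun=> 0)).
- apply: continuous_minf; first by apply: continuous_scale => ?; exact: cvg_id.
  by apply: continuous_csub; apply: continuous_scale => ?; exact: cvg_id.
- by move=> r; exact: cvg_cst.
- by rewrite min_l//; lra.
- by rewrite min_r//; lra.
- move=> s; rewrite extendE extend_concat extend_reverse.
  have [h|h] := leP (itv_val s) (2^-1 : R).
  + by rewrite min_l//; lra.
  + by rewrite min_r; [congr extend|]; lra.
- by move=> s; rewrite extend_le0 ?path_zero.
Qed.

Lemma reverseK x y (f : paths x y) : reverse (reverse f) = f.
Proof.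
by apply/path_eqP => s; rewrite extendE 2!extend_reverse opprB addrC subrK -extendE.
Qed.

Lemma concatVp_homotopic x y (f : paths x y) :
  path_homotopic (concat (reverse f) f) (const_path y).
Proof. by rewrite -{2}(reverseK f); exact: concatpV_homotopic. Qed.

End PathHomotopy.

Section FundamentalGroup.
Context (R : realType) (T : topologicalType) (x : T).
Local Notation loops := {path unit_itv R from x to x}.

Definition loop_rel (f g : loops) : bool := `[< path_homotopic f g >].

Lemma loop_rel_refl : reflexive loop_rel.
Proof. by move=> f; apply/asboolP; exact: path_homotopic_refl. Qed.

Lemma loop_rel_sym : symmetric loop_rel.
Proof. by move=> f g; apply/asboolP/asboolP; exact: path_homotopic_sym. Qed.

Lemma loop_rel_trans : transitive loop_rel.
Proof.
move=> g f h /asboolP fg /asboolP gh; apply/asboolP.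
exact: path_homotopic_trans fg gh.
Qed.

Definition loop_equiv := EquivRel loop_rel loop_rel_refl loop_rel_sym loop_rel_trans.

Definition pi1 : Type := {eq_quot loop_equiv}.

HB.instance Definition _ := Choice.on pi1.
HB.instance Definition _ := Quotient.on pi1.

Definition pi1_mul (a b : pi1) : pi1 := \pi_pi1 (concat (repr a) (repr b)).
Definition pi1_one : pi1 := \pi_pi1 (const_path x).
Definition pi1_inv (a : pi1) : pi1 := \pi_pi1 (reverse (repr a)).

Lemma pi1_eqP (f g : loops) : \pi_pi1 f = \pi_pi1 g <-> path_homotopic f g.
Proof. by split=> [/eqmodP/asboolP//|fg]; apply/eqmodP/asboolP. Qed.

Lemma pi1_repr (f : loops) : path_homotopic (repr (\pi_pi1 f)) f.
Proof. by apply/pi1_eqP; rewrite reprK. Qed.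

Lemma pi1_mulE (f g : loops) :
  pi1_mul (\pi f) (\pi g) = \pi_pi1 (concat f g).
Proof. by apply/pi1_eqP; apply: concat_homotopic; exact: pi1_repr. Qed.

Lemma pi1_invE (f : loops) : pi1_inv (\pi f) = \pi_pi1 (reverse f).
Proof. by apply/pi1_eqP; apply: reverse_homotopic; exact: pi1_repr. Qed.

Lemma pi1_mulA : associative pi1_mul.
Proof.
move=> a b c; rewrite -[a]reprK -[b]reprK -[c]reprK !pi1_mulE.
by apply/pi1_eqP; exact: concatA_homotopic.
Qed.

Lemma pi1_mul1g : left_id pi1_one pi1_mul.
Proof.
move=> a; rewrite -[a]reprK pi1_mulE.
by apply/pi1_eqP; exact: concat1p_homotopic.
Qed.

Lemma pi1_mulg1 : right_id pi1_one pi1_mul.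
Proof.
move=> a; rewrite -[a]reprK pi1_mulE.
by apply/pi1_eqP; exact: concatp1_homotopic.
Qed.

Lemma pi1_mulVg : left_inverse pi1_one pi1_inv pi1_mul.
Proof.
move=> a; rewrite -[a]reprK pi1_invE pi1_mulE.
by apply/pi1_eqP; exact: concatVp_homotopic.
Qed.

Lemma pi1_mulgV : right_inverse pi1_one pi1_inv pi1_mul.
Proof.
move=> a; rewrite -[a]reprK pi1_invE pi1_mulE.
by apply/pi1_eqP; exact: concatpV_homotopic.
Qed.

HB.instance Definition _ := isGroup.Build pi1
  pi1_mulA pi1_mul1g pi1_mulg1 pi1_mulVg pi1_mulgV.

End FundamentalGroup.

Section CAT0.
Context {R : realType}.

Definition edist (n : nat) (p q : 'rV[R]_n) : R :=
  Num.sqrt (\sum_(i < n) (p ord0 i - q ord0 i) ^+ 2).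

Context (X : metricType R).

(* c restricted to [0, 1] is a geodesic from x to y, parametrised
   proportionally to arc length. *)
Definition geodesic (x y : X) (c : R -> X) : Prop :=
  [/\ c 0 = x, c 1 = y
    & {in `[0, 1] &, forall s t, mdist (c s) (c t) = `|s - t| * mdist x y}].

Definition geodesic_space : Prop := forall x y : X, exists c, geodesic x y c.

(* A geodesic triangle has vertices v i and sides c i joining v i to
   v (ordS i), where ordS is the cyclic successor on 'I_3. The comparison point
   of c i s is the point of the segment [w i, w (ordS i)] in the Euclidean
   plane at distance s * mdist (v i) (v (ordS i)) from w i. *)
Definition CAT0_inequality : Prop :=
  forall (v : 'I_3 -> X) (c : 'I_3 -> R -> X) (w : 'I_3 -> 'rV[R]_2),
    (forall i, geodesic (v i) (v (ordS i)) (c i)) ->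
    (forall i j, edist (w i) (w j) = mdist (v i) (v j)) ->
    forall i j, {in `[0, 1] &, forall s t,
      mdist (c i s) (c j t) <=
        edist ((1 - s) *: w i + s *: w (ordS i))
              ((1 - t) *: w j + t *: w (ordS j))}.

(* Nonemptiness is required: the empty space would carry a proper cocompact
   action of any group. *)
Definition CAT0_space : Prop :=
  [/\ [set: X] !=set0, geodesic_space & CAT0_inequality].

End CAT0.

Definition open_cover (X : topologicalType) (C : set (set X)) : Prop :=
  (forall U, C U -> open U) /\ \bigcup_(U in C) U = [set: X].

(* Lebesgue covering dimension. *)
Definition covering_dim_le (X : topologicalType) (n : nat) : Prop :=
  forall C : set (set X), open_cover C ->
    exists D : set (set X),
      [/\ open_cover D,
          forall V, D V -> exists2 U, C U & V `<=` U
        & forall x, ([set V | D V /\ V x] #<= `I_n.+1)%card].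

Definition finite_dimensional (X : topologicalType) : Prop :=
  exists n, covering_dim_le X n.

Section Action.
Context {R : realType} {G : groupType} {X : metricType R} (act : G -> X -> X).

Definition left_action : Prop :=
  (forall x, act 1%g x = x) /\
  (forall g h x, act (g * h)%g x = act g (act h x)).

Definition isometric_action : Prop :=
  forall g x y, mdist (act g x) (act g y) = mdist x y.

Definition proper_action : Prop :=
  forall x, exists2 r : R, 0 < r &
    finite_set [set g | (act g @` ball x r) `&` ball x r !=set0].

Definition cocompact_action : Prop :=
  exists2 K : set X, compact K & \bigcup_g (act g @` K) = [set: X].

End Action.

(* Main.v *)
(** Let W be the right-angled Coxeter group with one generator s_i per vertex,
    s_i and s_j commuting when {i, j} is an edge. The universal cover of R_K is
    modelled by the pairs (w, y) of a chamber w in W and a point y of R_K whose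
    signs are those of x0 flipped according to the class of w in (Z/2)^m; when
    some coordinates of y change sign, w is multiplied by the corresponding
    (commuting) generators.

    Each reflection of W is a wall, and (w, y) has a coordinate in [-1, 1] for
    every wall: |y_i|, signed by the side of the wall, for the walls w s_i w^-1
    of the chamber w, and +1 or -1 for the others. If K is flag, the image is the
    solution set of the 2-clauses, each a disjunction of two sides of walls, that
    all chambers satisfy. Solution sets of 2-clauses are median cube
    complexes: their path metric satisfies Stewart's inequality (a form of the
    CAT(0) condition), by induction on the number of varying coordinates.
    Cutting along x_h = 0 leaves the faces x_h = 1 and x_h = -1, each glued, as in
    Reshetnyak's theorem, to the product of the carrier of the hyperplane with
    an interval.

    A loop in R_K lifts to a path of chambers starting at 1, whose end point
    depends only on the homotopy class. The resulting homomorphism from pi_1 to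
    the kernel of W -> (Z/2)^m is an isomorphism: projecting geodesics to R_K
    gives surjectivity, and projecting the geodesic contraction of the cover
    gives injectivity. So pi_1 acts by left translation of the chambers, freely
    and by isometries, and the stars of the 2^m chambers representing the
    classes in (Z/2)^m form a compact set meeting every orbit. A point lies in
    at most 2^m open stars, each with a grid of overlapping small cubes, which
    bounds the covering dimension. *)

Require Import Defs.
From HB Require Import structures.
From mathcomp Require Import all_boot all_order all_algebra.
From mathcomp Require Import all_classical all_reals all_analysis.
From mathcomp Require Import generic_quotient homotopy ring lra zify.

Set Implicit Arguments.
Unset Strict Implicit.
Unset Printing Implicit Defensive.

Import Order.TTheory GRing.Theory Num.Theory.
Import numFieldNormedType.Exports.

Local Open Scope classical_set_scope.
Local Open Scope ring_scope.

(** * Right-angled Coxeter groups *)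

(** The usual road to CAT(0), Gromov's link condition followed by Cartan-Hadamard, goes from local
    to global. It is replaced by an induction, and the induction dictates the setting. A face or a
    hyperplane of the cover need not be a cover of the same kind, but it is again a solution set of
    the same clauses with one more coordinate frozen, so 2-clause sets are closed under cutting. The
    infinite number of walls does no harm: points at finite distance differ in finitely many
    coordinates, and only these are cut along.

    Stewart's inequality serves as induction hypothesis because it speaks of distances and of the
    existence of one point only: no geodesics are carried along, and uniqueness of that point comes
    for free.

    The key fact about W is that a wall not bounding a chamber is hidden behind one that does. It
    turns every solution of the clauses that shares a cube with a point of the cover into a point of
    the cover.

    Lifting uses no theory of covering spaces: the change of chamber between nearby points [y] and
    [z] of R_K is the explicit cocycle [flip (offset y z)]. *)

Section RightAngledCoxeter.
Context {S : choiceType} (adj : rel S).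
Local Open Scope group_scope.
Local Open Scope quotient_scope.

Inductive weq : seq S -> seq S -> Prop :=
| weq_refl l : weq l l
| weq_sym l l' : weq l l' -> weq l' l
| weq_trans l' l l'' : weq l l' -> weq l' l'' -> weq l l''
| weq_cancel l1 l2 i : weq (l1 ++ [:: i, i & l2]) (l1 ++ l2)
| weq_comm l1 l2 i j : adj i j ->
    weq (l1 ++ [:: i, j & l2]) (l1 ++ [:: j, i & l2]).

Lemma weq_ctx a b l l' : weq l l' -> weq (a ++ l ++ b) (a ++ l' ++ b).
Proof.
elim=> [k|k k' _|k k' k'' _ h1 _|l1 l2 i|l1 l2 i j ij].
- exact: weq_refl.
- exact: weq_sym.
- exact: weq_trans.
- by have := weq_cancel (a ++ l1) (l2 ++ b) i; rewrite -!catA.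
- by have := weq_comm (a ++ l1) (l2 ++ b) ij; rewrite -!catA.
Qed.

Lemma weq_cat a a' b b' : weq a a' -> weq b b' -> weq (a ++ b) (a' ++ b').
Proof.
move=> /(weq_ctx [::] b) aa' /(weq_ctx a' [::]).
by rewrite !cats0; exact: weq_trans.
Qed.

Lemma weq_rev l l' : weq l l' -> weq (rev l) (rev l').
Proof.
elim=> [k|k k' _|k k' k'' _ h1 _|l1 l2 i|l1 l2 i j ij].
- exact: weq_refl.
- exact: weq_sym.
- exact: weq_trans.
- by rewrite !rev_cat !rev_cons -!cats1 -!catA; exact: weq_cancel.
- rewrite !rev_cat !rev_cons -!cats1 -!catA; apply: weq_sym.
  exact: weq_comm.
Qed.

Lemma weq_revl l : weq (rev l ++ l) [::].
Proof.
elim: l => [|i l IH]; first exact: weq_refl.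
rewrite rev_cons cat_rcons; apply: (weq_trans _ IH).
exact: weq_cancel.
Qed.

Lemma weq_revr l : weq (l ++ rev l) [::].
Proof. by rewrite -{1}[l]revK; exact: weq_revl. Qed.

Definition weqb (l l' : seq S) : bool := `[< weq l l' >].

Lemma weqb_refl : reflexive weqb.
Proof. by move=> l; apply/asboolP; exact: weq_refl. Qed.

Lemma weqb_sym : symmetric weqb.
Proof. by move=> l l'; apply/asboolP/asboolP; exact: weq_sym. Qed.

Lemma weqb_trans : transitive weqb.
Proof. by move=> l l' l'' /asboolP h /asboolP h'; apply/asboolP; exact: weq_trans h h'. Qed.

Definition weq_equiv := EquivRel weqb weqb_refl weqb_sym weqb_trans.

Definition racg : Type := {eq_quot weq_equiv}.
HB.instance Definition _ := Choice.on racg.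
HB.instance Definition _ := Quotient.on racg.

Definition cl (l : seq S) : racg := \pi_racg l.

Lemma clP l l' : cl l = cl l' <-> weq l l'.
Proof. by split=> [/eqmodP/asboolP//|h]; apply/eqmodP/asboolP. Qed.

Lemma repr_cl l : weq (repr (cl l)) l.
Proof. by apply/clP; rewrite /cl reprK. Qed.

Lemma cl_surj (w : racg) : exists l, w = cl l.
Proof. by exists (repr w); rewrite /cl reprK. Qed.

Definition racg_mul (a b : racg) : racg := cl (repr a ++ repr b).
Definition racg_one : racg := cl [::].
Definition racg_inv (a : racg) : racg := cl (rev (repr a)).

Lemma racg_mulE l l' : racg_mul (cl l) (cl l') = cl (l ++ l').
Proof. by apply/clP/weq_cat; exact: repr_cl. Qed.

Lemma racg_invE l : racg_inv (cl l) = cl (rev l).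
Proof. by apply/clP/weq_rev; exact: repr_cl. Qed.

Lemma racg_mulA : associative racg_mul.
Proof.
move=> a b c; have [[l ->] [l' ->] [l'' ->]] := And3 (cl_surj a) (cl_surj b) (cl_surj c).
by rewrite !racg_mulE catA.
Qed.

Lemma racg_mul1g : left_id racg_one racg_mul.
Proof. by move=> a; have [l ->] := cl_surj a; rewrite racg_mulE. Qed.

Lemma racg_mulg1 : right_id racg_one racg_mul.
Proof. by move=> a; have [l ->] := cl_surj a; rewrite racg_mulE cats0. Qed.

Lemma racg_mulVg : left_inverse racg_one racg_inv racg_mul.
Proof.
move=> a; have [l ->] := cl_surj a; rewrite racg_invE racg_mulE.
by apply/clP; exact: weq_revl.
Qed.

Lemma racg_mulgV : right_inverse racg_one racg_inv racg_mul.
Proof.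
move=> a; have [l ->] := cl_surj a; rewrite racg_invE racg_mulE.
by apply/clP; exact: weq_revr.
Qed.

HB.instance Definition _ := isGroup.Build racg
  racg_mulA racg_mul1g racg_mulg1 racg_mulVg racg_mulgV.

Implicit Types (u v w r z : racg) (l : seq S) (i j k : S).

Lemma cl_cat l l' : cl (l ++ l') = cl l * cl l'.
Proof. by rewrite -racg_mulE. Qed.

Lemma cl_nil : cl [::] = 1. Proof. by []. Qed.

Lemma cl_rev l : cl (rev l) = (cl l)^-1.
Proof. by rewrite -racg_invE. Qed.

Definition gen i : racg := cl [:: i].

Lemma cl_cons i l : cl (i :: l) = gen i * cl l.
Proof. by rewrite -cl_cat. Qed.

Lemma cl_rcons i l : cl (rcons l i) = cl l * gen i.
Proof. by rewrite -cats1 cl_cat. Qed.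

Lemma genK i : gen i * gen i = 1.
Proof. by rewrite -cl_cat; apply/clP; exact: (weq_cancel [::] [::]). Qed.

Lemma genV i : (gen i)^-1 = gen i.
Proof. exact/mulg1_eq/genK. Qed.

Lemma gen_comm i j : adj i j -> gen i * gen j = gen j * gen i.
Proof.
by move=> ij; rewrite -!cl_cat; apply/clP; exact: (weq_comm [::] [::]).
Qed.

(** The [i]-th coordinate of the abelianisation of W, a power of Z/2; both relations preserve the
    parity of the number of letters [i]. *)
Definition ab w i : bool := odd (count_mem i (repr w)).

Lemma ab_cl l i : ab (cl l) i = odd (count_mem i l).
Proof.
rewrite /ab; move: (repr (cl l)) (repr_cl l) => l0 h; elim: h => {l l0} [| |? ? ? _ -> _ ->|l1 l2 j|l1 l2 j k _] //.
- by rewrite !count_cat /= !oddD addKb.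
- by rewrite !count_cat /= (addnCA (j == i)).
Qed.

Lemma abM u v i : ab (u * v) i = ab u i (+) ab v i.
Proof.
have [[l ->] [l' ->]] := conj (cl_surj u) (cl_surj v).
by rewrite -cl_cat !ab_cl count_cat oddD.
Qed.

Lemma ab1 i : ab 1 i = false. Proof. by rewrite -cl_nil ab_cl. Qed.

Lemma abV u i : ab u^-1 i = ab u i.
Proof.
by have := ab1 i; rewrite -(mulVg u) abM; case: (ab u i); case: (ab _ i).
Qed.

Lemma ab_gen i j : ab (gen i) j = (i == j).
Proof. by rewrite ab_cl /= addn0 oddb. Qed.

(** Conjugation is invisible in the abelianisation, where distinct generators stay distinct. *)
Lemma gen_conj_inj u i j : u * gen i * u^-1 = gen j -> i = j.
Proof.
move=> /(congr1 (ab ^~ j)); rewrite !abM abV !ab_gen eqxx.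
by case: (i =P j) => //= _; case: (ab u j).
Qed.

Lemma gen_inj : injective gen.
Proof. by move=> i j ij; apply: (@gen_conj_inj 1); rewrite mul1g invg1 mulg1. Qed.

(* The parity of the number of times the edge path spelled by [l] from [u]
   crosses the wall of the reflection [r]. *)
Fixpoint cross r u l : bool :=
  if l is i :: l' then (u * gen i * u^-1 == r) (+) cross r (u * gen i) l'
  else false.

Lemma cross_cat r u l l' :
  cross r u (l ++ l') = cross r u l (+) cross r (u * cl l) l'.
Proof.
elim: l u => [|i l IH] u /=; first by rewrite cl_nil mulg1.
by rewrite IH cl_cons mulgA addbA.
Qed.

(** A cancelling pair crosses one wall twice. For commuting letters, conjugating [gen j] by
    [v * gen i] or by [v] gives the same wall, so a swap only reorders the crossings. *)
Lemma cross_weq r u l l' : weq l l' -> cross r u l = cross r u l'.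
Proof.
have conj_comm v i j : gen i * gen j = gen j * gen i ->
    v * gen i * gen j * (v * gen i)^-1 = v * gen j * v^-1.
  by move=> ij; rewrite invgM genV -(mulgA v) ij !mulgA -(mulgA (v * _)) genK mulg1.
move=> h; elim: h u => {l l'} [//|l l' _ IH u|k' k k'' _ h1 _ h2 u|l1 l2 i u|l1 l2 i j ij u].
- by rewrite IH.
- by rewrite h1 h2.
- rewrite !cross_cat /=; congr (_ (+) _).
  by rewrite conj_comm// -(mulgA _ (gen i) (gen i)) genK mulg1 addKb.
- rewrite !cross_cat /=; congr (_ (+) _); rewrite addbCA.
  have gij := gen_comm ij; rewrite (conj_comm _ _ _ gij) (conj_comm _ _ _ (esym gij)).
  by rewrite -(mulgA _ (gen i) (gen j)) gij mulgA.
Qed.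

Lemma cross_mul r g u l : cross r (g * u) l = cross (g^-1 * r * g) u l.
Proof.
elim: l u => //= i l IH u; rewrite -!mulgA IH !mulgA; congr (_ (+) _).
by rewrite invgM !mulgA -divg_eq -[in RHS](inj_eq (mulgI g)) !mulgA mulgV mul1g divg_eq.
Qed.

Lemma crossP r u l : cross r u l ->
  exists l1 i l2, l = l1 ++ i :: l2 /\ u * cl l1 * gen i * (u * cl l1)^-1 = r.
Proof.
elim: l u => //= i l IH u; case: eqP => [<- _|_ /= /IH[l1 [j [l2 [-> <-]]]]].
  by exists [::], i, l; rewrite cl_nil mulg1.
by exists (i :: l1), j, l2; rewrite cl_cons !mulgA.
Qed.

(* The wall of [r] separates the chambers [1] and [w]. *)
Definition sep r w := cross r 1 (repr w).

Lemma sep_cl r l : sep r (cl l) = cross r 1 l.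
Proof. exact/cross_weq/repr_cl. Qed.

Lemma sep1 r : sep r 1 = false. Proof. by rewrite -cl_nil sep_cl. Qed.

(** The path from [u] to [u * v] is the translate by [u] of a path from 1 to [v], and seen from [u]
    the wall of [r] is that of [u^-1 * r * u]. *)
Lemma sepM r u v : sep r (u * v) = sep r u (+) sep (u^-1 * r * u) v.
Proof.
have [[l ->] [l' ->]] := conj (cl_surj u) (cl_surj v).
by rewrite -cl_cat !sep_cl cross_cat -cross_mul mulg1 mul1g.
Qed.

Lemma sep_gen r i : sep r (gen i) = (gen i == r).
Proof. by rewrite sep_cl /= addbF mul1g invg1 mulg1. Qed.

Lemma lenP_ex w : exists n, `[< exists l, cl l = w /\ size l = n >].
Proof. by have [l ->] := cl_surj w; exists (size l); apply/asboolP; exists l. Qed.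

Definition len w := ex_minn (lenP_ex w).

Lemma lenP w : exists l, cl l = w /\ size l = len w.
Proof. by rewrite /len; case: ex_minnP => n /asboolP. Qed.

Lemma len_le l : (len (cl l) <= size l)%N.
Proof. by rewrite /len; case: ex_minnP => n _; apply; apply/asboolP; exists l. Qed.

(** The exchange condition: a shortest word for [v] crosses the wall at some letter, and deleting
    that letter spells [r * v]. *)
Lemma sep_len r v : sep r v -> (len (r * v)%g < len v)%N.
Proof.
have [l [<- <-]] := lenP v; rewrite sep_cl => /crossP[l1 [i [l2 [-> <-]]]].
rewrite mul1g cl_cat cl_cons !mulgA mulgVK -(mulgA (cl l1)) genK mulg1.
by rewrite -cl_cat (leq_ltn_trans (len_le _))// !size_cat /= addnS.
Qed.

Lemma len_gen_lt l i : size (i :: l) = len (cl (i :: l)) -> sep (gen i) (cl (i :: l)).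
Proof.
move=> h; rewrite cl_cons sepM sep_gen eqxx mulVg mul1g /=.
apply/negP => /sep_len; rewrite -cl_cons -h ltnNge => /negP; apply.
exact: leq_trans (len_le l) _.
Qed.

Lemma first_letter w : w <> 1 -> exists i l,
  [/\ w = gen i * cl l, len w = (size l).+1 & sep (gen i) w].
Proof.
move=> w1; have [[|i l] [hl hs]] := lenP w; first by case: w1.
by exists i, l; rewrite -cl_cons -hs; split=> //; rewrite -hl len_gen_lt// hs hl.
Qed.

Lemma last_letter w : w <> 1 -> exists i v, w = v * gen i /\ (len v < len w)%N.
Proof.
move=> w1; have [l [hl hs]] := lenP w; case: (lastP l) hl hs => [|l' i] hl hs.
  by case: w1.
exists i, (cl l'); rewrite -cl_rcons hl; split=> //.
by rewrite -hs size_rcons ltnS len_le.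
Qed.

Lemma last_letterS w : w <> 1 -> exists i v, w = v * gen i /\ (len w = (len v).+1)%N.
Proof.
move=> /last_letter[i [v [wE vw]]]; exists i, v; split => //.
apply/eqP; rewrite eqn_leq vw andbT.
have [l [vE <-]] := lenP v; rewrite wE -vE -(cl_rcons i).
by rewrite (leq_trans (len_le _))// size_rcons.
Qed.

Lemma sep_ex w : w <> 1 -> exists r, sep r w.
Proof. by move=> /first_letter[i [l [_ _ h]]]; exists (gen i). Qed.

Lemma len_min (P : racg -> Prop) w : P w ->
  exists v, P v /\ forall v', P v' -> (len v <= len v')%N.
Proof.
move=> Pw; have ex : exists n, `[< exists v, P v /\ len v = n >].
  by exists (len w); apply/asboolP; exists w.
case: (ex_minnP ex) => n /asboolP[v [Pv <-]] h; exists v; split=> // v' Pv'.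
by apply: h; apply/asboolP; exists v'.
Qed.

(** * Two non-commuting generators *)

Section Dihedral.
Variables (i j : S).
Hypotheses (ij : i != j) (nij : ~~ adj i j) (nji : ~~ adj j i).

(* The infinite dihedral group acting on the line, with walls at 0 and 2. *)
Definition dih_refl k (x : int) : int :=
  (if k == i then - x else if k == j then 4 - x else x)%R.

Lemma dih_reflK k : involutive (dih_refl k).
Proof. by move=> x; rewrite /dih_refl; case: (k == i); case: (k == j); lia. Qed.

Lemma dih_refl_comm k k' x : adj k k' ->
  dih_refl k (dih_refl k' x) = dih_refl k' (dih_refl k x).
Proof.
move=> kk'; rewrite /dih_refl.
case: (eqVneq k i) kk' => [->|_].
  case: (eqVneq k' i) => // _; case: (eqVneq k' j) => [->|//]; by rewrite (negbTE nij).
case: (eqVneq k j) => [->|//]; case: (eqVneq k' i) => [->|_]; first by rewrite (negbTE nji).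
by case: (eqVneq k' j).
Qed.

Definition dih_act w (x : int) := foldr dih_refl x (repr w).

Lemma dih_act_cl l x : dih_act (cl l) x = foldr dih_refl x l.
Proof.
rewrite /dih_act; move: (repr (cl l)) (repr_cl l) => l0 h; elim: h => {l l0} [| |? ? ? _ -> _ ->|l1 l2 k|l1 l2 k k' kk'] //.
- by rewrite !foldr_cat /= dih_reflK.
- by rewrite !foldr_cat /= dih_refl_comm.
Qed.

Lemma dih_actM u v x : dih_act (u * v) x = dih_act u (dih_act v x).
Proof.
have [[l ->] [l' ->]] := conj (cl_surj u) (cl_surj v).
by rewrite -cl_cat !dih_act_cl foldr_cat.
Qed.

Fixpoint alt (b : bool) n : seq S :=
  if n is n'.+1 then (if b then i else j) :: alt (~~ b) n' else [::].

(** The point 1 lies in the chamber between the walls at 0 and 2; alternating words starting with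
    [i] push it to the left, the others to the right. *)
Lemma alt_act b n : dih_act (cl (alt b n)) 1 = (if b then 1 - n.*2%:Z else 1 + n.*2%:Z)%R.
Proof.
rewrite dih_act_cl; elim: n b => [|n IH] b; first by case: b => /=; lia.
rewrite [LHS]/= IH /dih_refl; case: b => /=.
  by rewrite eqxx doubleS; lia.
by rewrite eq_sym (negbTE ij) eqxx doubleS; lia.
Qed.

Lemma dih_word l : all (pred2 i j) l -> exists b n, cl l = cl (alt b n).
Proof.
elim: l => [|k l IH] /=; first by exists true, 0%N.
move=> /andP[kij /IH[b [n hn]]]; rewrite cl_cons hn.
have [b' ->] : exists b' : bool, k = if b' then i else j.
  by case/pred2P: kij => ->; [exists true|exists false].
case: n {hn} => [|n]; first by exists b', 1%N; rewrite -cl_cons.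
case: (eqVneq b b') => [->|bb'].
  by exists (~~ b'), n; rewrite [alt _ _]/= cl_cons mulgA genK mul1g.
have -> : b = ~~ b' by case: (b) (b') bb' => [] [].
by exists b', n.+2; rewrite -cl_cons.
Qed.

Lemma alt_split b n l1 k l2 : alt b n = l1 ++ k :: l2 ->
  l1 = alt b (size l1) /\ rcons l1 k = alt b (size l1).+1.
Proof.
elim: n b l1 => [|n IH] b [|k' l1] //=; first by case=> <-.
by case=> <- /IH[h1 h2]; rewrite -h1; split=> //; congr cons; rewrite h2.
Qed.

(** A crossing of the forbidden wall after a prefix of length [p] would equate the alternating word
    of length [p.+1] with the reflected prefix, but these send the point 1 to opposite ends of the
    line. *)
Lemma alt_sep b n : ~~ sep (gen (if b then j else i)) (cl (alt b n)).
Proof.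
rewrite sep_cl; apply/negP => /crossP[l1 [k [l2 [/alt_split[h1 h2]]]]].
move=> /(congr1 (fun x => x * (1 * cl l1))); rewrite mulgVK mul1g -cl_rcons h2.
move: (size l1) h1 {h2} => p ->.
move=> /(congr1 (dih_act^~ 1%R)).
rewrite dih_actM !alt_act dih_act_cl /= /dih_refl.
case: b => /=; rewrite doubleS.
  by rewrite eq_sym (negbTE ij) eqxx; lia.
by rewrite eqxx; lia.
Qed.

(** Write [u] as an alternating word times a shortest element [v] of its coset. A reflection spelled
    by [i] and [j] that separates [v] from 1 would shorten it, so the walls of [gen i] and [gen j]
    can only be crossed by the alternating word, which misses one of them. *)
Lemma dih_sep u : ~~ (sep (gen i) u && sep (gen j) u).
Proof.
have Pu : exists l, all (pred2 i j) l /\ u = cl l * u by exists [::]; rewrite mul1g.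
have [v [[l [ijl uE]] vmin]] :=
  len_min (P := fun v => exists l, all (pred2 i j) l /\ u = cl l * v) Pu.
have {l ijl uE} [b [n uE]] : exists b n, u = cl (alt b n) * v.
  by have [b [n h]] := dih_word ijl; exists b, n; rewrite -h.
have nsep l : all (pred2 i j) l -> ~~ sep (cl l) v.
  move=> ijl; apply/negP => /sep_len; rewrite ltnNge => /negP; apply.
  apply: vmin; exists (alt b n ++ rev l); rewrite all_cat all_rev ijl andbT; split.
    by elim: (n) (b) => //= n' IH b'; rewrite IH andbT; case: b'; rewrite eqxx ?orbT.
  by rewrite cl_cat -mulgA (mulgA (cl (rev l))) cl_rev mulVg mul1g.
have altall : all (pred2 i j) (alt b n).
  by elim: (n) (b) => //= n' IH b'; rewrite IH andbT; case: b'; rewrite eqxx ?orbT.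
have hs : ~~ sep (gen (if b then j else i)) u.
  rewrite uE sepM (negbTE (alt_sep b n)) /= -cl_rev -mulgA -cl_cons -cl_cat nsep//.
  by rewrite all_cat all_rev altall /= altall; case: b {uE altall}; rewrite eqxx ?orbT.
by case: b hs {uE altall} => /negbTE ->; rewrite ?andbF.
Qed.

End Dihedral.

(** * Walls hidden behind the walls of the base chamber *)

Hypothesis adj_sym : symmetric adj.

Lemma sep_adj i j u : sep (gen i) u -> sep (gen j) u -> i != j -> adj i j.
Proof.
move=> iu ju ij; apply/negPn/negP => nij.
have := dih_sep ij nij _ u; rewrite iu ju adj_sym => /(_ nij).
by [].
Qed.

(** Induction on the length: if [b] is the first letter of [z], the walls of [gen k] and [gen b]
    both separate [gen k * z] from 1, so [b] is adjacent to [k] and can be stripped off. *)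
Lemma centraliser_word k z : z * gen k = gen k * z -> ~~ sep (gen k) z ->
  exists l, all (adj k) l /\ cl l = z.
Proof.
have [n] := ubnP (len z); elim: n z => // n IH z zn zk nkz.
have [->|/first_letter[b [l [zE lz bz]]]] := pselect (z = 1); first by exists [::].
have kb : k != b by apply: contraNneq nkz => ->.
have kzk : sep (gen k) (gen k * z).
  by rewrite sepM sep_gen eqxx mulVg mul1g.
have bzk : sep (gen b) (gen k * z).
  rewrite -zk sepM bz sep_gen; case: eqP => // h; case/eqP: kb.
  apply: (@gen_conj_inj z); rewrite h !mulgA mulgV mul1g -!mulgA mulgV mulg1.
  by [].
have akb := sep_adj kzk bzk kb.
have bk := gen_comm akb.
set z' := cl l in zE.
have z'k : z' * gen k = gen k * z'.
  apply: (mulgI (gen b)); rewrite mulgA -zE zk zE !mulgA; congr (_ * _); exact: bk.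
have nkz' : ~~ sep (gen k) z'.
  move: nkz; rewrite zE sepM sep_gen [gen b == _]eq_sym (inj_eq gen_inj) (negbTE kb) /=.
  by rewrite -mulgA bk mulKg.
have [|l' [al' l'E]] := IH z' _ z'k nkz'.
  by have := len_le l; rewrite -/z'; lia.
by exists (b :: l'); rewrite /= akb al' cl_cons l'E.
Qed.

(** Let [u] be shortest beyond [r], and [j] the first letter of the chamber [u'] just before it. If
    something beyond [r] is not beyond [gen j], let [v] be a shortest such chamber and [v'] the one
    before it. Then [z = u'^-1 * v'] runs along the wall of [r], so it is a word in generators
    commuting with [gen k], the reflection [r] as seen from [u']. As [z] crosses the wall of
    [gen j], [gen j] commutes with [r], and reflecting [u] in [gen j] contradicts its minimality. *)
Lemma sep_hidden r u0 : sep r u0 -> (forall j, gen j <> r) ->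
  exists j, forall v, sep r v -> sep (gen j) v.
Proof.
move=> ru0 nr.
have [u [ru umin]] := len_min (P := fun u => sep r u) ru0.
have u1 : u <> 1 by move=> u1; move: ru; rewrite u1 sep1.
have [k [u' [uE lu]]] := last_letterS u1.
have nru' : ~~ sep r u' by apply/negP => /umin; rewrite lu ltnn.
have ruk : gen k = u'^-1 * r * u'.
  by move: ru; rewrite uE sepM (negbTE nru') sep_gen => /eqP.
have u'1 : u' <> 1 by move=> h; apply: (nr k); rewrite ruk h invg1 mul1g mulg1.
have [j [l [u'E lu' ju']]] := first_letter u'1.
have ju : sep (gen j) u.
  rewrite uE sepM ju' sep_gen; case: eqP => // h; case: (nr j).
  by move: h; rewrite ruk => /mulIg/mulgI.
exists j => v0 rv0; apply/negPn/negP => njv0.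
have [v [[rv njv] vmin]] := len_min (P := fun v => sep r v /\ ~~ sep (gen j) v) (conj rv0 njv0).
have v1 : v <> 1 by move=> v1; move: rv; rewrite v1 sep1.
have [b [v' [vE lv]]] := last_letterS v1.
have nrv' : ~~ sep r v'.
  apply/negP => rv'; have jv' : sep (gen j) v'.
    by apply/negPn/negP => njv'; have := vmin _ (conj rv' njv'); rewrite lv ltnn.
  have bE : gen b = v'^-1 * gen j * v'.
    by move: njv; rewrite vE sepM jv' sep_gen; case: eqP.
  (* The last letter of [v] would cross the wall of [gen j], making [v] the reflection of [v'] and
     hence shorter than [v']. *)
  have := sep_len jv'; have -> : gen j * v' = v by rewrite vE bE !mulgA mulgV mul1g.
  by rewrite lv ltnNge leqnSn.
have bE : gen b = v'^-1 * r * v'.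
  by move: rv; rewrite vE sepM (negbTE nrv') sep_gen => /eqP.
have njv' : ~~ sep (gen j) v'.
  move: njv; rewrite vE sepM sep_gen bE; case: eqP => [h|_]; last by rewrite addbF.
  by case: (nr j); move: h => /mulIg/mulgI.
set z : racg := u'^-1 * v'.
have zE : v' = u' * z by rewrite mulVKg.
have zbk : z * gen b * z^-1 = gen k.
  by rewrite bE ruk /z invgM invgK !mulgA !mulgK.
have bk : b = k := gen_conj_inj zbk.
have zk : z * gen k = gen k * z by rewrite -{2}zbk bk mulgVK.
have nkz : ~~ sep (gen k) z.
  by move: nrv'; rewrite zE sepM (negbTE nru') /= -ruk.
have [w0 [aw0 w0E]] := centraliser_word zk nkz.
have : sep (u'^-1 * gen j * u') z.
  by move: njv'; rewrite zE sepM ju'; case: sep.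
rewrite -w0E sep_cl => /crossP[w1 [c [w2 [w0c]]]]; rewrite mul1g => qE.
have [aw1 akc] : all (adj k) w1 /\ adj k c by move: aw0; rewrite w0c all_cat /= => /and3P[].
have w1k : commute (gen k) (cl w1).
  elim: (w1) aw1 => [_|d w IHw /= /andP[ad /IHw h]]; first by rewrite cl_nil; exact: commute1.
  by rewrite cl_cons; apply: commuteM => //; exact: gen_comm.
have kq : commute (gen k) (u'^-1 * gen j * u').
  rewrite -qE; apply: commuteM; last exact: commuteV.
  by apply: commuteM => //; exact: gen_comm.
have jr : gen j * r * gen j = r.
  move: kq; rewrite /commute ruk !mulgA !mulgK => /mulIg; rewrite -!mulgA => /mulgI h.
  by rewrite mulgA -h -mulgA genK mulg1.
(* As [gen j] commutes with [r] and differs from it, [gen j * u] is still beyond [r], but shorter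
   than [u]. *)
have := umin (gen j * u); rewrite leqNgt sep_len// sepM sep_gen genV jr ru.
by case: eqP => [/nr//|_ /(_ isT)].
Qed.

End RightAngledCoxeter.

(** * Stewart's inequality and gluing *)

(* In the flat triangle the cevian [p xt] meets the segment [x0 w], [w] on
   [p x1], in the point dividing it in the ratio [s : 1 - s]; with this choice
   of [s] the length [h] of the segment drops out. *)
Lemma glue_algebra (R : realType) (t al be P0 D h u v a1 a0 x : R) :
  0 <= t <= 1 -> 0 < al -> 0 <= be -> 0 <= u -> 0 <= v -> 0 <= x -> 0 <= D ->
  D <= h + be ->
  let L := al + be in let s := t * L / ((1 - t) * al + t * L) in
  u ^+ 2 <= (1 - s) * P0 ^+ 2 + s * al ^+ 2 - s * (1 - s) * h ^+ 2 ->
  a1 ^+ 2 <= (1 - s) * D ^+ 2 + s * be ^+ 2 - s * (1 - s) * h ^+ 2 ->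
  a0 ^+ 2 <= s * h ^+ 2 - s * (1 - s) * h ^+ 2 ->
  v ^+ 2 <= (1 - t) * a0 ^+ 2 + t * a1 ^+ 2 - t * (1 - t) * D ^+ 2 ->
  x <= u + v ->
  x ^+ 2 <= (1 - t) * P0 ^+ 2 + t * L ^+ 2 - t * (1 - t) * D ^+ 2.
Proof.
move=> /andP[t0 t1] al0 be0 u0 v0 x0 D0 Dh L s hu ha1 ha0 hv hx.
pose E := (1 - t) * al + t * L.
have E0 : 0 < E by rewrite /E /L; nra.
have L0 : 0 < L by rewrite /L; lra.
(* The segment [[x0 w]] cuts the cevian in the ratio [mu : nu]. In the flat triangle [u = mu * x]
   and [v = nu * x]; [key] is the identity of squares behind this. *)
pose mu := al / E; pose nu := t * be / E.
have En0 : E != 0 by rewrite gt_eqF.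
have mu0 : 0 < mu by rewrite divr_gt0.
have nu0 : 0 <= nu by rewrite divr_ge0 ?mulr_ge0// ltW.
have mn1 : mu + nu = 1 by rewrite /mu /nu /E /L; field; rewrite -/L -/E.
have sE : s = t * L / E by [].
have s1E : 1 - s = (1 - t) * mu by rewrite sE /mu /E /L; field; rewrite -/L -/E.
have hv' : v ^+ 2 <= (1 - t) * (s * h ^+ 2 - s * (1 - s) * h ^+ 2) +
    t * ((1 - s) * D ^+ 2 + s * be ^+ 2 - s * (1 - s) * h ^+ 2) - t * (1 - t) * D ^+ 2.
  apply: le_trans hv _; rewrite lerD2r; apply: lerD; apply: ler_wpM2l => //; lra.
set U := (X in u ^+ 2 <= X) in hu; set V := (X in v ^+ 2 <= X) in hv'.
set Q := (X in _ <= X).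
have key : nu * U + mu * V = mu * nu * Q.
  rewrite /U /V /Q /nu /mu sE /E /L; field; by rewrite -/L -/E.
(* Degenerate case [t * be = 0]: the foot of the cevian lies on the cut, and [v] vanishes. *)
have [nu1|nu1] := eqVneq nu 0.
  have mu1 : mu = 1 by lra.
  have V0 : V = 0 by move: key; rewrite nu1 mu1; lra.
  have v00 : v = 0 by apply/eqP; rewrite -sqrf_eq0 eq_le sqr_ge0 andbT -V0.
  have UQ : U <= Q.
    have tb : t * be = 0.
      by move/eqP: nu1; rewrite /nu mulf_eq0 invr_eq0 (negbTE En0) orbF => /eqP.
    have st : s = t by have := s1E; rewrite mu1; lra.
    rewrite /U /Q st /L.
    move/eqP: tb; rewrite mulf_eq0 => /orP[/eqP ->|/eqP b0]; first by lra.
    have : D ^+ 2 <= h ^+ 2 by rewrite ler_sqr ?nnegrE//; lra.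
    move: t1; rewrite b0 addr0 -subr_ge0 => t1.
    by move=> /(ler_wpM2l (mulr_ge0 t0 t1)); lra.
  by apply: le_trans (le_trans hu UQ); rewrite ler_sqr ?nnegrE//; lra.
have {nu1} nu1 : 0 < nu by rewrite lt_neqAle eq_sym nu1.
rewrite -(ler_pM2l (mulr_gt0 mu0 nu1)) -key.
(* Cauchy-Schwarz in the form [mu * nu * (u + v) ^+ 2 <= nu * u ^+ 2 + mu * v ^+ 2], as
   [mu + nu = 1]. *)
apply: (@le_trans _ _ (nu * u ^+ 2 + mu * v ^+ 2)); last first.
  by apply: lerD; apply: ler_wpM2l => //; apply: ltW.
apply: (@le_trans _ _ (mu * nu * (u + v) ^+ 2)).
  have : x ^+ 2 <= (u + v) ^+ 2 by rewrite ler_sqr ?nnegrE// addr_ge0.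
  by apply: ler_wpM2l; rewrite ltW// mulr_gt0.
have -> : mu = 1 - nu by lra.
have -> : nu * u ^+ 2 + (1 - nu) * v ^+ 2 =
    (1 - nu) * nu * (u + v) ^+ 2 + (nu * u - (1 - nu) * v) ^+ 2 by ring.
by rewrite lerDl sqr_ge0.
Qed.

Section Stewart.
Context {R : realType} {P : Type} (d : P -> P -> R).
Implicit Types (t s : R) (p q r m x y z w : P) (B : set P).

(* Stewart's inequality for the cevian from [p] to the point [m] dividing
   [q, r] in the ratio [t : 1 - t]; equality holds in the Euclidean plane. *)
Definition stewart t p q r m : Prop :=
  d p m ^+ 2 <= (1 - t) * d p q ^+ 2 + t * d p r ^+ 2 - t * (1 - t) * d q r ^+ 2.

(** The point [m] is chosen before [p]. Taking [p] among the candidates for [m] therefore forces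
    uniqueness, up to distance 0. *)
Definition stewart_space B : Prop := forall q r t, B q -> B r -> 0 <= t <= 1 ->
  exists2 m, B m & forall p, B p -> stewart t p q r m.

Definition triangle_on B : Prop :=
  forall y x z, B x -> B y -> B z -> d x z <= d x y + d y z.

Hypotheses (d_ge0 : forall x y, 0 <= d x y) (d_xx : forall x, d x x = 0)
  (d_sym : forall x y, d x y = d y x).

Lemma stewartC t p q r m : stewart t p q r m <-> stewart (1 - t) p r q m.
Proof.
rewrite /stewart (d_sym r q) subKr (mulrC (1 - t) t).
by rewrite (addrC (t * _)).
Qed.

Lemma stewart_endl t q r m : 0 <= t <= 1 -> stewart t q q r m -> d q m <= t * d q r.
Proof.
move=> /andP[t0 t1]; rewrite /stewart d_xx expr0n /= mulr0 add0r => h.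
rewrite -ler_sqr ?nnegrE ?mulr_ge0// exprMn; apply: le_trans h _.
by rewrite -subr_ge0 le_eqVlt; apply/orP; left; apply/eqP; ring.
Qed.

Lemma stewart_endr t q r m : 0 <= t <= 1 -> stewart t r q r m -> d r m <= (1 - t) * d q r.
Proof.
move=> /andP[t0 t1] /stewartC /stewart_endl; rewrite (d_sym r q); apply.
by rewrite subr_ge0 t1 gerBl.
Qed.

(** The inequality for the cevian from [m] itself to the Stewart point [m0] gives [d m m0 = 0], so
    the distances to [q] and [r] determine the point. *)
Lemma stewart_mid B t q r m : triangle_on B -> stewart_space B ->
  B q -> B r -> B m -> 0 <= t <= 1 ->
  d q m <= t * d q r -> d r m <= (1 - t) * d q r ->
  forall p, B p -> stewart t p q r m.
Proof.
move=> tri SB Bq Br Bm t01 qm rm p Bp; have [m0 Bm0 h] := SB _ _ _ Bq Br t01.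
have /andP[t0 t1] := t01.
have mm0 : d m m0 = 0.
  apply/eqP; rewrite -sqrf_eq0 eq_le sqr_ge0 andbT; apply: le_trans (h _ Bm) _.
  have h1 : d m q ^+ 2 <= (t * d q r) ^+ 2 by rewrite ler_sqr ?nnegrE ?mulr_ge0// d_sym.
  have h2 : d m r ^+ 2 <= ((1 - t) * d q r) ^+ 2.
    by rewrite ler_sqr ?nnegrE ?mulr_ge0// ?subr_ge0// d_sym.
  have := ler_wpM2l t0 h2; have : 0 <= 1 - t by rewrite subr_ge0.
  by move=> /ler_wpM2l/(_ _ _ h1); move: (d q r) (d m q) (d m r) => D a b; nra.
apply: le_trans (h _ Bp); rewrite ler_sqr ?nnegrE//.
by apply: le_trans (tri m0 _ _ Bp Bm0 Bm) _; rewrite (d_sym m0) mm0 addr0.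
Qed.

(** Alexandrov's lemma for Stewart's inequality: the triangle [p x0 x1] is cut along [[x0, w]], and
    [a] is the point of the cut that the cevian from [p] would meet in the plane. *)
Lemma glue_triangles B t p x0 x1 w xt : triangle_on B ->
  B p -> B x0 -> B x1 -> B w -> B xt -> 0 <= t <= 1 ->
  d p x1 = d p w + d w x1 ->
  (forall s, 0 <= s <= 1 -> exists2 a, B a &
    [/\ stewart s p x0 w a, stewart s x1 x0 w a, stewart s x0 x0 w a
      & stewart t a x0 x1 xt]) ->
  stewart t w x0 x1 xt -> stewart t p x0 x1 xt.
Proof.
move=> tri Bp Bx0 Bx1 Bw Bxt t01 pwx ha hw.
have [pw0|pw0] := eqVneq (d p w) 0.
  have pq y : B y -> d p y = d w y.
    move=> By; apply/eqP; rewrite eq_le.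
    have := tri _ _ _ Bp Bw By; have := tri _ _ _ Bw Bp By.
    by rewrite (d_sym w p) pw0 !add0r => -> ->.
  by move: hw; rewrite /stewart !pq.
have {pw0} pw0 : 0 < d p w by rewrite lt_neqAle eq_sym pw0 d_ge0.
set al := d p w in pwx pw0; set be := d w x1 in pwx.
have be0 : 0 <= be := d_ge0 _ _.
pose s := t * (al + be) / ((1 - t) * al + t * (al + be)).
have /andP[t0 t1] := t01.
have E0 : 0 < (1 - t) * al + t * (al + be) by nra.
have s01 : 0 <= s <= 1.
  rewrite /s divr_ge0/=; [|by rewrite mulr_ge0// addr_ge0// ltW|by rewrite ltW].
  by rewrite ler_pdivrMr// mul1r; nra.
have [a Ba [h1 h2 h3 h4]] := ha _ s01.
rewrite /stewart pwx.
apply: (@glue_algebra R t al be _ _ (d x0 w) (d p a) (d a xt) (d a x1) (d a x0)) => //.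
- exact: tri.
- by move: h2; rewrite /stewart (d_sym x1 a) (d_sym x1 x0) (d_sym x1 w).
- by move: h3; rewrite /stewart d_xx (d_sym x0 a) expr0n /= mulr0 add0r.
- exact: tri.
Qed.

(** Moving from [w] the fraction [s] towards [p] to a point [u] cannot make the route from [q] over
    [u] to [r] shorter than [d q r]. This gives [(1 - s) * d p w ^+ 2 <= K] for all [s > 0], and the
    claim in the limit. *)
Lemma first_variation B p q r w : triangle_on B -> B q -> B r -> B w -> 0 < d q r ->
  d q r = d q w + d w r ->
  (forall s, 0 < s <= 1 -> exists2 u, B u & stewart s q w p u /\ stewart s r w p u) ->
  stewart (d q w / d q r) p q r w.
Proof.
move=> tri Bq Br Bw D0 qwr hu; rewrite /stewart.
set D := d q r in D0 qwr *; set si := d q w / D.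
have qw : d q w = si * D by rewrite /si mulfVK// gt_eqF.
have wr : d w r = (1 - si) * D by move: qwr; rewrite qw; lra.
have si0 : 0 <= si by rewrite divr_ge0// ltW.
have si1 : 0 <= 1 - si by rewrite -(pmulr_lge0 _ D0) -wr.
set K := (1 - si) * d p q ^+ 2 + si * d p r ^+ 2 - si * (1 - si) * D ^+ 2.
have bound s : 0 < s <= 1 -> (1 - s) * d p w ^+ 2 <= K.
  move=> s01; have /andP[s0 s1] := s01; have [u Bu [uq ur]] := hu _ s01.
  have h1 : D ^+ 2 <= (d q u + d u r) ^+ 2.
    by rewrite ler_sqr ?nnegrE ?addr_ge0 ?(ltW D0)//; exact: tri.
  have h2 : si * (1 - si) * (d q u + d u r) ^+ 2 <= (1 - si) * d q u ^+ 2 + si * d u r ^+ 2.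
    rewrite -subr_ge0 (_ : _ - _ = ((1 - si) * d q u - si * d u r) ^+ 2) ?sqr_ge0//.
    by ring.
  move: uq ur; rewrite /stewart (d_sym w p) (d_sym r u) (d_sym r w) wr qw => uq ur.
  have h3 := le_trans (ler_wpM2l (mulr_ge0 si0 si1) h1) h2.
  have h4 := ler_wpM2l si1 uq; have h5 := ler_wpM2l si0 ur.
  rewrite -(ler_pM2l s0) /K (d_sym p q) (d_sym p r).
  by move: h3 h4 h5; lra.
rewrite leNgt; apply/negP => gap.
set g := d p w ^+ 2 - K; have g0 : 0 < g by rewrite subr_gt0.
have H0 : 0 <= d p w ^+ 2 := sqr_ge0 _.
have G0 : 0 < 2 * d p w ^+ 2 + g by lra.
(* Small enough that [s * d p w ^+ 2 < g], which contradicts [bound s]. *)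
pose s := g / (2 * d p w ^+ 2 + g).
have := bound s; rewrite /s divr_gt0//= ler_pdivrMr// mul1r => hb.
have {hb} : (1 - s) * d p w ^+ 2 <= K by apply: hb; lra.
rewrite leNgt => /negP; apply.
have : s * d p w ^+ 2 < g.
  by rewrite /s mulrAC ltr_pdivrMr// ltr_pM2l//; lra.
by rewrite /s /g; lra.
Qed.

Lemma stewart_comp tau si p q r w m : 0 <= tau <= 1 ->
  d q w = si * d q r -> stewart si p q r w -> stewart tau p q w m ->
  stewart (tau * si) p q r m.
Proof.
move=> /andP[t0 t1] qw; rewrite /stewart qw => h /le_trans; apply.
by have := ler_wpM2l t0 h; lra.
Qed.

Section TwoPieces.
Variables (B1 B2 : set P).
Hypotheses (tri : triangle_on (B1 `|` B2))
  (SP1 : stewart_space B1) (SP2 : stewart_space B2) (SPA : stewart_space (B1 `&` B2))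
  (crossing : forall x z, B1 x -> B2 z ->
    exists2 a, (B1 `&` B2) a & d x z = d x a + d a z).

Let tri1 : triangle_on B1. Proof. by move=> y x z ? ? ?; apply: tri; left. Qed.
Let tri2 : triangle_on B2. Proof. by move=> y x z ? ? ?; apply: tri; right. Qed.

(** A point [p] of [B2] reaches [q] and [r] through [w0] and [w1] in the intersection. The triangle
    is assembled by two cuts: [p w0 r] along [[w0, w1]], which both pieces contain, and then [p q r]
    along [[r, w0]], which lies in [B1]. *)
Lemma stewart_one_sided q r t m : B1 q -> B1 r -> B1 m -> 0 <= t <= 1 ->
  (forall p, B1 p -> stewart t p q r m) ->
  forall p, (B1 `|` B2) p -> stewart t p q r m.
Proof.
move=> B1q B1r B1m t01 hm p [/hm//|B2p].
have [w0 [B1w0 B2w0] q0] := crossing B1q B2p.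
have [w1 [B1w1 B2w1] r1] := crossing B1r B2p.
have l x : B1 x -> (B1 `|` B2) x by left.
have rr x : B2 x -> (B1 `|` B2) x by right.
have half s z : 0 <= s <= 1 -> B1 z -> (forall p', B1 p' -> stewart s p' w0 r z) ->
    stewart s p w0 r z.
  move=> s01 B1z hz.
  apply: (glue_triangles tri (w := w1)) => //; try by [left|right].
  - by rewrite d_sym r1 addrC d_sym (d_sym r).
  - move=> s' s'01; have [a [B1a B2a] ha] := SPA (conj B1w0 B2w0) (conj B1w1 B2w1) s'01.
    have wa : d w0 a <= s' * d w0 w1 by apply: stewart_endl => //; exact: ha.
    have wa1 : d w1 a <= (1 - s') * d w0 w1 by apply: stewart_endr => //; exact: ha.
    exists a; [by left|split; last exact: hz].
    + exact: (stewart_mid tri2).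
    + exact: (stewart_mid tri1).
    + exact: (stewart_mid tri1).
  - exact: hz.
have t01' : 0 <= 1 - t <= 1 by move: t01; lra.
apply/stewartC; apply: (glue_triangles tri (w := w0)) => //; try by [left|right].
- by rewrite d_sym q0 addrC d_sym (d_sym q).
- move=> s s01; have [a B1a ha] := SP1 B1r B1w0 s01.
  exists a; [by left|split]; try exact: ha.
  + apply/stewartC; apply: half => //; first by move: s01; lra.
    by move=> p' B1p'; apply/stewartC; rewrite subKr; exact: ha.
  + by apply/stewartC; rewrite subKr; exact: hm.
- by apply/stewartC; rewrite subKr; exact: hm.
Qed.

End TwoPieces.

(** By [first_variation] the crossing point [w] is itself the Stewart point for its ratio [si]. The
    point for [t] is then taken on [[q, w]] or on [[r, w]], each inside one piece. *)
Lemma stewart_mixed B1 B2 q r t :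
  triangle_on (B1 `|` B2) ->
  stewart_space B1 -> stewart_space B2 -> stewart_space (B1 `&` B2) ->
  (forall x z, B1 x -> B2 z -> exists2 a, (B1 `&` B2) a & d x z = d x a + d a z) ->
  B1 q -> B2 r -> 0 <= t <= 1 ->
  exists2 m, (B1 `|` B2) m & forall p, (B1 `|` B2) p -> stewart t p q r m.
Proof.
move=> tri SP1 SP2 SPA cr B1q B2r t01; have /andP[t0 t1] := t01.
have tri' : triangle_on (B2 `|` B1) by rewrite setUC.
have SPA' : stewart_space (B2 `&` B1) by rewrite setIC.
have cr' x z : B2 x -> B1 z -> exists2 a, (B2 `&` B1) a & d x z = d x a + d a z.
  move=> B2x B1z; have [a [B1a B2a] h] := cr _ _ B1z B2x.
  by exists a => //; rewrite (d_sym x z) h addrC (d_sym z a) (d_sym a x).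
have [D0|D0] := eqVneq (d q r) 0.
  exists q; first by left.
  move=> p Bp; rewrite /stewart D0 expr0n /= mulr0 subr0.
  have h : d p q <= d p r.
    by rewrite -[leRHS]addr0 -D0 (d_sym q); apply: tri => //; [right|left].
  have : d p q ^+ 2 <= d p r ^+ 2 by rewrite ler_sqr ?nnegrE.
  by move=> /(ler_wpM2l t0); lra.
have {}D0 : 0 < d q r by rewrite lt_neqAle eq_sym D0 d_ge0.
have [w [B1w B2w] qwr] := cr _ _ B1q B2r.
set si := d q w / d q r.
have qw : d q w = si * d q r by rewrite /si mulfVK// gt_eqF.
have rw : d r w = (1 - si) * d q r by rewrite (d_sym r); move: qwr; rewrite qw; lra.
have si0 : 0 <= si by rewrite divr_ge0.
have si1 : 0 <= 1 - si by rewrite -(pmulr_lge0 _ D0) -rw.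
have hw p : (B1 `|` B2) p -> stewart si p q r w.
  move=> Bp; apply: (first_variation tri) => //; try by [left|right].
  move=> s /andP[s0 s1]; have s01 : 0 <= s <= 1 by rewrite ltW.
  case: Bp => [B1p|B2p].
  - have [u B1u hu] := SP1 _ _ _ B1w B1p s01.
    exists u; [by left|split; first exact: hu].
    by apply: (stewart_one_sided tri) => //; right.
  - have [u B2u hu] := SP2 _ _ _ B2w B2p s01.
    exists u; [by right|split; last exact: hu].
    by apply: (stewart_one_sided tri') => //; right.
have [tsi|tsi] := leP t si.
- pose tau := t / si.
  have tE : t = tau * si.
    by rewrite /tau; have [s0|s0] := eqVneq si 0; [rewrite s0; lra|rewrite mulfVK].
  have tau01 : 0 <= tau <= 1.
    rewrite /tau divr_ge0//=; have [->|s0] := eqVneq si 0; first by rewrite invr0 mulr0.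
    by rewrite ler_pdivrMr ?mul1r// lt_neqAle eq_sym s0.
  have [m B1m hm] := SP1 _ _ _ B1q B1w tau01.
  exists m; first by left.
  move=> p Bp; rewrite tE; apply: stewart_comp qw (hw _ Bp) _ => //.
  exact: (stewart_one_sided tri).
- pose tau := (1 - t) / (1 - si).
  have s0 : 0 < 1 - si by lra.
  have tE : 1 - t = tau * (1 - si) by rewrite /tau mulfVK// gt_eqF.
  have tau01 : 0 <= tau <= 1.
    apply/andP; split; first by rewrite divr_ge0// subr_ge0.
    by rewrite /tau ler_pdivrMr// mul1r lerD2l lerN2 ltW.
  have [m B2m hm] := SP2 _ _ _ B2r B2w tau01.
  exists m; first by right.
  move=> p Bp; apply/stewartC; rewrite tE; apply: (stewart_comp (w := w)) => //.
  + by rewrite (d_sym r q).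
  + by apply/stewartC; rewrite subKr; exact: hw.
  + by apply: (stewart_one_sided tri') => //; rewrite setUC.
Qed.

(* Reshetnyak's gluing theorem. *)
Lemma stewart_glue B1 B2 : triangle_on (B1 `|` B2) ->
  stewart_space B1 -> stewart_space B2 -> stewart_space (B1 `&` B2) ->
  (forall x z, B1 x -> B2 z -> exists2 a, (B1 `&` B2) a & d x z = d x a + d a z) ->
  stewart_space (B1 `|` B2).
Proof.
move=> tri SP1 SP2 SPA cr.
have tri' : triangle_on (B2 `|` B1) by rewrite setUC.
have SPA' : stewart_space (B2 `&` B1) by rewrite setIC.
have cr' x z : B2 x -> B1 z -> exists2 a, (B2 `&` B1) a & d x z = d x a + d a z.
  move=> B2x B1z; have [a [B1a B2a] h] := cr _ _ B1z B2x.
  by exists a => //; rewrite (d_sym x z) h addrC (d_sym z a) (d_sym a x).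
move=> q r t [B1q|B2q] [B1r|B2r] t01.
- have [m B1m hm] := SP1 _ _ _ B1q B1r t01.
  by exists m; [left|exact: (stewart_one_sided tri)].
- exact: stewart_mixed.
- by rewrite setUC; exact: stewart_mixed.
- have [m B2m hm] := SP2 _ _ _ B2q B2r t01.
  exists m; first by right.
  by move=> p Bp; apply: (stewart_one_sided tri') => //; rewrite setUC.
Qed.

End Stewart.

(** * Chain metrics on 2-clause sets *)

Section ChainMetric.
Context {R : realType} {P : Type} (step : P -> P -> Prop) (e : P -> P -> R).
Hypotheses (step_sym : forall x y, step x y -> step y x)
  (step_refl : forall x y, step x y -> step x x)
  (e_ge0 : forall x y, 0 <= e x y) (e_sym : forall x y, e x y = e y x).

Inductive chain : P -> P -> R -> Prop :=
| chain0 x : step x x -> chain x x 0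
| chainS y x z L : step x y -> chain y z L -> chain x z (e x y + L).

Definition conn x y := exists L, chain x y L.
(** The infimum of the empty set is 0, so this is a distance only between connected points; hence
    the [conn] hypotheses. *)
Definition cdist x y := inf [set L | chain x y L].

Lemma chain_ge0 x y L : chain x y L -> 0 <= L.
Proof. by elim=> // *; rewrite addr_ge0. Qed.

Lemma chain_refl x y L : chain x y L -> step x x.
Proof. by case=> // z {}x {}y {}L xz _; exact: step_refl xz. Qed.

Lemma chain1 x y : step x y -> chain x y (e x y).
Proof.
move=> xy; rewrite -[e x y]addr0; apply: chainS (xy) _; apply: chain0.
exact: step_refl (step_sym xy).
Qed.

Lemma chain_cat x y z L L' : chain x y L -> chain y z L' -> chain x z (L + L').
Proof.
move=> h; elim: h L' => [{}x _ L'|u {}x {}y {}L xu _ IH L' yz]; first by rewrite add0r.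
by rewrite -addrA; apply: chainS xu _; exact: IH.
Qed.

Lemma chain_sym x y L : chain x y L -> chain y x L.
Proof.
elim=> [u uu|u v w L' vu _ IH]; first exact: chain0.
by rewrite addrC e_sym; apply: chain_cat IH (chain1 _); exact: step_sym.
Qed.

Lemma conn_sym x y : conn x y -> conn y x.
Proof. by move=> [L /chain_sym]; exists L. Qed.

Lemma conn_trans y x z : conn x y -> conn y z -> conn x z.
Proof. by move=> [L xy] [L' yz]; exists (L + L'); exact: chain_cat yz. Qed.

Lemma conn1 x y : step x y -> conn x y.
Proof. by move=> /chain1; exists (e x y). Qed.

Lemma cdist_le x y L : chain x y L -> cdist x y <= L.
Proof.
move=> h; apply: ge_inf => //; exists 0 => L' /=; exact: chain_ge0.
Qed.

Lemma cdist_ge x y c : conn x y -> (forall L, chain x y L -> c <= L) -> c <= cdist x y.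
Proof. by move=> [L h] hc; apply: lb_le_inf => //; exists L. Qed.

Lemma cdist_ge0 x y : 0 <= cdist x y.
Proof.
have [h|h] := pselect (conn x y); first by apply: cdist_ge => // L /chain_ge0.
rewrite /cdist (_ : [set _ | _] = set0) ?inf0//.
by apply/seteqP; split=> // L /= ?; apply: h; exists L.
Qed.

Lemma cdist_lt x y c : conn x y -> cdist x y < c -> exists2 L, chain x y L & L < c.
Proof. by move=> [L h] /inf_lt[|L' h' lt]; [exists L|exists L']. Qed.

Lemma cdist_sym x y : cdist x y = cdist y x.
Proof. by congr inf; apply/seteqP; split=> L /=; exact: chain_sym. Qed.

Lemma cdist_xx x : cdist x x = 0.
Proof.
apply/eqP; rewrite eq_le cdist_ge0 andbT.
have [h|h] := pselect (step x x); first exact: cdist_le (chain0 h).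
rewrite /cdist (_ : [set _ | _] = set0) ?inf0//.
by apply/seteqP; split=> // L /= /chain_refl.
Qed.

Lemma cdist_tri y x z : conn x y -> conn y z -> cdist x z <= cdist x y + cdist y z.
Proof.
move=> xy yz; apply/ler_addgt0Pr => eps eps0.
have [|L hL Le] := @cdist_lt x y (cdist x y + eps / 2) xy; first by rewrite ltrDl divr_gt0.
have [|L' hL' Le'] := @cdist_lt y z (cdist y z + eps / 2) yz; first by rewrite ltrDl divr_gt0.
have := cdist_le (chain_cat hL hL'); lra.
Qed.

Lemma cdist_step x y : step x y -> cdist x y <= e x y.
Proof. by move=> /chain1 /cdist_le. Qed.

Section Map.
Variable f : P -> P.
Hypothesis f_step : forall x y, step x y -> step (f x) (f y) /\ e (f x) (f y) <= e x y.

Lemma chain_map x y L : chain x y L -> exists2 L', chain (f x) (f y) L' & L' <= L.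
Proof.
elim=> [u /f_step[uu _]|u v w {}L vu _ [L' uw L'L]]; first by exists 0 => //; exact: chain0.
have [fvu le] := f_step vu.
by exists (e (f v) (f u) + L'); [exact: chainS uw|exact: lerD].
Qed.

Lemma conn_map x y : conn x y -> conn (f x) (f y).
Proof. by move=> [L /chain_map[L' h _]]; exists L'. Qed.

Lemma cdist_map x y : conn x y -> cdist (f x) (f y) <= cdist x y.
Proof.
move=> xy; apply: cdist_ge => // L /chain_map[L' h]; apply: le_trans.
exact: cdist_le.
Qed.
End Map.

End ChainMetric.

(** * Points and cubes of a 2-clause set *)

Section Clauses.
Context {R : realType} {T : choiceType} (C : T * bool -> T * bool -> Prop).
Implicit Types (x y z u v b : T -> R) (h t : T) (N : set T) (l : T * bool).

Definition sg (s : bool) : R := if s then 1 else -1.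

Definition lit x l : Prop := x l.1 = sg l.2.

Definition fin_diff x z : Prop := exists s : seq T, forall t, t \notin s -> x t = z t.

(* The points [x] with [compat x x] form the 2-clause set; [compat x z] says
   that [x] and [z] lie in a common closed cube of it. *)
Definition compat x z : Prop :=
  [/\ forall t, -1 <= x t <= 1, forall t, -1 <= z t <= 1, fin_diff x z
    & forall l l', C l l' -> lit x l /\ lit z l \/ lit x l' /\ lit z l'].

(** A sum of infinite support defaults to 0; the clause [fin_diff] of [compat] keeps this value from
    shortening chains. *)
Definition eucl x z : R := Num.sqrt (\sum_(t \in [set: T]) (x t - z t) ^+ 2).

Lemma fin_diff_sym x z : fin_diff x z -> fin_diff z x.
Proof. by move=> [s h]; exists s => t /h. Qed.

Lemma fin_diff_refl x : fin_diff x x. Proof. by exists [::]. Qed.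

Lemma fin_diff_uniq x z (s0 : seq T) : fin_diff x z -> exists2 s, uniq s &
  {subset s0 <= s} /\ forall t, t \notin s -> x t = z t.
Proof.
move=> [s h]; exists (undup (s0 ++ s)); first exact: undup_uniq.
split=> t; first by rewrite mem_undup mem_cat => ->.
by rewrite mem_undup mem_cat negb_or => /andP[_ /h].
Qed.

Lemma euclE x z (s : seq T) : uniq s -> (forall t, t \notin s -> x t = z t) ->
  eucl x z = Num.sqrt (\sum_(t <- s) (x t - z t) ^+ 2).
Proof.
move=> us hs; rewrite /eucl [in RHS]fsbig_seq//; congr Num.sqrt; apply/esym.
apply: fsbig_widen => // t [_ /= /negP/hs ->].
by rewrite subrr expr0n.
Qed.

Lemma eucl_sqE x z (s : seq T) : uniq s -> (forall t, t \notin s -> x t = z t) ->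
  eucl x z ^+ 2 = \sum_(t <- s) (x t - z t) ^+ 2.
Proof.
by move=> us hs; rewrite (euclE us hs) sqr_sqrtr// sumr_ge0// => *; exact: sqr_ge0.
Qed.

Lemma eucl_ge0 x z : 0 <= eucl x z. Proof. exact: sqrtr_ge0. Qed.

Lemma eucl_sym x z : eucl x z = eucl z x.
Proof. by congr Num.sqrt; apply: eq_fsbigr => t _; rewrite -sqrrN opprB. Qed.

Lemma eucl_mono x z x' z' : fin_diff x' z' ->
  (forall t, `|x t - z t| <= `|x' t - z' t|) -> eucl x z <= eucl x' z'.
Proof.
move=> /(@fin_diff_uniq _ _ [::])[s us [_ hs]] le.
have hs' t : t \notin s -> x t = z t.
  by move=> /hs e; have := le t; rewrite e subrr normr0 normr_le0 subr_eq0 => /eqP.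
rewrite (euclE us hs) (euclE us hs'); apply: ler_wsqrtr.
apply: ler_sum => t _; rewrite -[X in X <= _]real_normK ?num_real//.
by rewrite -[X in _ <= X]real_normK ?num_real// ler_sqr ?nnegrE.
Qed.

Lemma eucl_coord x z t : fin_diff x z -> `|x t - z t| <= eucl x z.
Proof.
move=> /(@fin_diff_uniq _ _ [:: t])[s us [ts hs]].
rewrite -(ler_sqr (normr_ge0 _))// ?nnegrE ?eucl_ge0// (eucl_sqE us hs) real_normK ?num_real//.
rewrite (bigD1_seq t) ?ts ?mem_head//= lerDl sumr_ge0// => *; exact: sqr_ge0.
Qed.

Lemma eucl_bound x z (s : seq T) (c : R) : uniq s -> (forall t, t \notin s -> x t = z t) ->
  (forall t, `|x t - z t| <= c) -> eucl x z <= (size s)%:R * c.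
Proof.
move=> us hs hc; case: s us hs => [|t0 s] us hs.
  by rewrite (euclE us hs) big_nil sqrtr0 mul0r.
have c0 : 0 <= c := le_trans (normr_ge0 _) (hc t0).
rewrite -ler_sqr ?nnegrE ?eucl_ge0 ?mulr_ge0// (eucl_sqE us hs).
apply: (@le_trans _ _ (\sum_(t <- t0 :: s) c ^+ 2)).
  apply: ler_sum => t _; rewrite -real_normK ?num_real// ler_sqr ?nnegrE//.
rewrite big_const_seq count_predT iter_addr_0 exprMn -[leLHS]mulr_natl.
apply: ler_wpM2r; first exact: sqr_ge0.
by rewrite -natrX ler_nat -mulnn leq_pmull.
Qed.

Definition upd x h (c : R) : T -> R := fun t => if t == h then c else x t.

Lemma fin_diff_upd x z h c c' : fin_diff x z -> fin_diff (upd x h c) (upd z h c').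
Proof.
move=> [s hs]; exists (h :: s) => t; rewrite inE negb_or /upd => /andP[/negbTE -> /hs].
by [].
Qed.

Lemma eucl_upd x z h c c' : fin_diff x z ->
  eucl (upd x h c) (upd z h c') ^+ 2 = (c - c') ^+ 2 + eucl (upd x h 0) (upd z h 0) ^+ 2.
Proof.
move=> /(@fin_diff_uniq _ _ [:: h])[s us [hs' hs]].
have hin : h \in s by apply: hs'; rewrite mem_head.
have off c1 c2 t : t \notin s -> upd x h c1 t = upd z h c2 t.
  by move=> ts; rewrite /upd ifN ?ifN ?hs//; apply: contraNneq ts => ->.
rewrite !(eucl_sqE us)//; try by move=> ?; exact: off.
rewrite !(bigD1_seq h)//= /upd eqxx subrr expr0n /= add0r; congr (_ + _).
by apply: eq_bigr => t th; rewrite (negbTE th).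
Qed.

Lemma upd_id x h : upd x h (x h) = x.
Proof. by apply/funext => t; rewrite /upd; case: eqP => // ->. Qed.

Lemma upd_upd x h c c' : upd (upd x h c) h c' = upd x h c'.
Proof. by apply/funext => t; rewrite /upd; case: eqP. Qed.

Lemma upd_eq x h c : upd x h c h = c. Proof. by rewrite /upd eqxx. Qed.

Lemma compat_sym x z : compat x z -> compat z x.
Proof.
move=> [x1 z1 xz h]; split=> //; first exact: fin_diff_sym.
by move=> l l' /h[[? ?]|[? ?]]; [left|right].
Qed.

Lemma compat_refl x z : compat x z -> compat x x.
Proof.
move=> [x1 z1 xz h]; split=> //; first exact: fin_diff_refl.
by move=> l l' /h[[? ?]|[? ?]]; [left|right].
Qed.

(** Only a common literal on [h] could be lost, and there is none. *)
Lemma compat_upd x z h c c' : compat x z -> -1 <= c <= 1 -> -1 <= c' <= 1 ->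
  (forall s, ~ (x h = sg s /\ z h = sg s)) -> compat (upd x h c) (upd z h c').
Proof.
move=> [x1 z1 xz hx] c1 c'1 nh; split=> [t|t||].
- by rewrite /upd; case: ifP.
- by rewrite /upd; case: ifP.
- exact: fin_diff_upd.
have key l : lit x l /\ lit z l -> lit (upd x h c) l /\ lit (upd z h c') l.
  move=> lxz; rewrite /lit /upd; case: eqP => // lh; case: (nh l.2).
  by rewrite -lh.
by move=> l l' /hx[/key|/key]; [left|right].
Qed.

(** Literals that fail at [x] fail by a positive margin, so a clause violated at [x] is violated at
    all points close to it. *)
Lemma compat_closed x : (forall eps : R, 0 < eps -> exists2 u, compat u u &
  forall t, `|u t - x t| < eps) -> compat x x.
Proof.
move=> hx; split.
- move=> t; rewrite -ler_norml; apply/ler_addgt0Pr => eps /hx[u [u1 _ _ _]] /(_ t).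
  have := u1 t; rewrite -ler_norml => u1t; rewrite distrC => xu.
  by have := ler_normD (x t - u t) (u t); rewrite subrK; lra.
- move=> t; rewrite -ler_norml; apply/ler_addgt0Pr => eps /hx[u [u1 _ _ _]] /(_ t).
  have := u1 t; rewrite -ler_norml => u1t; rewrite distrC => xu.
  by have := ler_normD (x t - u t) (u t); rewrite subrK; lra.
- exact: fin_diff_refl.
move=> l l' Cll'; have [|nl] := pselect (lit x l); first by left.
have [|nl'] := pselect (lit x l'); first by right.
have pos l0 : ~ lit x l0 -> 0 < `|sg l0.2 - x l0.1|.
  by move=> h; rewrite normr_gt0 subr_eq0; apply/eqP => /esym.
have [|u [_ _ _ hu] le] := hx (Num.min `|sg l.2 - x l.1| `|sg l'.2 - x l'.1|).
  by rewrite lt_min !pos.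
exfalso; have [[lu _]|[lu _]] := hu _ _ Cll'.
  by have := le l.1; rewrite lu lt_min ltxx.
by have := le l'.1; rewrite lu lt_min ltxx andbF.
Qed.

Notation chn := (chain compat eucl).
Notation con := (conn compat eucl).
Notation dist := (cdist compat eucl).

Lemma dist_ge0 x z : 0 <= dist x z.
Proof. exact: (cdist_ge0 compat eucl_ge0). Qed.

Lemma dist_sym x z : dist x z = dist z x.
Proof. exact: (cdist_sym compat_sym compat_refl eucl_sym). Qed.

Lemma dist_xx x : dist x x = 0.
Proof. exact: (cdist_xx compat_refl eucl_ge0). Qed.

Lemma dist_tri y x z : con x y -> con y z -> dist x z <= dist x y + dist y z.
Proof. exact: (cdist_tri (step := compat) eucl_ge0). Qed.

Lemma compat_con x z : compat x z -> con x z.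
Proof. exact: (conn1 eucl compat_sym compat_refl). Qed.

Lemma compat_dist x z : compat x z -> dist x z <= eucl x z.
Proof. exact: (cdist_step compat_sym compat_refl eucl_ge0). Qed.

Lemma con_sym x z : con x z -> con z x.
Proof. exact: (conn_sym compat_sym compat_refl eucl_sym). Qed.

Lemma con_refl x z : con x z -> compat x x.
Proof. by move=> [L /(chain_refl compat_refl)]. Qed.

Lemma chain_fin_diff x z L : chn x z L -> fin_diff x z.
Proof.
elim=> [u _|u v w L' [_ _ [s hs] _] _ [s' hs']]; first exact: fin_diff_refl.
exists (s ++ s') => t; rewrite mem_cat negb_or => /andP[/hs -> /hs'].
by [].
Qed.

Lemma dist_coord x z t : con x z -> `|x t - z t| <= dist x z.
Proof.
move=> xz; apply: (cdist_ge xz) => L {xz}.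
elim=> [u _|u v w L' [_ _ uv _] _ IH]; first by rewrite subrr normr0.
rewrite -(subrKA (u t)); apply: le_trans (ler_normD _ _) _.
by apply: lerD => //; exact: eucl_coord.
Qed.

(** The stopover [z] differs from [u] only where [v] is at an end of the interval and [u] is not.
    The first step then keeps all literals of [u], the second all those of [v]; the bound 2 prevents
    [u] and [v] from being at opposite ends. *)
Lemma near_dist u v : compat u u -> compat v v -> fin_diff u v ->
  (forall t, `|u t - v t| < 2) -> con u v /\ dist u v <= 2 * eucl u v.
Proof.
move=> [u1 _ _ hu] [v1 _ _ hv] uv near.
have ext w t : -1 <= w t <= 1 -> ~~ (`|w t| < 1 :> R) -> w t = 1 \/ w t = -1.
  rewrite -leNgt => /andP[w1 w2]; rewrite ler_normr => /orP[w3|w3]; [left|right]; lra.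
have nlit w l : lit w l -> ~~ (`|w l.1| < 1).
  by rewrite /lit => ->; case: l.2; rewrite /= ?normrN normr1 ltxx.
pose z t := if (`|u t| < 1) && ~~ (`|v t| < 1) then v t else u t.
have uz : compat u z.
  split=> //.
  - by move=> t; rewrite /z; case: ifP.
  - by case: uv => s hs; exists s => t /hs e; rewrite /z -e; case: ifP.
  have key l : lit u l -> lit u l /\ lit z l.
    by move=> ul; split=> //; rewrite /lit /z (negbTE (nlit _ _ ul)).
  by move=> l l' /hu[[/key]|[/key]]; [left|right].
have zv : compat z v.
  split=> //.
  - by move=> t; rewrite /z; case: ifP.
  - by case: uv => s hs; exists s => t /hs e; rewrite /z -e; case: ifP.
  have key l : lit v l -> lit z l /\ lit v l.
    move=> vl; split=> //; rewrite /lit /z (nlit _ _ vl) andbT; case: ifP => // /negbT ul.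
    have := near l.1; have [ul1|ul1] := ext u l.1 (u1 _) ul.
      have [vl1|vl1] := ext v l.1 (v1 _) (nlit _ _ vl); first by rewrite -vl ul1 vl1.
      by rewrite ul1 vl1 opprK ger0_norm// ?ltxx; lra.
    have [vl1|vl1] := ext v l.1 (v1 _) (nlit _ _ vl); last by rewrite -vl ul1 vl1.
    by rewrite ul1 vl1 ler0_norm; lra.
  by move=> l l' /hv[[/key]|[/key]]; [left|right].
have cuz := compat_con uz.
have czv := compat_con zv.
split; first exact: conn_trans cuz czv.
apply: le_trans (dist_tri cuz czv) _.
have -> : 2 * eucl u v = eucl u v + eucl u v by ring.
have d1 := compat_dist uz.
have d2 := compat_dist zv.
apply: lerD; [apply: le_trans d1 _|apply: le_trans d2 _]; apply: eucl_mono => // t.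
  by rewrite /z; case: ifP => // _; rewrite subrr normr0.
by rewrite /z; case: ifP => // _; rewrite subrr normr0.
Qed.

(** * Retraction onto a slice *)

Section Retraction.
Variables (N : set T) (b : T -> R).

Definition slice : set (T -> R) := [set x | compat x x /\ forall t, ~ N t -> x t = b t].

Hypothesis Xb : compat b b.

(** Freezing only the coordinates outside [N] could break a clause with one frozen and one free
    literal. So the coordinates on which the slice leaves no choice are frozen as well, as in unit
    propagation. *)
Definition rigid t : Prop := ~ N t \/ exists s, forall x, slice x -> x t = sg s.

Definition retract u : T -> R := fun t => if `[< rigid t >] then b t else u t.

Lemma rigidE t x : rigid t -> slice x -> x t = b t.
Proof. by case=> [Nt [_ h]|[s h] sx]; [exact: h|rewrite !h]. Qed.

Lemma retract_slice x : slice x -> retract x = x.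
Proof.
by move=> sx; apply/funext => t; rewrite /retract; case: asboolP => // /rigidE ->.
Qed.

Lemma retract_off u t : ~ N t -> retract u t = b t.
Proof. by move=> Nt; rewrite /retract asboolT//; left. Qed.

Lemma retract_compat u v : compat u v ->
  compat (retract u) (retract v) /\ eucl (retract u) (retract v) <= eucl u v.
Proof.
move=> [u1 v1 uv huv]; have [b1 _ _ _] := Xb; split; last first.
  by apply: eucl_mono => // t; rewrite /retract; case: ifP => // _; rewrite subrr normr0.
split=> [t|t||].
- by rewrite /retract; case: ifP.
- by rewrite /retract; case: ifP.
- by case: uv => s hs; exists s => t /hs e; rewrite /retract e.
have key l l' : C l l' \/ C l' l -> rigid l.1 ->
    lit (retract u) l /\ lit (retract v) l \/ lit (retract u) l' /\ lit (retract v) l'.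
  move=> Cll' rl; rewrite /lit /retract (asboolT rl).
  have [bl|nbl] := pselect (b l.1 = sg l.2); first by left.
  right; have hx x : slice x -> x l'.1 = sg l'.2.
    move=> sx; have [[_ _ _ hx] _] := sx.
    have nx : ~ lit x l by rewrite /lit (rigidE rl sx).
    by case: Cll' => /hx[[]|[]].
  by rewrite (asboolT (or_intror (ex_intro _ l'.2 hx))) hx.
move=> l l' Cll'; have [rl|nrl] := pselect (rigid l.1); first by apply: key => //; left.
have [rl'|nrl'] := pselect (rigid l'.1).
  by apply/or_comm; apply: key => //; right.
by rewrite /lit /retract (asboolF nrl) (asboolF nrl'); exact: huv.
Qed.

Lemma slice_retract u : compat u u -> slice (retract u).
Proof.
by move=> /retract_compat[uu _]; split=> // t; exact: retract_off.
Qed.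

End Retraction.
End Clauses.

Lemma minkowski2 (R : realType) (a b c d : R) :
  Num.sqrt ((a + c) ^+ 2 + (b + d) ^+ 2) <=
  Num.sqrt (a ^+ 2 + b ^+ 2) + Num.sqrt (c ^+ 2 + d ^+ 2).
Proof.
have p x y : 0 <= x ^+ 2 + y ^+ 2 :> R by rewrite addr_ge0 ?sqr_ge0.
rewrite -[leRHS]ger0_norm ?addr_ge0 ?sqrtr_ge0// -[leRHS]sqrtr_sqr.
apply: ler_wsqrtr; rewrite [leRHS]sqrrD !sqr_sqrtr//.
have : a * c + b * d <= Num.sqrt (a ^+ 2 + b ^+ 2) * Num.sqrt (c ^+ 2 + d ^+ 2).
  rewrite -sqrtrM//; apply: le_trans (ler_norm _) _; rewrite -sqrtr_sqr.
  apply: ler_wsqrtr; rewrite -subr_ge0.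
  rewrite (_ : _ - _ = (a * d - b * c) ^+ 2) ?sqr_ge0//; ring.
by rewrite mulr2n; lra.
Qed.

(** Tychonoff gives a cluster point; only the coordinates in [s] vary, so pointwise closeness is
    uniform. Returning infinitely often to each neighbourhood stands in for a convergent
    subsequence. *)
Lemma cluster_point (R : realType) (T : choiceType) (s : seq T) (b : T -> R) (u : nat -> T -> R) :
  (forall k t, -1 <= u k t <= 1) -> (forall k t, t \notin s -> u k t = b t) ->
  exists2 a : T -> R, (forall t, t \notin s -> a t = b t) &
    forall (eps : R) k0, 0 < eps -> exists2 k, (k0 <= k)%N & forall t, `|u k t - a t| < eps.
Proof.
move=> u1 ub.
have cpt : @compact (prod_topology (fun _ : T => R)) [set f | forall t, `[-1, 1]%classic (f t)].
  exact: (@tychonoff T (fun _ => R) (fun _ => `[-1, 1]%classic) (fun _ => @segment_compact R _ _)).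
pose F : set_system (prod_topology (fun _ : T => R)) := u @ \oo.
have FF : ProperFilter F by exact: fmap_proper_filter.
have [|a0 [_ cl]] := cpt F FF.
  by exists 0%N => // k _ t /=; rewrite in_itv /= u1.
exists (fun t => if t \in s then a0 t else b t) => [t /negbTE ->//|eps k0 eps0].
have FA : F [set f | exists2 k, (k0 <= k)%N & f = u k].
  by exists k0 => // k /= k0k; exists k.
pose X := prod_topology (fun _ : T => R).
have FX : Filter (@nbhs X X a0) := nbhs_filter (a0 : X).
pose B (s' : seq T) : set X := [set f | forall t, t \in s' -> `|f t - a0 t| < eps].
have nB (s' : seq T) : @nbhs X X a0 (B s').
  elim: s' => [|t s' IH].
    by apply: (@filterS _ _ FX _ _ _ (@filterT _ _ FX)) => f _ t; rewrite in_nil.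
  have nt : @nbhs X X a0 [set f : X | `|f t - a0 t| < eps].
    have := @proj_continuous T (fun _ => R) t a0 _ (nbhsx_ballx (a0 t : R) eps eps0).
    by apply: (@filterS _ _ FX) => f; rewrite /ball /= /proj distrC.
  apply: (@filterS _ _ FX _ _ _ (@filterI _ _ FX _ _ nt IH)) => f [/= ft fs] t'.
  by rewrite inE => /orP[/eqP ->//|/fs].
have [f [[k k0k ->] fB]] := cl _ _ FA (nB s).
exists k => // t; case: ifPn => [/fB//|ts]; by rewrite ub// subrr normr0.
Qed.

Section ClauseSpace.
Context {R : realType} {T : choiceType} (C : T * bool -> T * bool -> Prop).
Implicit Types (x y z u v b : T -> R) (h t : T) (N : set T) (l : T * bool).
Notation cmp := (@compat R T C).
Notation eu := (@eucl R T).
Notation chn := (chain cmp eu).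
Notation con := (conn cmp eu).
Notation dist := (cdist cmp eu).

(** * The carrier of a hyperplane as a metric product *)

Section Carrier.
Variable h : T.

Definition flat x : T -> R := upd x h 0.

Definition carrier : set (T -> R) := [set x | cmp x x /\ cmp (flat x) (flat x)].

Lemma sg_neq0 s : 0 <> sg s :> R.
Proof. by case: s; move/eqP; rewrite eq_sym ?oppr_eq0 oner_eq0. Qed.

Lemma flat_compat_upd u v c c' : cmp u v -> u h = 0 -> -1 <= c <= 1 -> -1 <= c' <= 1 ->
  cmp (upd u h c) (upd v h c').
Proof. by move=> uv u0 c1 c'1; apply: compat_upd => // s [+ _]; rewrite u0 => /sg_neq0. Qed.

Lemma carrier_flat x : carrier x -> cmp x (flat x).
Proof.
move=> [[x1 _ _ _] fx]; have := flat_compat_upd (c' := 0) fx (upd_eq _ _ _) (x1 h).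
by rewrite /flat !upd_upd upd_id; apply; rewrite oppr_le0 ler01.
Qed.

Lemma carrier_dist x z : carrier x -> carrier z -> con x z ->
  dist x z ^+ 2 = (x h - z h) ^+ 2 + dist (flat x) (flat z) ^+ 2.
Proof.
move=> cx cz xz; have [[xx fx] [zz fz]] := (cx, cz).
set b := flat z; pose N := [set t | t <> h].
pose p := retract C N b.
have Nh : ~ N h by apply.
have ph u : p u h = 0 by rewrite /p (retract_off C _ _ Nh) /b /flat upd_eq.
have pupd u c : p (upd u h c) = p u.
  apply/funext => t; have [->|th] := eqVneq t h; first by rewrite !ph.
  by rewrite /p /retract /upd (negbTE th).
have pflat u : carrier u -> p u = flat u.
  move=> [uu fu]; rewrite -(pupd u 0); apply: (retract_slice fz); split=> [|t]; first exact: fu.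
  by move=> /contrapT ->; rewrite /b /flat !upd_eq.
have pstep u v : cmp u v -> cmp (p u) (p v) /\ eu (p u) (p v) <= eu u v.
  exact: (retract_compat N fz).
have pupd0 u : upd (p u) h 0 = p u by rewrite -{1}(ph u) upd_id.
have lower u v L : chn u v L ->
    Num.sqrt (dist (p u) (p v) ^+ 2 + (u h - v h) ^+ 2) <= L.
  elim=> [w ww|w {}u {}v {}L uw wv IH].
    by rewrite dist_xx subrr expr0n /= addr0 sqrtr0.
  have [pu pe] := pstep _ _ uw.
  have cuw := compat_con pu.
  have cwv : con (p w) (p v) by apply: (conn_map pstep); exists L.
  have mk := minkowski2 (dist (p u) (p w)) (u h - w h) (dist (p w) (p v)) (w h - v h).
  suff le1 : Num.sqrt (dist (p u) (p w) ^+ 2 + (u h - w h) ^+ 2) <= eu u w.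
    apply: le_trans (lerD le1 IH); apply: le_trans mk.
    apply: ler_wsqrtr; rewrite addrA subrK lerD2r.
    by rewrite ler_sqr ?nnegrE ?addr_ge0 ?dist_ge0//; exact: dist_tri.
  rewrite -ler_sqr ?nnegrE ?sqrtr_ge0 ?eucl_ge0// sqr_sqrtr ?addr_ge0 ?sqr_ge0//.
  have [_ _ fuw _] := uw.
  rewrite -{3}(upd_id u h) -{3}(upd_id w h) eucl_upd// addrC lerD2l.
  rewrite ler_sqr ?nnegrE ?dist_ge0 ?eucl_ge0//; apply: le_trans (compat_dist pu) _.
  apply: eucl_mono; first exact: fin_diff_upd.
  move=> t; rewrite -(pupd u 0) -(pupd w 0) /p /retract.
  by case: ifP => // _; rewrite subrr normr0.
have upper u v L k c : chn u v L -> -1 <= c <= 1 -> -1 <= c + k * L <= 1 ->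
    exists2 L', chn (upd (p u) h c) (upd (p v) h (c + k * L)) L' &
      L' <= L * Num.sqrt (1 + k ^+ 2).
  move=> hc; elim: hc c => {u v L} [w ww|w u v L uw wv IH] c c1 cL1.
    exists 0; last by rewrite mul0r.
    rewrite mulr0 addr0; apply: chain0; have [pw _] := pstep _ _ ww.
    by apply: flat_compat_upd.
  have e0 := eucl_ge0 u w; have L0 := chain_ge0 (@eucl_ge0 _ _) wv.
  set e := eu u w in cL1 e0 *.
  have c'1 : -1 <= c + k * e <= 1.
    have [k0|k0] := leP 0 k.
      have ke := mulr_ge0 k0 e0; have kL := mulr_ge0 k0 L0.
      by move: cL1 c1; rewrite mulrDr; lra.
    have ke : k * e <= 0 by rewrite mulr_le0_ge0// ltW.
    have kL : k * L <= 0 by rewrite mulr_le0_ge0// ltW.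
    by move: cL1 c1; rewrite mulrDr; lra.
  rewrite mulrDr addrA; have [|L' hL' LL'] := IH (c + k * e) c'1.
    by rewrite -addrA -mulrDr.
  have [pu pe] := pstep _ _ uw.
  exists (eu (upd (p u) h c) (upd (p w) h (c + k * e)) + L').
    by apply: chainS hL'; exact: flat_compat_upd.
  rewrite mulrDl; apply: lerD => //.
  have [_ _ fpu _] := pu.
  rewrite -ler_sqr ?nnegrE ?eucl_ge0 ?mulr_ge0 ?sqrtr_ge0// eucl_upd// !pupd0.
  rewrite exprMn (@sqr_sqrtr _ (1 + k ^+ 2)) ?addr_ge0 ?sqr_ge0//.
  have : eu (p u) (p w) ^+ 2 <= e ^+ 2 by rewrite ler_sqr ?nnegrE ?eucl_ge0.
  by rewrite opprD addrA subrr add0r sqrrN exprMn; lra.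
have xE c : c = x h -> upd (p x) h c = x.
  by move=> ->; rewrite pflat// /flat upd_upd upd_id.
have zE c : c = z h -> upd (p z) h c = z.
  by move=> ->; rewrite pflat// /flat upd_upd upd_id.
have [x1 _ _ _] := xx; have [z1 _ _ _] := zz.
have cfz : con (flat x) (flat z).
  by rewrite -!pflat//; exact: (conn_map pstep).
apply/eqP; rewrite eq_le; apply/andP; split; last first.
  rewrite addrC -[X in X <= _]sqr_sqrtr ?addr_ge0 ?sqr_ge0//.
  rewrite ler_sqr ?nnegrE ?sqrtr_ge0 ?dist_ge0//.
  by apply: (cdist_ge xz) => L /lower; rewrite !pflat.
have up L : chn (flat x) (flat z) L -> dist x z ^+ 2 <= (x h - z h) ^+ 2 + L ^+ 2.
  move=> hL; have L0 := chain_ge0 (@eucl_ge0 _ _) hL.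
  have pf u : carrier u -> p (flat u) = p u by move=> _; rewrite /flat pupd.
  (* A chain of length 0 leaves no room for a slope; the coordinate [h] is then changed in one extra
     step at the end. *)
  have [LE|LN] := eqVneq L 0.
    rewrite LE expr0n /= addr0 -[X in _ <= X]real_normK ?num_real//.
    rewrite ler_sqr ?nnegrE ?dist_ge0//.
    have [|L' hL' LL'] := upper _ _ _ 0 (x h) hL (x1 h).
      by rewrite mul0r addr0.
    rewrite mul0r addr0 /flat !pupd xE// in hL'.
    have {LL'} L'0 : L' <= 0 by move: LL'; rewrite LE mul0r.
    have st : cmp (upd (p z) h (x h)) (upd (p z) h (z h)).
      by apply: flat_compat_upd => //; have [] := pstep _ _ zz.
    have cst : con x (upd (p z) h (x h)) by exists L'.
    rewrite -{1}(zE _ erefl); apply: le_trans (dist_tri cst (compat_con st)) _.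
    have := cdist_le (@eucl_ge0 _ _) hL'; have := compat_dist st.
    have -> : eu (upd (p z) h (x h)) (upd (p z) h (z h)) = `|x h - z h|.
      apply/eqP; rewrite -(eqrXn2 (n := 2))// ?eucl_ge0// eucl_upd; last exact: fin_diff_refl.
      rewrite real_normK ?num_real// pupd0 (_ : eu _ _ = 0) ?expr0n /= ?addr0//.
      apply/eqP; rewrite -sqrf_eq0 (eucl_sqE (s := [::]))// ?big_nil//.
    by lra.
  have [|L' hL' LL'] := upper _ _ _ ((z h - x h) / L) (x h) hL (x1 h).
    by rewrite mulfVK// addrC subrK.
  rewrite mulfVK// addrC subrK /flat !pupd xE// zE// in hL'.
  have := le_trans (cdist_le (@eucl_ge0 _ _) hL') LL'.
  rewrite -ler_sqr ?nnegrE ?dist_ge0 ?mulr_ge0 ?sqrtr_ge0//.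
  rewrite exprMn (@sqr_sqrtr _ (1 + _)) ?addr_ge0 ?sqr_ge0// mulrDr mulr1 -exprMn (mulrC L) mulfVK//.
  by rewrite -[X in X -> _]/(is_true _) -(sqrrN (z h - x h)) opprB addrC.
rewrite leNgt; apply/negP => lt.
set D := dist x z in up lt; set d0 := dist (flat x) (flat z) in lt.
have d00 : 0 <= d0 := dist_ge0 _ _ _.
have lt' : d0 < Num.sqrt (D ^+ 2 - (x h - z h) ^+ 2).
  rewrite -ltr_sqr ?nnegrE ?sqrtr_ge0// sqr_sqrtr; last by have := sqr_ge0 d0; lra.
  by lra.
have [L hL lL] := cdist_lt cfz lt'.
have L0 := chain_ge0 (@eucl_ge0 _ _) hL.
have := up _ hL; move: lL; rewrite -ltr_sqr ?nnegrE ?sqrtr_ge0// sqr_sqrtr.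
  by lra.
by have := sqr_ge0 d0; lra.
Qed.

End Carrier.
End ClauseSpace.

(** * Induction on the number of free coordinates *)

Section ClauseSpaceStewart.
Context {R : realType} {T : choiceType} (C : T * bool -> T * bool -> Prop).
Implicit Types (x y z u v b : T -> R) (h t : T) (l : T * bool).
Notation cmp := (@compat R T C).
Notation eu := (@eucl R T).
Notation chn := (chain cmp eu).
Notation con := (conn cmp eu).
Notation dist := (cdist cmp eu).

Lemma sg_inj : injective (@sg R).
Proof. by move=> [] [] //= /eqP; rewrite ?eqr_oppLR; move=> /eqP h; exfalso; lra. Qed.

Lemma chain_exit h s x z L : chn x z L -> x h = sg s -> z h <> sg s ->
  exists a a1 L1 L2, [/\ cmp a a1, a h = sg s, a1 h <> sg s, chn x a L1 & chn a z L2]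
    /\ L1 + L2 <= L.
Proof.
elim=> [u _ -> //|v u w {}L uv vw IH] us ws.
have [vs|vs] := pselect (v h = sg s); last first.
  exists u, v, 0, (eu u v + L); rewrite add0r; split=> //; split=> //.
    by apply: chain0; exact: compat_refl uv.
  exact: chainS vw.
have [a [a1 [L1 [L2 [[aa1 as' a1s va aw] le]]]]] := IH vs ws.
exists a, a1, (eu u v + L1), L2; split; last by rewrite -addrA lerD2l.
by split=> //; exact: chainS va.
Qed.

(** A chain leaves the face [x h = sg s] from a cube that crosses the hyperplane. Retracted to the
    finitely many coordinates [N], the exit points of ever shorter chains have a cluster point, and
    it realises the distance. *)
Lemma wall_crossing (N : seq T) h s x z : con x z -> compat C z z ->
  (forall t, t \notin N -> x t = z t) -> x h = sg s -> z h <> sg s ->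
  exists a, [/\ slice C [set` N] x a, con x a, a h = sg s, cmp (flat h a) (flat h a)
    & dist x z = dist x a + dist a z].
Proof.
move=> xz zz offN xs zs.
have xx : cmp x x := con_refl xz.
pose S := slice C [set` N] x.
have Sx : S x by split.
have Sz : S z by split=> // t /negP/offN ->.
pose p := retract C [set` N] x.
have pstep u v : cmp u v -> cmp (p u) (p v) /\ eu (p u) (p v) <= eu u v.
  exact: (retract_compat [set` N] xx).
have px : p x = x by exact: (retract_slice xx).
have pz : p z = z by exact: (retract_slice xx).
(* The coordinate [h] is not rigid, as [x] and [z] lie in the slice and differ there. *)
have ph u : p u h = u h.
  rewrite /p /retract; case: asboolP => // rh.
  by have e1 := rigidE xx rh Sz; rewrite e1 in zs.
have approx L : chn x z L -> exists a, [/\ S a, con x a, a h = sg s,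
    cmp (flat h a) (flat h a) & dist x a + dist a z <= L].
  move=> hL; have [a [a1 [L1 [L2 [[aa1 as' a1s xa az] le]]]]] := chain_exit hL xs zs.
  have [paa1 _] := pstep _ _ aa1.
  have cxa : con x a by exists L1.
  have caz : con a z by exists L2.
  have aa := compat_refl aa1.
  exists (p a); split.
  - exact: (slice_retract _ xx).
  - by rewrite -px; exact: (conn_map pstep).
  - by rewrite ph.
  - apply: (@compat_refl _ _ _ _ (flat h (p a1))).
    have o1 : -1 <= (0 : R) <= 1 by lra.
    by apply: compat_upd => // s' []; rewrite !ph as' => /sg_inj <-.
  - apply: le_trans le; apply: lerD.
      rewrite -{1}px; apply: le_trans (cdist_map (@eucl_ge0 _ _) pstep cxa) _.
      exact: (cdist_le (@eucl_ge0 _ _)).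
    rewrite -{1}pz; apply: le_trans (cdist_map (@eucl_ge0 _ _) pstep caz) _.
    exact: (cdist_le (@eucl_ge0 _ _)).
pose D := dist x z.
have seqP k : exists a, [/\ S a, con x a, a h = sg s, cmp (flat h a) (flat h a)
    & dist x a + dist a z <= D + k.+1%:R^-1].
  have [|L hL Lk] := cdist_lt (c := D + k.+1%:R^-1) xz; first by rewrite ltrDl invr_gt0.
  have [a [? ? ? ? le]] := approx _ hL.
  by exists a; split=> //; apply: le_trans le (ltW Lk).
have [u uP] := choice seqP.
have [|k t Nt|a aN alim] := @cluster_point R T N x u.
- by move=> k; have [[[? _ _ _] _] _ _ _ _] := uP k.
- by have [[_ offx] _ _ _ _] := uP k; apply: offx => /=; exact/negP.
have aa : cmp a a.
  apply: compat_closed => eps eps0; have [k _ hk] := alim eps 0%N eps0.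
  by exists (u k) => //; have [[? _] _ _ _ _] := uP k.
have fa : cmp (flat h a) (flat h a).
  apply: compat_closed => eps eps0; have [k _ hk] := alim eps 0%N eps0.
  exists (flat h (u k)); first by have [] := uP k.
  by move=> t; rewrite /flat /upd; case: ifP => _; rewrite ?subrr ?normr0.
have ah : a h = sg s.
  apply/eqP; rewrite -subr_eq0 -normr_le0; apply/ler_addgt0Pr => eps eps0.
  have [k _ hk] := alim eps 0%N eps0; have [_ _ uh _ _] := uP k.
  by have := hk h; rewrite uh distrC add0r => /ltW.
have off k t : t \notin undup N -> u k t = a t.
  by rewrite mem_undup => tN; rewrite aN//; have [[_ offx] _ _ _ _] := uP k; apply: offx; exact/negP.
have nearu k : (forall t, `|u k t - a t| < 2) -> con (u k) a /\ dist (u k) a <= 2 * eu (u k) a.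
  have [[uk _] _ _ _ _] := uP k.
  apply: near_dist => //; exists (undup N) => t; exact: off.
have xa : con x a.
  have [k _ hk] := alim 2 0%N (ltr0n _ _).
  have [_ xu _ _ _] := uP k; exact: conn_trans xu (nearu k hk).1.
have az : con a z := conn_trans (con_sym xa) xz.
exists a; split=> //; first by split=> // t /= /negP /aN.
apply/eqP; rewrite eq_le dist_tri//=.
apply/ler_addgt0Pr => eps eps0.
pose n : R := (size (undup N)).+1%:R.
have n0 : 0 < n by rewrite ltr0n.
(* The 2 is required by [near_dist]. The detour over [u k] costs at most [4 * n * del <= eps / 2];
   the other half of [eps] covers the defect of [u k]. *)
pose del := Num.min 2 (eps / (8 * n)).
have del0 : 0 < del by rewrite lt_min ltr0n divr_gt0// mulr_gt0.
have [k0 hk0] : exists k0, forall k, (k0 <= k)%N -> k.+1%:R^-1 <= eps / 2 :> R.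
  have e20 : 0 < eps / 2 by rewrite divr_gt0.
  exists (Num.truncn (eps / 2)^-1) => k hk.
  rewrite -[leRHS]invrK lef_pV2 ?posrE ?invr_gt0//.
  apply: le_trans (ltW (truncnS_gt _)) _.
  by rewrite ler_nat ltnS.
have [k k0k hk] := alim del k0 del0.
have del2 : del <= 2 by rewrite /del ge_min lexx.
have [cua dua] := nearu k (fun t => lt_le_trans (hk t) del2).
have [[uk _] xu _ _ le] := uP k.
have d1 : eu (u k) a <= n * del.
  have := @eucl_bound R T (u k) a (undup N) del (undup_uniq _) (off k) (fun t => ltW (hk t)).
  move=> /le_trans; apply; apply: ler_wpM2r; first exact: ltW.
  by rewrite ler_nat.
have d2 : n * del <= eps / 8.
  have : del <= eps / (8 * n) by rewrite /del ge_min lexx orbT.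
  move=> /(ler_wpM2l (ltW n0)) /le_trans; apply.
  have nn : n != 0 by rewrite gt_eqF.
  by rewrite (_ : n * _ = eps / 8)//; move: (n) nn => n' nn; field.
have t1 := dist_tri xu cua.
have t2 := dist_tri (con_sym cua) (conn_trans cua az).
rewrite (dist_sym C a (u k)) in t2.
rewrite -/D; move: le (hk0 k k0k); move: (k.+1%:R^-1) => w le wle.
by move: t1 t2 d1 d2 dua le wle; clearbody D; lra.
Qed.

(** By [carrier_dist] the inequality is the sum of the one for [Y] and of an identity on the
    interval. The value of [m h] is recorded so that the ends of the carrier inherit the
    property. *)
Lemma carrier_stewart h (Y : set (T -> R)) :
  (forall y z, Y y -> Y z -> con y z) -> (forall y, Y y -> y h = 0) ->
  stewart_space dist Y ->
  forall q r (t : R), [set x | carrier C h x /\ Y (flat h x)] q ->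
    [set x | carrier C h x /\ Y (flat h x)] r -> 0 <= t <= 1 ->
  exists2 m, [set x | carrier C h x /\ Y (flat h x)] m /\ m h = (1 - t) * q h + t * r h &
    forall p, [set x | carrier C h x /\ Y (flat h x)] p -> stewart dist t p q r m.
Proof.
move=> Yc Y0 SY q r t [cq Yq] [cr Yr] t01.
have [y Yy hy] := SY _ _ _ Yq Yr t01.
have y0 := Y0 _ Yy.
pose c := (1 - t) * q h + t * r h.
have [[[q1 _ _ _] _] [[r1 _ _ _] _]] := (cq, cr).
have /andP[t0 t1] := t01.
have c1 : -1 <= c <= 1.
  have [/andP[q2 q3] /andP[r2 r3]] := (q1 h, r1 h).
  have t1' : 0 <= 1 - t by rewrite subr_ge0.
  have := ler_wpM2l t1' q2; have := ler_wpM2l t1' q3.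
  have := ler_wpM2l t0 r2; have := ler_wpM2l t0 r3; rewrite /c.
  by move: t1; rewrite !mulr1 !mulrN1; lra.
pose m := upd y h c.
have yy : cmp y y := con_refl (Yc _ _ Yy Yy).
have fm : flat h m = y.
  by apply/funext => s; rewrite /m /flat /upd; case: eqP => // ->.
have cm : carrier C h m.
  by split; [exact: (flat_compat_upd yy y0)|rewrite fm].
have mh : m h = c by rewrite /m upd_eq.
have con_of x z : carrier C h x /\ Y (flat h x) -> carrier C h z /\ Y (flat h z) -> con x z.
  move=> [cx Yx] [cz Yz]; apply: conn_trans (compat_con (carrier_flat cx)) _.
  apply: conn_trans (Yc _ _ Yx Yz) _; apply: compat_con; apply: compat_sym.
  exact: carrier_flat.
have Ym : Y (flat h m) by rewrite fm.
exists m => [|p [cp Yp]]; first by [].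
have dE x z (cx : carrier C h x /\ Y (flat h x)) (cz : carrier C h z /\ Y (flat h z)) :=
  carrier_dist cx.1 cz.1 (con_of _ _ cx cz).
rewrite /stewart (dE p m)// (dE p q)// (dE p r)// (dE q r)//.
rewrite mh fm; have := hy _ Yp; rewrite /stewart /c; lra.
Qed.

Definition piece (s : seq T) b : set (T -> R) :=
  [set x | slice C [set` s] b x /\ con b x].

Lemma piece_con s b x z : piece s b x -> piece s b z -> con x z.
Proof. by move=> [_ bx] [_ bz]; exact: conn_trans (con_sym bx) bz. Qed.

Lemma piece_eq s b c : piece s b c -> piece s b = piece s c.
Proof.
move=> [[cc offc] bc]; apply/seteqP; split=> x [[xx offx] bx]; split.
- by split=> // t st; rewrite offx// offc.
- exact: conn_trans (con_sym bc) bx.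
- by split=> // t st; rewrite offx// offc.
- exact: conn_trans bc bx.
Qed.

(* Cutting along the hyperplane [x h = 0]: the piece is the union of its faces
   [x h = 1] and [x h = -1] and of the carrier, a product with [-1, 1]. *)
Lemma piece_stewart s b : uniq s -> cmp b b -> stewart_space dist (piece s b).
Proof.
elim: s b => [|h s IH] b /= us bb.
  move=> q r t bq br t01; exists b; first by split; [split|exact: compat_con].
  have e x : piece [::] b x -> x = b.
    by move=> [[_ off] _]; apply/funext => t'; apply: off.
  move=> p /e ->; rewrite (e _ bq) (e _ br) /stewart dist_xx.
  by rewrite expr0n /= !mulr0 addr0 subr0.
case/andP: us => hs us; set PB := piece (h :: s) b.
have PBb : PB b by split; [split|exact: compat_con].
have PBcmp x : PB x -> cmp x x by case=> [[]].
have triPB B : B `<=` PB -> triangle_on dist B.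
  move=> BP y x z /BP Bx /BP By /BP Bz; apply: dist_tri.
    exact: piece_con Bx By.
  exact: piece_con By Bz.
pose Bs e := [set x | PB x /\ x h = sg e].
pose Ca := [set x | PB x /\ cmp (flat h x) (flat h x)].
have offh t : ~ [set` s] t -> t <> h -> ~ [set` h :: s] t.
  by move=> /= ts th; rewrite inE => /orP[/eqP|].
(* A face is a piece with one free coordinate fewer. *)
have SBs e : stewart_space dist (Bs e).
  have [[b' [Pb' b'h]]|nB] := pselect (exists b', Bs e b'); last first.
    by move=> q r t Bq; case: nB; exists q.
  suff -> : Bs e = piece s b' by exact: IH (PBcmp _ Pb').
  rewrite /Bs /PB (piece_eq Pb'); apply/seteqP; split=> x.
    move=> [[[xx off] bx] xh]; split=> //; split=> // t ts.
    by have [->|/eqP th] := eqVneq t h; [rewrite xh b'h|apply: off; exact: offh].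
  move=> [[xx off] bx]; split; last by rewrite off//=; exact/negP.
  by split=> //; split=> // t ts; apply: off => /= st; apply: ts; rewrite /= inE st orbT.
have SCa : forall q r (t : R), Ca q -> Ca r -> 0 <= t <= 1 ->
    exists2 m, Ca m /\ m h = (1 - t) * q h + t * r h & forall p, Ca p -> stewart dist t p q r m.
  move=> q r t Cq; have [Pq fq] := Cq.
  have cq : carrier C h q by split=> //; exact: PBcmp.
  have qfq := compat_con (carrier_flat cq).
  have -> : Ca = [set x | carrier C h x /\ piece s (flat h q) (flat h x)].
    rewrite /Ca /PB (piece_eq Pq); apply/seteqP; split=> x.
      move=> [[[xx off] qx] fx]; have cx : carrier C h x by [].
      split=> //; split; last first.
        apply: conn_trans (con_sym qfq) _; apply: conn_trans qx _.
        exact: compat_con (carrier_flat cx).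
      split=> // t' ts; have [->|th] := eqVneq t' h; first by rewrite /flat !upd_eq.
      by rewrite /flat /upd (negbTE th); apply: off; apply: offh => //; exact/eqP.
    move=> [cx [[fx off] cqx]]; have [xx _] := cx; split=> //; split; last first.
      apply: conn_trans qfq _; apply: conn_trans cqx _; apply: con_sym.
      exact: compat_con (carrier_flat cx).
    split=> // t' ts; have th : t' != h.
      by apply/eqP => th; apply: ts; rewrite /= th mem_head.
    have := off t'; rewrite /flat /upd (negbTE th); apply => /= st.
    by apply: ts; rewrite /= inE st orbT.
  apply: carrier_stewart.
  - by move=> y z; exact: piece_con.
  - by move=> y [[_ off] _]; rewrite off /flat ?upd_eq //=; exact/negP.
  - exact: IH.
  - by split=> //; split; [split|exact: compat_con].
have SCa' : stewart_space dist Ca.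
  by move=> q r t Cq Cr t01; have [m [? _] ?] := SCa _ _ _ Cq Cr t01; exists m.
have SA e : stewart_space dist (Ca `&` Bs e).
  move=> q r t [Cq Bq] [Cr Br] t01; have [m [Cm mh] hm] := SCa _ _ _ Cq Cr t01.
  exists m; last by move=> p [Cp _]; exact: hm.
  by split=> //; split; [case: Cm|rewrite mh (proj2 Bq) (proj2 Br); ring].
have CaP : Ca `<=` PB by move=> x [].
have BsP e : Bs e `<=` PB by move=> x [].
have cross e x z : Bs e x -> PB z -> z h <> sg e ->
    exists2 a, (Ca `&` Bs e) a & dist x z = dist x a + dist a z.
  move=> [Px xh] Pz zh.
  have xz : con x z := piece_con Px Pz.
  have [|a [[aa offa] xa ah fa da]] := @wall_crossing (h :: s) h e x z xz (PBcmp _ Pz) _ xh zh.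
    by move=> t /negP ts; have [[_ ox] _] := Px; have [[_ oz] _] := Pz; rewrite ox// oz.
  exists a => //; have Pa : PB a.
    split; first by split=> // t ts; rewrite offa//; have [[_ ox] _] := Px; exact: ox.
    by have [_ bx] := Px; exact: conn_trans bx xa.
  by split.
have G1 : stewart_space dist (Bs true `|` Ca).
  apply: stewart_glue => //; try by [exact: dist_ge0|exact: dist_xx|exact: dist_sym].
  - by apply: triPB => x [/BsP|/CaP].
  - by rewrite setIC.
  - move=> x z Bx Cz; have [zh|zh] := eqVneq (z h) (sg true).
      by exists z; [split=> //; split=> //; exact: CaP|rewrite dist_xx addr0].
    have [|a [? ?] da] := cross _ _ _ Bx (CaP _ Cz); first exact/eqP.
    by exists a.
have -> : PB = (Bs true `|` Ca) `|` Bs false.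
  apply/seteqP; split=> [x Px|x [[/BsP|/CaP]|/BsP]//].
  have [xh|xh] := eqVneq (x h) (sg true); first by left; left.
  have [xh'|xh'] := eqVneq (x h) (sg false); first by right.
  left; right; split=> //.
  have o1 : -1 <= (0 : R) <= 1 by lra.
  by apply: compat_upd => // [|[] [/eqP + _]]; [exact: PBcmp|exact/negP|exact/negP].
(* The two faces are disjoint, so the second gluing is along an end of the carrier, too. *)
have IE : (Bs true `|` Ca) `&` Bs false = Ca `&` Bs false.
  apply/seteqP; split=> x [Cx Bx]; split=> //; last by right.
  by case: Cx => // -[_ h1]; case: Bx => _; rewrite h1 => /sg_inj.
apply: stewart_glue => //; try by [exact: dist_ge0|exact: dist_xx|exact: dist_sym].
- by apply: triPB => x [[/BsP|/CaP]|/BsP].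
- by rewrite IE.
- rewrite IE => x z Bx Bz.
  have Px : PB x by case: Bx => [/BsP|/CaP].
  have [xh|xh] := eqVneq (x h) (sg false).
    exists x; last by rewrite dist_xx add0r.
    split=> //; case: Bx => // -[_ h1]; move: xh; rewrite h1 => /sg_inj.
    by [].
  have [|a Ca' da] := cross _ _ _ Bz Px; first exact/eqP.
  by exists a => //; rewrite dist_sym da addrC (dist_sym C z a) (dist_sym C a x).
Qed.

Lemma finite_diff_con x z : con x z -> fin_diff x z.
Proof. by move=> [L]; exact: chain_fin_diff. Qed.

(* [piece] depends on the finitely many points at hand; the points on a
   geodesic do not, being unique. *)
Lemma component_stewart b : stewart_space dist [set x | con b x].
Proof.
move=> q r t bq br t01.
have qr : con q r := conn_trans (con_sym bq) br.
have [s us [_ hs]] := fin_diff_uniq [::] (finite_diff_con qr).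
have qq := con_refl qr.
have in_piece (s' : seq T) x : con q x -> (forall i, i \notin s' -> q i = x i) -> piece s' q x.
  move=> qx off; split=> //; split; first exact: con_refl (con_sym qx).
  by move=> i /negP /off.
have [m Pm hm] := piece_stewart us qq (in_piece _ _ (compat_con qq) (fun _ _ => erefl))
  (in_piece _ _ qr hs) t01.
have bm : con b m by case: Pm => _; exact: conn_trans bq.
exists m => // p bp.
have qp : con q p := conn_trans (con_sym bq) bp.
have [s' us' [ss' hs']] := fin_diff_uniq s (finite_diff_con qp).
have Pq' := in_piece s' _ (compat_con qq) (fun _ _ => erefl).
have Pr' : piece s' q r by apply: in_piece => // i si; apply: hs; apply: contra si; exact: ss'.
have Pm' : piece s' q m.
  apply: in_piece; first by case: Pm.
  move=> i si; have [[_ off] _] := Pm; rewrite off//=.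
  by apply/negP; apply: contra si; exact: ss'.
have Pp' : piece s' q p by apply: in_piece.
have Pq := in_piece s _ (compat_con qq) (fun _ _ => erefl).
have Pr := in_piece s _ qr hs.
have d0 := @dist_ge0 R T C; have dxx := @dist_xx R T C; have dsym := @dist_sym R T C.
apply: (@stewart_mid _ _ dist d0 dsym (piece s' q)) => //.
- move=> y x z Px Py Pz; apply: dist_tri; [exact: piece_con Px Py|exact: piece_con Py Pz].
- exact: piece_stewart.
- by apply: stewart_endl => //; exact: hm.
- by apply: stewart_endr => //; exact: hm.
Qed.

End ClauseSpaceStewart.

(** * The universal cover *)

Section Cover.
Context {R : realType} {m : nat} (K : {set {set 'I_m}}).
Hypotheses (Kc : simplicial_complex K) (Kf : flag_complex K).
Local Open Scope group_scope.

(** [edge i i] holds as soon as [i] is a vertex; it adds only the trivial relation that [s_ i]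
    commutes with itself. *)
Definition edge : rel 'I_m := [rel i j | [set i; j]%SET \in K].

Lemma edge_sym : symmetric edge.
Proof. by move=> i j; rewrite /edge /= finset.setUC. Qed.

Notation W := (racg edge).
Notation s_ := (gen edge).
Implicit Types (w u r : W) (y z : 'rV[R]_m) (I : {set 'I_m}) (D E : pred 'I_m).

Lemma simplex_comm I i j : I \in K -> i \in I -> j \in I -> commute (s_ i) (s_ j).
Proof.
move=> IK iI jI; apply: gen_comm; have [_ _ sub] := Kc.
by apply: sub IK _; apply/fintype.subsetP => k; rewrite !inE => /orP[] /eqP ->.
Qed.

Definition cube_word D : seq 'I_m := [seq i <- enum 'I_m | D i].

Lemma cube_word_uniq D : uniq (cube_word D).
Proof. by rewrite filter_uniq ?enum_uniq. Qed.

(** If [D] lies in a simplex, its generators commute and the order of [enum] is immaterial.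
    Otherwise this is merely some element of class [D] in the abelianisation. *)
Definition flip D : W := cl edge (cube_word D).

Lemma ab_flip D i : ab (flip D) i = D i.
Proof.
rewrite ab_cl (count_uniq_mem _ (cube_word_uniq D)) oddb.
by rewrite mem_filter mem_enum andbT.
Qed.

Lemma flip_eq D E : D =1 E -> flip D = flip E.
Proof. by move=> DE; rewrite /flip /cube_word (eq_filter DE). Qed.

Lemma flip0 D : (forall i, ~~ D i) -> flip D = 1.
Proof.
move=> D0; rewrite /flip /cube_word (@eq_filter _ D pred0) ?filter_pred0//.
by move=> i; exact/negbTE.
Qed.

Lemma flip1 i : flip (pred1 i) = s_ i.
Proof.
by rewrite /flip /cube_word -[in LHS]/(pred1 i) filter_pred1_uniq ?enum_uniq ?mem_enum.
Qed.

Lemma flipM I D E : I \in K -> (forall i, D i -> i \in I) -> (forall i, E i -> i \in I) ->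
  flip D * flip E = flip (fun i => D i (+) E i).
Proof.
move=> IK DI EI; rewrite /flip /cube_word; elim: (enum 'I_m) => [|i l IH] /=.
  by rewrite cl_nil mulg1.
have clD j : E j -> commute (s_ j) (cl edge [seq i <- l | D i]).
  move=> Ej; elim: (l) => [|k l' IHl] /=; first exact: commute1.
  case: ifP => // Dk; rewrite cl_cons; apply: commuteM => //.
  by apply: (simplex_comm IK); [exact: EI|exact: DI].
case: ifP => Di; case: ifP => Ei; rewrite /= ?cl_cons -?IH.
- by rewrite mulgA -(mulgA (s_ i)) -(clD _ Ei) !mulgA genK mul1g.
- by rewrite mulgA.
- by rewrite mulgA -(clD _ Ei) mulgA.
- by [].
Qed.

Lemma flip_conj I D i : I \in K -> (forall i, D i -> i \in I) -> i \in I ->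
  commute (s_ i) (flip D).
Proof.
move=> IK DI iI; rewrite /flip /cube_word; elim: (enum 'I_m) => [|k l IHl] /=.
  exact: commute1.
case: ifP => // Dk; rewrite cl_cons; apply: commuteM => //.
by apply: (simplex_comm IK) => //; exact: DI.
Qed.

Lemma sep_clique (l : seq 'I_m) r : uniq l ->
  (forall i j, i \in l -> j \in l -> commute (s_ i) (s_ j)) ->
  sep r (cl edge l) = has (fun j => s_ j == r) l.
Proof.
elim: l r => [|i l IH] r /=; first by rewrite cl_nil sep1.
move=> /andP[il ul] lc; rewrite cl_cons sepM sep_gen genV IH//; last first.
  by move=> a b al bl; apply: lc; rewrite inE ?al ?bl orbT.
have e : {in l, (fun j => s_ j == s_ i * r * s_ i) =1 (fun j => s_ j == r)}.
  move=> j jl; have ij : commute (s_ i) (s_ j) by apply: lc; rewrite ?mem_head// inE jl orbT.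
  rewrite -(inj_eq (mulgI (s_ i))) -(inj_eq (mulIg (s_ i))) !mulgA genK mul1g.
  by rewrite ij -!mulgA genK !mulg1.
rewrite (eq_in_has e); case: eqP => //= ir.
apply/hasPn => j jl; rewrite -ir (inj_eq (@gen_inj _ edge)).
by apply: contraNneq il => <-.
Qed.

Lemma sep_flip I D r : I \in K -> (forall i, D i -> i \in I) ->
  sep r (flip D) = [exists i, D i && (s_ i == r)].
Proof.
move=> IK DI; rewrite sep_clique ?cube_word_uniq//; last first.
  by move=> i j; rewrite !mem_filter => /andP[/DI ? _] /andP[/DI ? _]; exact: simplex_comm IK _ _.
apply/hasP/existsP => [[i]|[i /andP[Di ri]]].
  by rewrite mem_filter => /andP[Di _] ri; exists i; rewrite Di.
by exists i => //; rewrite mem_filter Di mem_enum.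
Qed.

Definition wall w i : W := w * s_ i * w^-1.

Lemma wall_inj w : injective (wall w).
Proof. by move=> i j; rewrite /wall => /mulIg /mulgI /gen_inj. Qed.

Lemma wall_flip w I D i : I \in K -> (forall i, D i -> i \in I) -> i \in I ->
  wall (w * flip D) i = wall w i.
Proof.
move=> IK DI iI; rewrite /wall -(mulgA w) -(flip_conj IK DI iI) invgM !mulgA.
by rewrite mulgK.
Qed.

Definition side r w : bool := ~~ sep r w.

Lemma side_mul r w u : side r (w * u) = side r w (+) sep (w^-1 * r * w) u.
Proof. by rewrite /side sepM addNb. Qed.

Lemma wallV w i : w^-1 * wall w i * w = s_ i.
Proof. by rewrite /wall !mulgA mulVg mul1g mulgVK. Qed.

Lemma wall_eqV w i r : (s_ i == w^-1 * r * w) = (wall w i == r).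
Proof.
by rewrite -(inj_eq (mulgI w)) -(inj_eq (mulIg w^-1)) !mulgA mulgV mul1g mulgK.
Qed.

Lemma side_flip w I D r : I \in K -> (forall i, D i -> i \in I) ->
  side r (w * flip D) = side r w (+) [exists i, D i && (wall w i == r)].
Proof.
move=> IK DI; rewrite side_mul (sep_flip _ IK DI); congr (_ (+) _).
by apply: eq_existsb => i; rewrite wall_eqV.
Qed.

(** Counting 0 as positive assigns a point on a mirror to exactly one chamber, which spares a
    quotient. *)
Definition sgn y : pred 'I_m := fun i => (y ord0 i < 0)%R.

Definition supp y : {set 'I_m} := [set i | (y ord0 i != 1%R) && (y ord0 i != (-1)%R)]%SET.

Definition inRK y : Prop := (forall i, -1 <= y ord0 i <= 1)%R /\ supp y \in K.

Lemma inRKP y : inRK y <-> real_moment_angle R K y.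
Proof.
split=> [[y1 yK]|[I /= IK [y1 yI]]].
  exists (supp y) => //; split=> [i _|j]; first by rewrite in_itv /= y1.
  by rewrite inE negb_and !negbK => /orP[] /eqP; [left|right].
split=> [i|].
  have [/y1|/yI[]->] := boolP (i \in I); first by rewrite in_itv.
    by rewrite lexx andbT; lra.
  by rewrite lexx; lra.
have [_ _ sub] := Kc; apply: sub IK _; apply/fintype.subsetP => i; rewrite inE.
by apply: contraTT => /yI[] ->; rewrite eqxx ?andbF.
Qed.

Definition offset y z : pred 'I_m := fun i => sgn y i (+) sgn z i.

Notation pt := (W * 'rV[R]_m)%type.
Implicit Types p q : pt.

(* [p] and [q] lie in a common closed cube. *)
Definition cube_step p q : Prop := exists I, [/\ I \in K,
  forall i, (-1 <= p.2 ord0 i <= 1)%R, forall i, (-1 <= q.2 ord0 i <= 1)%R,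
  forall i, i \notin I -> i \notin supp p.2 /\ p.2 ord0 i = q.2 ord0 i
  & q.1 = p.1 * flip (offset p.2 q.2)].

Definition coords p : W -> R := fun r =>
  (sg (side r p.1) * (if [pick i | wall p.1 i == r] is Some i then `|p.2 ord0 i| else 1))%R.

Lemma coords_wall p i : coords p (wall p.1 i) = (sg (side (wall p.1 i) p.1) * `|p.2 ord0 i|)%R.
Proof.
rewrite /coords; case: pickP => [j /eqP/wall_inj ->//|/(_ i)].
by rewrite eqxx.
Qed.

Lemma abs_off_supp y i : i \notin supp y -> `|y ord0 i| = 1%R.
Proof.
by rewrite inE negb_and !negbK => /orP[] /eqP ->; rewrite ?normrN normr1.
Qed.

Lemma coords_off p I r : (forall i, i \notin I -> i \notin supp p.2) ->
  (forall i, i \in I -> wall p.1 i != r) -> coords p r = sg (side r p.1).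
Proof.
move=> pI rI; rewrite /coords; case: pickP => [i ir|_]; last by rewrite mulr1.
rewrite abs_off_supp ?mulr1//; apply: pI.
by apply/negP => /rI; rewrite ir.
Qed.

(* The sign relating the coordinate of the wall [wall w i] to that of [y]. *)
Definition wall_sign p i : R := (sg (side (wall p.1 i) p.1) * sg (~~ sgn p.2 i))%R.

Lemma sg_sq e : (sg e * sg e = 1 :> R)%R.
Proof. by case: e; rewrite /= ?mulrNN mulr1. Qed.

Lemma sg_norm e : `|sg e : R| = 1%R.
Proof. by case: e; rewrite /= ?normrN normr1. Qed.

Lemma wall_sign_sq p i : (wall_sign p i * wall_sign p i = 1)%R.
Proof. by rewrite /wall_sign mulrACA !sg_sq mulr1. Qed.

Lemma wall_sign_norm p i : `|wall_sign p i| = 1%R.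
Proof. by rewrite normrM !sg_norm mulr1. Qed.

Lemma coords_wallE p i : coords p (wall p.1 i) = (wall_sign p i * p.2 ord0 i)%R.
Proof.
rewrite coords_wall /wall_sign -mulrA; congr (_ * _)%R; rewrite /sgn.
by case: ltP => h /=; [rewrite mulN1r ltr0_norm|rewrite mul1r ger0_norm].
Qed.

Lemma offset_sub p q I : (forall i, i \notin I -> i \notin supp p.2 /\ p.2 ord0 i = q.2 ord0 i) ->
  forall i, offset p.2 q.2 i -> i \in I.
Proof.
move=> h i; apply: contraTT => /h[_ e].
by rewrite /offset /sgn e addbb.
Qed.

(** Along a cube, the side of a wall changes exactly when the coordinate of [y] changes sign. The
    signed absolute value is therefore [y] itself up to the constant sign [wall_sign p i]. *)
Lemma cube_step_coords p q I : I \in K ->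
  (forall i, i \notin I -> i \notin supp p.2 /\ p.2 ord0 i = q.2 ord0 i) ->
  q.1 = p.1 * flip (offset p.2 q.2) ->
  [/\ forall i, i \in I -> wall q.1 i = wall p.1 i,
      forall i, i \in I -> coords p (wall p.1 i) = (wall_sign p i * p.2 ord0 i)%R,
      forall i, i \in I -> coords q (wall p.1 i) = (wall_sign p i * q.2 ord0 i)%R
    & forall r, (forall i, i \in I -> wall p.1 i != r) ->
      coords p r = sg (side r p.1) /\ coords q r = sg (side r p.1)].
Proof.
move=> IK pq qE; have sub := offset_sub pq.
have wE i : i \in I -> wall q.1 i = wall p.1 i by move=> iI; rewrite qE (wall_flip _ IK).
split=> // [i iI|i iI|r rI].
- exact: coords_wallE.
- rewrite -wE// coords_wallE; congr (_ * _)%R; rewrite /wall_sign wE// qE (side_flip _ _ IK)//.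
  rewrite (_ : [exists _, _] = offset p.2 q.2 i); last first.
    apply/existsP/idP => [[j /andP[jD /eqP/wall_inj <-]]//|iD].
    by exists i; rewrite iD eqxx.
  rewrite /offset; case: (side _ _); case: (sgn p.2 i); case: (sgn q.2 i) => /=;
    by rewrite ?mulr1 ?mulrN1 ?mul1r ?opprK.
- split; first by apply: (coords_off (I := I)) => // i /pq[].
  rewrite (coords_off (I := I)) => [|i iI|i iI].
  + rewrite qE (side_flip _ _ IK)// (_ : [exists _, _] = false) ?addbF//.
    by apply/existsP => -[j /andP[/sub/rI/negP]].
  + have [np e] := pq _ iI; move: np; rewrite !inE e.
    by [].
  + by rewrite wE// rI.
Qed.

(** The first condition excludes the tautology whose literals are the two sides of one wall: every
    chamber satisfies it, but as a clause it would forbid interior values. *)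
Definition clause (l l' : W * bool) : Prop :=
  (l.1 = l'.1 -> l.2 = l'.2) /\ forall u, side l.1 u = l.2 \/ side l'.1 u = l'.2.

Notation cmp := (@compat R W clause).
Notation eu := (@eucl R W).
Notation con := (conn cmp eu).
Notation dist := (cdist cmp eu).

(** The clause is applied to the chamber [p.1 * flip E] of the cube, at which every literal on a
    wall of the cube fails. The literal that holds is then on another wall, and is constant on the
    cube. *)
Lemma cube_step_compat p q : cube_step p q -> cmp (coords p) (coords q).
Proof.
move=> [I [IK p1 q1 pq qE]]; have [wE cpI cqI off] := cube_step_coords IK pq qE.
have coords1 p' r : (forall i, (-1 <= p'.2 ord0 i <= 1)%R) -> (-1 <= coords p' r <= 1)%R.
  move=> h; rewrite -ler_norml /coords normrM.
  by rewrite sg_norm mul1r; case: pickP => [i _|_]; rewrite ?normr_id ?normr1// ler_norml.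
split=> [r|r||]; try exact: coords1.
  exists [seq wall p.1 i | i <- enum I] => r rI.
  have [|-> ->//] := off r; move=> i iI; apply: contraNneq rI => <-.
  by apply: map_f; rewrite mem_enum.
move=> [r e] [r' e'] [/= rr cl_].
pose E i := (i \in I) && ((wall p.1 i == r) && (side r p.1 == e) ||
  (wall p.1 i == r') && (side r' p.1 == e')).
have EI i : E i -> i \in I by case/andP.
have key x d : (x = r /\ d = e) \/ (x = r' /\ d = e') -> side x (p.1 * flip E) = d ->
    coords p x = sg d /\ coords q x = sg d.
  move=> xd; have [/existsP[i /andP[iI /eqP ix]]|nx] := boolP [exists i, (i \in I) && (wall p.1 i == x)].
    rewrite (side_flip _ _ IK)//.
    rewrite (_ : [exists _, _] = (side x p.1 == d)); last first.
      apply/existsP/idP => [[j /andP[Ej /eqP jx]]|sd].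
        have ji : j = i by apply: (@wall_inj p.1); rewrite jx.
        move: Ej; rewrite ji /E iI ix /=.
        case: xd => -[xr dr] /orP[] /andP[/eqP a b].
        - by rewrite xr dr.
        - by rewrite a dr (rr (etrans (esym xr) a)).
        - by rewrite a dr -(rr (etrans (esym a) xr)).
        - by rewrite xr dr.
      exists i; rewrite ix eqxx andbT /E iI ix /=.
      by case: xd sd => -[-> ->] ->; rewrite eqxx ?orbT.
    by case: (side x p.1); case: (d).
  rewrite (side_flip _ _ IK)// (_ : [exists _, _] = false) ?addbF; last first.
    apply/existsP => -[i /andP[/EI iI ix]]; case/existsP: nx.
    by exists i; rewrite iI.
  move=> <-; apply: off => i iI; apply: contra nx => ix; apply/existsP.
  by exists i; rewrite iI.
by have [h|h] := cl_ (p.1 * flip E); [left|right]; apply: key => //; [left|right].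
Qed.

Lemma cube_step_eucl p q (c : R) : cube_step p q ->
  (forall i, `|p.2 ord0 i - q.2 ord0 i| <= c)%R -> (0 <= c)%R ->
  (eu (coords p) (coords q) <= m%:R * c)%R.
Proof.
move=> [I [IK p1 q1 pq qE]] hc c0; have [wE cpI cqI off] := cube_step_coords IK pq qE.
have us : uniq [seq wall p.1 i | i <- enum I].
  by rewrite map_inj_uniq ?enum_uniq//; exact: wall_inj.
apply: (@le_trans _ _ ((size [seq wall p.1 i | i <- enum I])%:R * c)%R); last first.
  by apply: ler_wpM2r => //; rewrite size_map -cardE ler_nat -[leqRHS]card_ord max_card.
have offs r : r \notin [seq wall p.1 i | i <- enum I] -> coords p r = coords q r.
  move=> rI; have [|-> ->//] := off r; move=> i iI; apply: contraNneq rI => <-.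
  by apply: map_f; rewrite mem_enum.
apply: eucl_bound => // r; have [/mapP[i]|/offs ->] := boolP (r \in [seq wall p.1 i | i <- enum I]).
  rewrite mem_enum => iI ->; rewrite cpI// cqI// -mulrBr normrM wall_sign_norm mul1r.
  exact: hc.
by rewrite subrr normr0.
Qed.

Lemma cube_step_coord p q i : cube_step p q ->
  (`|p.2 ord0 i - q.2 ord0 i| <= eu (coords p) (coords q))%R.
Proof.
move=> st; have [_ _ fd _] := cube_step_compat st.
have [I [IK p1 q1 pq qE]] := st; have [wE cpI cqI off] := cube_step_coords IK pq qE.
have [iI|/pq[_ ->]] := boolP (i \in I); last by rewrite subrr normr0 eucl_ge0.
apply: le_trans (eucl_coord (wall p.1 i) fd).
by rewrite cpI// cqI// -mulrBr normrM wall_sign_norm mul1r.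
Qed.

End Cover.

(** * Cubes of the clause set come from the cover *)

Section CoverMetric.
Context {R : realType} {m : nat} (K : {set {set 'I_m}}).
Hypotheses (Kc : simplicial_complex K) (Kf : flag_complex K).
Local Open Scope group_scope.

Notation W := (racg (edge K)).
Notation s_ := (gen (edge K)).
Notation pt := (W * 'rV[R]_m)%type.
Implicit Types (w u r : W) (y : 'rV[R]_m) (I : {set 'I_m}) (p q : pt).
Notation cmp := (@compat R W (@clause m K)).
Notation eu := (@eucl R W).
Notation chn := (chain cmp eu).
Notation con := (conn cmp eu).
Notation dist := (cdist cmp eu).

Lemma side_neg w u r : side r u != side r w = sep (w^-1 * r * w) (w^-1 * u).
Proof.
rewrite -{1}(mulVKg w u) side_mul; by case: (side r w); case: (sep _ _).
Qed.

Lemma sg_opp_abs (e : bool) (x : R) : (0 <= x)%R -> (sg e * x)%R <> sg (~~ e).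
Proof.
by case: e => x0 /= h; move: x0; [rewrite -[x]mul1r h|move: h; rewrite mulN1r => h]; lra.
Qed.

Lemma sg_abs_eq (e e' : bool) (a b : R) : (0 <= a)%R -> (0 <= b)%R ->
  (sg e * a = sg e' * b)%R -> e' != e -> a = 0%R.
Proof.
by case: e e' => [] [] //= a0 b0; rewrite ?mul1r ?mulN1r => h _;
  apply/eqP; rewrite eq_le a0 andbT; lra.
Qed.

(** A wall that is not [fixed] bounds the chamber [w], since the clause from [sep_hidden] would fix
    it otherwise. Two such walls commute, since the clause from [sep_adj] would fix one of them
    otherwise. By flagness they span a simplex, the cube to move in. *)
Lemma cube_step_lift p (z : W -> R) : cmp (coords p) z -> inRK K p.2 ->
  exists2 q, cube_step p q & coords q = z.
Proof.
case: p => w y cz [/= y1 yK]; set p : pt := (w, y).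
have [_ z1 _ czl] := cz; have [_ _ sub] := Kc.
have cwall j : coords p (wall w j) = (sg (side (wall w j) w) * `|y ord0 j|)%R := coords_wall p j.
pose fixed r := exists e, coords p r = sg e /\ z r = sg e.
have adjacent r : ~ fixed r -> exists i, wall w i = r.
  move=> nf; apply: contrapT => nadj.
  have nadj' i : wall w i != r by apply/eqP => h; apply: nadj; exists i.
  have cr : coords p r = sg (side r w).
    rewrite /coords; case: pickP => [i|_]; first by rewrite (negbTE (nadj' i)).
    by rewrite mulr1.
  have [[u0 ru0]|allw] := pselect (exists u, side r u != side r w); last first.
    have [|[e1 e2]|[e1 e2]] := czl (r, side r w) (r, side r w); first split=> // u.
    - by left; apply/eqP/negPn/negP => h; apply: allw; exists u.
    - by apply: nf; exists (side r w).
    - by apply: nf; exists (side r w).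
  rewrite side_neg in ru0.
  have [|j hj] := sep_hidden (@edge_sym m K) ru0.
    by move=> j /eqP; rewrite wall_eqV; exact/negP.
  (* Every chamber is on the side of [w] for [r] or beyond [wall w j]. The second literal fails at
     [p], whose coordinate there carries the sign of the side of [w]. *)
  have [|[e1 e2]|[/= e1 _]] := czl (r, side r w) (wall w j, ~~ side (wall w j) w).
  - split=> /= [rw|u]; first by have := nadj' j; rewrite rw eqxx.
    have [->|] := eqVneq (side r u) (side r w); first by left.
    rewrite side_neg => /hj; rewrite -(wallV w j) -side_neg => h; right.
    by move: h; case: (side _ u); case: (side _ w).
  - by apply: nf; exists (side r w).
  - move: e1; rewrite /lit /= -/p cwall; exact: sg_opp_abs.
pose I : {set 'I_m} := [set i | ~~ `[< fixed (wall w i) >]]%SET.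
have inI i : i \in I -> ~ fixed (wall w i) by rewrite inE => /asboolPn.
have notinI i : i \notin I -> fixed (wall w i) by rewrite inE negbK => /asboolP.
have IK : I \in K.
  apply: Kf => i j iI jI ij; apply/negPn/negP => nij.
  have [|[e1 e2]|[e1 e2]] := czl (wall w i, side (wall w i) w) (wall w j, side (wall w j) w).
  - split=> [/= /wall_inj h|/= u]; first by rewrite h eqxx in ij.
    have [->|+] := eqVneq (side (wall w i) u) (side (wall w i) w); first by left.
    have [->|+] := eqVneq (side (wall w j) u) (side (wall w j) w); first by right.
    rewrite !side_neg !wallV => uj ui.
    by have := sep_adj (@edge_sym m K) ui uj ij; rewrite /edge /= (negbTE nij).
  - by apply: (inI i iI); exists (side (wall w i) w).
  - by apply: (inI j jI); exists (side (wall w j) w).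
pose y' : 'rV[R]_m := (\row_i (if i \in I then wall_sign p i * z (wall w i) else y ord0 i))%R.
pose q : pt := (w * flip K (offset y y'), y').
have pq i : i \notin I -> i \notin supp p.2 /\ p.2 ord0 i = q.2 ord0 i.
  move=> iI; rewrite /= mxE (negbTE iI); split=> //.
  have [e [e1 e2]] := notinI i iI.
  have : `|y ord0 i| = 1%R.
    by rewrite -(sg_norm e) -e1 cwall normrM sg_norm mul1r normr_id.
  rewrite inE; have [h|h] := leP 0%R (y ord0 i).
    by rewrite ger0_norm// => ->; rewrite eqxx.
  by rewrite ltr0_norm// => /eqP; rewrite eqr_oppLR => /eqP ->; rewrite eqxx andbF.
have q1 i : (-1 <= q.2 ord0 i <= 1)%R.
  rewrite /= mxE; case: ifP => // _; rewrite -ler_norml normrM wall_sign_norm mul1r.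
  by rewrite ler_norml.
exists q; first by exists I; split.
have [wE cpI cqI off] := cube_step_coords (q := q) Kc IK pq erefl.
apply/funext => r; have [fr|nfr] := pselect (fixed r).
  have [e [e1 e2]] := fr; rewrite e2 -e1.
  have [|-> ->//] := off r; move=> i iI; apply/eqP => h; apply: (inI i iI).
  by rewrite h.
have [i ir] := adjacent r nfr; have iI : i \in I by rewrite inE; apply/asboolPn; rewrite ir.
by rewrite -ir cqI//= mxE iI mulrA wall_sign_sq mul1r.
Qed.

Lemma cube_step_inRK p q : cube_step p q -> inRK K q.2.
Proof.
move=> [I [IK p1 q1 pq _]]; split=> //; have [_ _ sub] := Kc.
apply: sub IK _; apply/fintype.subsetP => i; apply: contraTT => /pq[].
by rewrite !inE => + e; rewrite e.
Qed.

Section BasePoint.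
Variable x0 : 'rV[R]_m.

(* [(w, y)] is the point over [y] in the chamber of [w]. *)
Definition cover_pt p : Prop :=
  inRK K p.2 /\ forall i, sgn p.2 i = ab p.1 i (+) sgn x0 i.

Lemma cover_step p q : cube_step p q -> cover_pt p -> cover_pt q.
Proof.
move=> st [p1 pab]; split=> [|i]; first exact: cube_step_inRK st.
have [I [_ _ _ _ qE]] := st; rewrite qE abM ab_flip /offset pab.
by case: (ab _ _); case: (sgn x0 i); case: (sgn q.2 i).
Qed.

(** A wall separating [w] from [w'] has coordinate 0 in both points, so it bounds [w] and
    [w' = w * flip D] with [y] and [y'] vanishing on [D]. As 0 counts as positive, the signs do not
    change there, and [D] is empty. *)
Lemma coords_inj p q : cover_pt p -> cover_pt q -> coords p = coords q -> p = q.
Proof.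
case: p q => [w y] [w' y'] [/= [y1 yK] yab] [/= [y'1 y'K] y'ab] e.
set p : pt := (w, y); set q : pt := (w', y').
have [_ _ sub] := Kc.
have coordr r : side r w' != side r w -> exists2 i, wall w i = r & y ord0 i = 0%R.
  move=> rs; have := congr1 (fun f => f r) e.
  pose b : R := (if [pick i | wall w' i == r] is Some i then `|y' ord0 i| else 1)%R.
  rewrite -/p -/q /coords /= -/b => h.
  have b0 : (0 <= b)%R by rewrite /b; case: pickP => [i _|_]; [exact: normr_ge0|exact: ler01].
  move: h; case: pickP => [i /eqP ir|_] h.
    by exists i => //; apply/normr0_eq0; exact: sg_abs_eq (normr_ge0 _) b0 h rs.
  have := sg_abs_eq ler01 b0 h rs; move/eqP; rewrite oner_eq0.
  by [].
have coordr' r i : wall w' i = r -> side r w' != side r w -> y' ord0 i = 0%R.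
  move=> ir rs; have [j jr yj] := coordr r rs.
  have := congr1 (fun f => f r) e.
  rewrite -/p -/q -{1}jr -ir coords_wall coords_wall yj normr0 mulr0 => /esym/eqP.
  rewrite mulf_eq0 normr_eq0 => /orP[|/eqP//].
  by case: (side _ _) => /=; rewrite ?oppr_eq0 oner_eq0.
pose v := w^-1 * w'; pose D i := sep (s_ i) v.
have sepD r : sep r v -> exists2 i, s_ i = r & y ord0 i = 0%R.
  move=> rv; have [|i ir yi] := coordr (w * r * w^-1).
    by rewrite side_neg !mulgA mulVg mul1g mulgVK.
  by exists i => //; move: ir => /mulIg /mulgI.
have Dy i : D i -> y ord0 i = 0%R by move=> /sepD[j /gen_inj ->].
have DI i : D i -> i \in supp y.
  by move=> /Dy h; rewrite inE h eq_sym oner_eq0 eq_sym oppr_eq0 oner_eq0.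
(* No wall separates the two sides, and an element other than 1 is separated from 1 by some wall. *)
have vE : v = flip K D.
  apply/eqP; rewrite -divg_eq1; have -> : v / flip K D = flip K D * ((flip K D)^-1 * v) / flip K D.
    by rewrite mulVKg.
  have -> : (flip K D)^-1 * v = 1; last by rewrite mulg1 mulgV.
  apply: contrapT => /sep_ex[r]; apply/negP.
  set f := flip K D; have := sepM (f * r * f^-1) f (f^-1 * v).
  rewrite mulVKg !mulgA mulVg mul1g mulgVK => h.
  suff: sep (f * r / f) v = sep (f * r / f) f.
    by move=> E; move: h; rewrite E; case: (sep _ f); case: (sep r _).
  rewrite (sep_flip Kc _ yK DI); apply/idP/existsP => [rv|[i /andP[Di /eqP <-]]//].
  by have [i ir _] := sepD _ rv; exists i; rewrite -ir eqxx andbT /D ir.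
have w'E : w' = w * flip K D by rewrite -vE mulVKg.
have D0 i : ~~ D i.
  apply/negP => Di; have yi := Dy i Di.
  have wE : wall w' i = wall w i by rewrite w'E (wall_flip Kc _ yK DI (DI i Di)).
  have y'i : y' ord0 i = 0%R by apply: coordr' wE _; rewrite side_neg wallV.
  have := yab i; have := y'ab i; rewrite w'E abM ab_flip Di /sgn yi y'i ltxx.
  by case: (ab w i); case: (_ < _)%R.
have ww' : w = w' by rewrite w'E flip0// mulg1.
rewrite /p /q -ww'; congr pair; apply/rowP => i.
have sE : sgn y i = sgn y' i by rewrite yab y'ab ww'.
have h1 := coords_wall ((w, y) : pt) i; have h2 := coords_wall ((w, y') : pt) i.
move: h1; rewrite e -ww' h2 /=.
move=> /(congr1 (fun x => sg (side (wall w i) w) * x)%R); rewrite !mulrA sg_sq !mul1r.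
move: sE; rewrite /sgn; case: (ltP (y _ _)) => h; case: (ltP (y' _ _)) => h' // _.
  by rewrite !ltr0_norm// => /oppr_inj.
by rewrite !ger0_norm.
Qed.

End BasePoint.
End CoverMetric.

Section MetricOf.
Context {R : realType} {X : choiceType} (d : X -> X -> R)
  (d_xx : forall x, d x x = 0) (d_eq0 : forall x y, d x y = 0 -> x = y)
  (d_sym : forall x y, d x y = d y x) (d_tri : forall y x z, d x z <= d x y + d y z).

(* The proofs are arguments so that the metric structure can be inferred. *)
Definition metric_of : Type := let _ := (d_xx, d_eq0, d_sym, d_tri) in X.

HB.instance Definition _ := Choice.on metric_of.
HB.instance Definition _ := isMetric.Build R metric_of d_xx d_eq0 d_sym d_tri.

End MetricOf.

(** * From Stewart's inequality to CAT(0) and to contractions *)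

Section StewartCAT0.
Context {R : realType} (X : metricType R).
Hypotheses (X0 : [set: X] !=set0) (SX : stewart_space (@mdist R X) [set: X]).

Let dge0 := @mdist_ge0 R X.
Let dxx := @mdistxx R X.
Let dsym := @metric_sym R X.
Let dtri : triangle_on (@mdist R X) [set: X].
Proof. by move=> y x z _ _ _; exact: metric_triangle. Qed.

(** Stewart's inequality for the cevian from [m] to [m'] is the upper bound; the triangle inequality
    along [x], [m], [m'], [y] is the lower one. *)
Lemma stewart_cut (x y m m' : X) (s t : R) : 0 <= s <= 1 -> 0 <= t <= 1 ->
  (forall p, stewart mdist s p x y m) -> (forall p, stewart mdist t p x y m') ->
  mdist m m' = `|s - t| * mdist x y.
Proof.
move=> s01 t01 hm hm'.
have xm := stewart_endl dge0 dxx s01 (hm x).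
have xm' := stewart_endl dge0 dxx t01 (hm' x).
have ym := stewart_endr dge0 dxx dsym s01 (hm y).
have ym' := stewart_endr dge0 dxx dsym t01 (hm' y).
have [/andP[s0 s1] /andP[t0 t1]] := (s01, t01).
have D0 := dge0 x y.
apply/eqP; rewrite eq_le; apply/andP; split.
  rewrite -ler_sqr ?nnegrE ?dge0 ?mulr_ge0 ?normr_ge0// exprMn real_normK ?num_real//.
  apply: le_trans (hm' m) _.
  have h1 : mdist m x ^+ 2 <= (s * mdist x y) ^+ 2.
    by rewrite dsym ler_sqr ?nnegrE ?dge0 ?mulr_ge0.
  have h2 : mdist m y ^+ 2 <= ((1 - s) * mdist x y) ^+ 2.
    by rewrite dsym ler_sqr ?nnegrE ?dge0 ?mulr_ge0// subr_ge0.
  have t1' : 0 <= 1 - t by rewrite subr_ge0.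
  have := ler_wpM2l t1' h1; have := ler_wpM2l t0 h2.
  by move: (mdist x y) (mdist m x) (mdist m y) => D a b; lra.
have tri1 := metric_triangle x m y; have tri2 := metric_triangle m m' y.
have tri3 := metric_triangle x m' y; have tri4 := metric_triangle m' m y.
rewrite (dsym m' m) in tri4; rewrite (dsym y m) in ym; rewrite (dsym y m') in ym'.
have [st|st] := leP t s; first by rewrite ger0_norm ?subr_ge0//; lra.
by rewrite ltr0_norm ?subr_lt0//; lra.
Qed.

(** [k x t] divides the geodesic from [b] to [x] in the ratio [t]. Two uses of Stewart's inequality
    show that at equal times distances shrink by the factor [t'], and [stewart_cut] compares two
    times. *)
Lemma stewart_contraction (b : X) : exists k : X -> R -> X,
  [/\ forall x, k x 0 = b, forall x, k x 1 = x, forall t, 0 <= t <= 1 -> k b t = b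
    & forall x x' t t', 0 <= t <= 1 -> 0 <= t' <= 1 ->
      mdist (k x t) (k x' t') <= mdist x x' + `|t - t'| * mdist b x].
Proof.
have kP (z : X * R) : exists m : X, 0 <= z.2 <= 1 -> forall p, stewart mdist z.2 p b z.1 m.
  have [t01|nt] := pselect (0 <= z.2 <= 1); last by exists b => /nt.
  by have [m _ hm] := SX (I : [set: X] b) (I : [set: X] z.1) t01; exists m => _ p; exact: hm.
have [k hk] := choice kP.
have e0 (x y : X) : mdist x y <= 0 -> y = x.
  by move=> h; apply/esym/mdist_positivity/eqP; rewrite eq_le h dge0.
have t0 : 0 <= (0 : R) <= 1 by rewrite lexx ler01.
have t1 : 0 <= (1 : R) <= 1 by rewrite lexx ler01.
exists (fun x t => k (x, t)); split=> [x|x|t t01|x x' t t' t01 t'01].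
- by apply: e0; have := stewart_endl dge0 dxx t0 (hk (x, 0) t0 b); rewrite mul0r.
- by apply: e0; have := stewart_endr dge0 dxx dsym t1 (hk (x, 1) t1 x); rewrite subrr mul0r.
- by apply: e0; have := stewart_endl dge0 dxx t01 (hk (b, t) t01 b); rewrite dxx mulr0.
apply: le_trans (metric_triangle _ (k (x, t')) _) _; rewrite addrC; apply: lerD; last first.
  by rewrite (stewart_cut t01 t'01 (hk (x, t) t01) (hk (x, t') t'01)).
have [/andP[a0 a1] D0] := (t'01, dge0 b x).
have h1 := hk (x', t') t'01 (k (x, t')); have h2 := hk (x, t') t'01 x'.
have h3 : mdist (k (x, t')) b ^+ 2 <= (t' * mdist b x) ^+ 2.
  rewrite dsym ler_sqr ?nnegrE ?dge0 ?mulr_ge0//.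
  by have := stewart_endl dge0 dxx t'01 (hk (x, t') t'01 b).
suff h : mdist (k (x, t')) (k (x', t')) ^+ 2 <= (t' * mdist x x') ^+ 2.
  apply: (@le_trans _ _ (t' * mdist x x')); last by rewrite ler_piMl.
  by move: h; rewrite ler_sqr ?nnegrE ?dge0 ?mulr_ge0.
apply: le_trans h1 _; rewrite /stewart /= in h2.
have a1' : 0 <= 1 - t' by rewrite subr_ge0.
have := ler_wpM2l a1' h3; have := ler_wpM2l a0 h2.
rewrite (dsym (k (x, t')) x') (dsym x' b) (dsym x' x).
by rewrite /=; lra.
Qed.

Lemma stewart_geodesic_space : geodesic_space X.
Proof.
move=> x y.
have mP (t : R) : exists m : X, 0 <= t <= 1 -> forall p, stewart mdist t p x y m.
  have [t01|nt] := pselect (0 <= t <= 1); last by exists x => /nt.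
  by have [m _ hm] := SX (I : [set: X] x) (I : [set: X] y) t01; exists m => _ p; exact: hm.
have [c cP] := choice mP; exists c; split.
- have t01 : 0 <= (0 : R) <= 1 by rewrite lexx ler01.
  apply/esym/mdist_positivity/eqP; rewrite eq_le dge0 andbT.
  by have := stewart_endl dge0 dxx t01 (cP 0 t01 x); rewrite mul0r.
- have t01 : 0 <= (1 : R) <= 1 by rewrite lexx ler01.
  apply/esym/mdist_positivity/eqP; rewrite eq_le dge0 andbT.
  by have := stewart_endr dge0 dxx dsym t01 (cP 1 t01 y); rewrite subrr mul0r.
- move=> s t; rewrite !in_itv /= => s01 t01.
  by apply: stewart_cut => // p; exact: cP.
Qed.

(** The inequality is used for the cevians from both ends of side [j] to side [i], and from [c i s]
    to side [j]. In the comparison triangle all three are equalities. *)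
Lemma stewart_CAT0 : CAT0_space X.
Proof.
split=> //; first exact: stewart_geodesic_space.
move=> v c w geo cmp i j s t; rewrite !in_itv /= => s01 t01.
have st k u : 0 <= u <= 1 -> forall p, stewart mdist u p (v k) (v (ordS k)) (c k u).
  move=> u01 p; have [c0 c1 cl] := geo k.
  have o0 : 0 \in `[0, 1 : R] by rewrite in_itv /= lexx ler01.
  have o1 : 1 \in `[0, 1 : R] by rewrite in_itv /= lexx ler01.
  have ou : u \in `[0, 1 : R] by rewrite in_itv.
  have /andP[u0 u1] := u01.
  apply: (stewart_mid dge0 dsym dtri SX) => //.
  - by rewrite -{1}c0 cl// sub0r normrN ger0_norm.
  - by rewrite -{1}c1 cl// ger0_norm// subr_ge0.
have [/andP[s0 s1] /andP[t0 t1]] := (s01, t01).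
have s1' : 0 <= 1 - s by rewrite subr_ge0.
have t1' : 0 <= 1 - t by rewrite subr_ge0.
have sqE (a b : 'rV[R]_2) : Defs.edist a b ^+ 2 = \sum_(k < 2) (a ord0 k - b ord0 k) ^+ 2.
  by rewrite sqr_sqrtr// sumr_ge0// => k _; exact: sqr_ge0.
rewrite -ler_sqr ?nnegrE ?dge0 ?sqrtr_ge0//.
have := st j t t01 (c i s); have := st i s s01 (v j); have := st i s s01 (v (ordS j)).
rewrite /stewart (dsym (c i s) (v j)) (dsym (c i s) (v (ordS j))) -!cmp !sqE.
rewrite !big_ord_recl !big_ord0 !mxE.
move: (w j ord0 _) (w j ord0 _) => a0 a1.
move: (w (ordS j) ord0 _) (w (ordS j) ord0 _) => b0 b1.
move: (w i ord0 _) (w i ord0 _) (w (ordS i) ord0 _) (w (ordS i) ord0 _) => e0 e1 f0 f1.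
move=> /(ler_wpM2l t0) h2 /(ler_wpM2l t1') h1 h; apply: le_trans h _.
by move: h1 h2; lra.
Qed.

End StewartCAT0.

(** * The cover as a metric space *)

Section CoverSpace.
Context {R : realType} {m : nat} (K : {set {set 'I_m}}).
Hypotheses (Kc : simplicial_complex K) (Kf : flag_complex K).
Local Open Scope group_scope.

Notation W := (racg (edge K)).
Notation s_ := (gen (edge K)).
Notation pt := (W * 'rV[R]_m)%type.
Implicit Types (w u r : W) (y z : 'rV[R]_m) (I : {set 'I_m}) (p q : pt).
Notation cmp := (@compat R W (@clause m K)).
Notation eu := (@eucl R W).
Notation chn := (chain cmp eu).
Notation con := (conn cmp eu).
Notation dist := (cdist cmp eu).

Definition near_pts (y z : 'rV[R]_m) : Prop := forall i, (`|y ord0 i - z ord0 i| < 1)%R.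

Lemma near_ptsC y z : near_pts y z -> near_pts z y.
Proof. by move=> h i; rewrite distrC. Qed.

(** A coordinate equal to 1 or -1 cannot change sign within a distance less than 1, so the letters
    of a short move belong to a simplex and commute. *)
Lemma offset_supp y z i : inRK K y -> inRK K z -> near_pts y z -> offset y z i ->
  i \in supp y.
Proof.
move=> [y1 _] [z1 _] /(_ i); move: (y1 i) (z1 i) => /andP[y2 y3] /andP[z2 z3] yz.
rewrite inE /offset /sgn; apply: contraTT; rewrite negb_and !negbK => /orP[] /eqP yi.
  move: yz; rewrite yi ltr_norml ltr10 => /andP[a b].
  by rewrite (_ : (z ord0 i < 0)%R = false)//; apply/negP => h; lra.
move: yz; rewrite yi ltr_norml ltrN10 => /andP[a b].
by rewrite (_ : (z ord0 i < 0)%R = true)//; apply/idP; lra.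
Qed.

Lemma offsetC y z : offset y z =1 offset z y.
Proof. by move=> i; rewrite /offset addbC. Qed.

Lemma flip_offset_cocycle I y y' y'' : I \in K ->
  (forall i, offset y y' i -> i \in I) -> (forall i, offset y' y'' i -> i \in I) ->
  flip K (offset y y') * flip K (offset y' y'') = flip K (offset y y'').
Proof.
move=> IK h h'; rewrite (flipM Kc IK h h'); apply: flip_eq => i.
by rewrite /offset; case: (sgn y i); case: (sgn y' i); case: (sgn y'' i).
Qed.

(** Both offsets lie in the simplex of the middle point. *)
Lemma flip_near_cocycle y y' y'' : inRK K y -> inRK K y' -> inRK K y'' ->
  near_pts y y' -> near_pts y' y'' ->
  flip K (offset y y') * flip K (offset y' y'') = flip K (offset y y'').
Proof.
move=> ky ky' ky'' n n'; apply: (@flip_offset_cocycle (supp y')); first by case: ky'.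
  by move=> i; rewrite offsetC; apply: offset_supp => //; exact: near_ptsC.
by move=> i; exact: offset_supp.
Qed.

Lemma flip_offset_id y : flip K (offset y y) = 1.
Proof. by apply: flip0 => i; rewrite /offset addbb. Qed.

Section BasePoint.
Variable x0 : 'rV[R]_m.
Hypothesis x0K : inRK K x0.
Notation cover_pt := (cover_pt x0).
Notation base := ((1, x0) : pt).

Lemma cover_base : cover_pt base.
Proof. by split=> //= i; rewrite ab1. Qed.

(** By [cube_step_lift], chains never leave the cover. On a chain shorter than 1 all points are near
    each other, so the changes of chamber compose and depend on the endpoints only. *)
Lemma chain_lift p (z : W -> R) L : chn (coords p) z L -> cover_pt p ->
  exists q, [/\ cover_pt q, coords q = z, forall i, (`|p.2 ord0 i - q.2 ord0 i| <= L)%R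
    & (L < 1)%R -> q.1 = p.1 * flip K (offset p.2 q.2)].
Proof.
move=> h; move E0: (coords p) h => f h; elim: h p E0 => {f z L} [f _ p pf cp|
    f z u L zf fu IH p pz cp].
  exists p; split=> // [i|_]; first by rewrite subrr normr0.
  by rewrite flip_offset_id mulg1.
rewrite -pz in zf.
have [q pq qf] := cube_step_lift Kc Kf zf cp.1.
have cq := cover_step Kc pq cp.
have [q' [cq' q'u le E]] := IH q qf cq.
have e0 : (0 <= eu z f)%R := eucl_ge0 _ _.
have L0 : (0 <= L)%R := chain_ge0 (@eucl_ge0 _ _) fu.
have pqc i : (`|p.2 ord0 i - q.2 ord0 i| <= eu z f)%R.
  by rewrite -pz -qf; exact: (cube_step_coord Kc).
exists q'; split=> // [i|lt1].
  rewrite -(subrKA (q.2 ord0 i)); apply: le_trans (ler_normD _ _) _.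
  exact: lerD.
rewrite E; last by lra.
have [_ [_ _ _ _ ->]] := pq.
rewrite -mulgA flip_near_cocycle//; [exact: cp.1|exact: cq.1|exact: cq'.1|move=> i..].
  by apply: le_lt_trans (pqc i) _; lra.
by apply: le_lt_trans (le i) _; lra.
Qed.

Definition vert y : 'rV[R]_m := (\row_i (sg (~~ sgn y i)))%R.

Lemma sgn_vert y : sgn (vert y) =1 sgn y.
Proof.
move=> i; rewrite /sgn mxE -/(sgn y i); case: (sgn y i) => /=.
  by rewrite ltrN10.
by rewrite ltr10.
Qed.

Lemma vert1 y i : (-1 <= vert y ord0 i <= 1)%R.
Proof. by rewrite -ler_norml mxE sg_norm. Qed.

Lemma supp_vert y i : i \notin supp (vert y).
Proof. by rewrite inE mxE; case: (sgn y i); rewrite /= eqxx ?andbF. Qed.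

Lemma inRK_vert y : inRK K (vert y).
Proof.
split=> [i|]; first exact: vert1.
rewrite (_ : supp _ = finset.set0); first by case: Kc.
by apply/setP => i; rewrite finset.in_set0; apply/negbTE; exact: supp_vert.
Qed.

Lemma vert_eq y z : sgn y =1 sgn z -> vert y = vert z.
Proof. by move=> yz; apply/rowP => i; rewrite !mxE yz. Qed.

Lemma cover_vert w y : cover_pt (w, y) -> cube_step (w, y) (w, vert y) /\ cover_pt (w, vert y).
Proof.
move=> [[y1 yK] yab]; split; last first.
  by split=> [|i]; [exact: inRK_vert|rewrite -yab /= sgn_vert].
exists (supp y); split=> // [i|i iy|].
- exact: vert1.
- split=> //=; rewrite mxE; move: iy; rewrite inE negb_and !negbK /sgn => /orP[] /eqP ->.
    by rewrite ltr10.
  by rewrite ltrN10.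
- by rewrite flip0 ?mulg1// => i; rewrite /offset sgn_vert addbb.
Qed.

(** Each point is joined to the vertex of its chamber, and the vertices of neighbouring chambers are
    joined by an edge, following a word for the chamber. *)
Lemma cover_con p : cover_pt p -> con (coords base) (coords p).
Proof.
have viavert w y : cover_pt (w, y) -> con (coords (w, vert y)) (coords (w, y)).
  move=> /cover_vert[st _]; apply/con_sym/compat_con; exact: (cube_step_compat Kc).
case: p => w y; have [l ->] := cl_surj w.
elim/last_ind: l y => [|l i IH] y cp.
  apply: conn_trans (viavert _ _ cp).
  have -> : vert y = vert x0 by apply: vert_eq => i; have [_ /(_ i)] := cp; rewrite /= cl_nil ab1.
  rewrite cl_nil; apply: compat_con; apply: (cube_step_compat Kc).
  by have [] := cover_vert cover_base.
apply: conn_trans (viavert _ _ cp).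
pose y' : 'rV[R]_m := (\row_j (if j == i then - vert y ord0 j else vert y ord0 j))%R.
have sy' j : sgn y' j = sgn y j (+) (i == j).
  rewrite -[sgn y j]sgn_vert /sgn !mxE (eq_sym i); case: (j == i); last by rewrite addbF.
  by case: (sgn y j); rewrite /= ?opprK ltrN10 ltr10.
have y'1 j : (-1 <= y' ord0 j <= 1)%R.
  by rewrite -ler_norml mxE; case: ifP => _; rewrite ?normrN mxE sg_norm.
have cw' : cover_pt (cl (edge K) l, y').
  split=> [|j] /=.
    split=> //; rewrite (_ : supp _ = finset.set0); first by case: Kc.
    apply/setP => j; rewrite finset.in_set0 inE !mxE.
    by case: ifP => _; case: (sgn y j); rewrite /= ?opprK eqxx ?andbF.
  have [_ /(_ j)] := cp; rewrite /= cl_rcons abM ab_gen sy' => ->.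
  by case: (ab _ _); case: (sgn x0 j); case: (i == j).
apply: conn_trans (IH _ cw') _; apply: compat_con; apply: (cube_step_compat Kc).
have [_ iK _] := Kc.
exists [set i]%SET; split=> // [j|j|].
- exact: vert1.
- rewrite inE => ji; split; last by rewrite /= [in LHS]mxE (negbTE ji).
  by rewrite inE mxE (negbTE ji) mxE; case: (sgn y j); rewrite /= eqxx ?andbF.
- rewrite /= cl_rcons -flip1; congr (_ * _); apply: flip_eq => j.
  by rewrite /offset sy' sgn_vert /= eq_sym; case: (sgn y j); case: (_ == _).
Qed.

(** The coordinates that reach 1 or -1 at [y] are moved first, within the cube of [z] and without a
    change of sign; the rest of the motion is in the cube of [y]. Each of the two steps moves at
    most [m] coordinates by at most [c]. *)
Lemma cover_near p y (c : R) : cover_pt p -> inRK K y ->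
  (forall i, `|p.2 ord0 i - y ord0 i| <= c)%R -> (0 <= c < 1)%R ->
  let q : pt := (p.1 * flip K (offset p.2 y), y) in
  cover_pt q /\ (dist (coords p) (coords q) <= 2 * m%:R * c)%R.
Proof.
case: p => w z; set p : pt := (w, z) => cp ky hc /andP[c0 c1] q.
have [[z1 zK] zab] := cp; have [y1 yK] := ky.
have nzy : near_pts z y by move=> i; exact: le_lt_trans (hc i) c1.
pose v : 'rV[R]_m := (\row_i (if (i \in supp z) && (i \notin supp y) then y ord0 i else z ord0 i))%R.
have v1 i : (-1 <= v ord0 i <= 1)%R by rewrite mxE; case: ifP.
have osub i : offset z y i -> (i \in supp z) && (i \in supp y).
  move=> h; rewrite (offset_supp (z := y))//=.
  by rewrite (offset_supp (z := z))//; [exact: near_ptsC|rewrite offsetC].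
have sv : sgn v =1 sgn z.
  move=> i; rewrite /sgn mxE; case: ifP => // /andP[_ iy].
  have := osub i; rewrite (negbTE iy) andbF /offset /sgn.
  by case: (z ord0 i < 0)%R; case: (y ord0 i < 0)%R => // /(_ isT).
have st1 : cube_step p ((w, v) : pt).
  exists (supp z); split=> // [i iz|].
    by split=> //=; rewrite mxE (negbTE iz).
  by rewrite flip0 ?mulg1// => i; rewrite /offset sv addbb.
have offy i : i \notin supp y -> v ord0 i = y ord0 i.
  move=> iy; rewrite mxE iy andbT; case: ifP => // /negbT iz.
  have : (`|z ord0 i - y ord0 i| < 1)%R := nzy i.
  move: iy iz; rewrite !inE !negb_and !negbK.
  by move=> /orP[] /eqP -> /orP[] /eqP -> //; rewrite ltr_norml => /andP[]; lra.
have st2 : cube_step ((w, v) : pt) q.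
  exists (supp y); split=> // [i iy|]; last first.
    by rewrite /=; congr (_ * _); apply: flip_eq => i; rewrite /offset sv.
  split; last by rewrite /= offy.
  by move: (offy _ iy) (iy); rewrite ![i \in supp _]inE /= => ->.
have cv := cover_step Kc st1 cp.
have cq : cover_pt q := cover_step Kc st2 cv.
split; first exact: cq.
have cc1 := cube_step_compat Kc st1; have cc2 := cube_step_compat Kc st2.
apply: le_trans (dist_tri (compat_con cc1) (compat_con cc2)) _.
have -> : (2 * m%:R * c = m%:R * c + m%:R * c)%R by ring.
apply: lerD.
  apply: le_trans (compat_dist cc1) _; apply: (cube_step_eucl Kc st1) => // i /=.
  by rewrite mxE; case: ifP => _; rewrite ?subrr ?normr0.
apply: le_trans (compat_dist cc2) _; apply: (cube_step_eucl Kc st2) => // i /=.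
by rewrite mxE; case: ifP => _; rewrite ?subrr ?normr0.
Qed.

Definition cover : Type := {p : pt | `[< cover_pt p >]}.

HB.instance Definition _ := Choice.on cover.

Lemma coverP (a : cover) : cover_pt (val a).
Proof. by case: a => p /= /asboolP. Qed.

Definition mk_cover p (cp : cover_pt p) : cover := exist _ p (asboolT cp).

Definition cdst (a b : cover) : R := dist (coords (val a)) (coords (val b)).

Lemma cover_conn (a b : cover) : con (coords (val a)) (coords (val b)).
Proof.
by apply: conn_trans (con_sym (cover_con (coverP a))) _; exact: cover_con (coverP b).
Qed.

Lemma cdst_xx a : cdst a a = 0%R. Proof. exact: dist_xx. Qed.

Lemma cdst_eq0 a b : cdst a b = 0%R -> a = b.
Proof.
move=> ab; apply: val_inj; apply: (coords_inj Kc (coverP a) (coverP b)).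
apply/funext => r; apply/eqP; rewrite -subr_eq0 -normr_le0 -ab.
exact: dist_coord (cover_conn a b).
Qed.

Lemma cdst_sym a b : cdst a b = cdst b a. Proof. exact: dist_sym. Qed.

Lemma cdst_tri b a c : (cdst a c <= cdst a b + cdst b c)%R.
Proof. apply: dist_tri; exact: cover_conn. Qed.

Definition cover_space : Type := metric_of cdst_xx cdst_eq0 cdst_sym cdst_tri.
HB.instance Definition _ := Metric.on cover_space.

Lemma cdst_stewart : stewart_space cdst [set: cover].
Proof.
move=> q r t _ _ t01.
have [f cf hf] := component_stewart (cover_con (coverP q)) (cover_con (coverP r)) t01.
have [L hL] : con (coords (val q)) f := conn_trans (con_sym (cover_con (coverP q))) cf.
have [p [cp pf _ _]] := chain_lift hL (coverP q).
exists (mk_cover cp) => // p' _.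
have := hf _ (cover_con (coverP p')); rewrite /stewart /cdst /= pf.
by [].
Qed.

Lemma cover_CAT0 : CAT0_space cover_space.
Proof.
by apply: stewart_CAT0; [exists (mk_cover cover_base)|exact: cdst_stewart].
Qed.

(** A partial converse of [cover_near]. In particular, distinct points of one fibre are at distance
    at least 1, whence the properness of the action. *)
Lemma cdst_small (a b : cover) : (cdst a b < 1)%R ->
  (val b).1 = (val a).1 * flip K (offset (val a).2 (val b).2) /\
  forall i, (`|(val a).2 ord0 i - (val b).2 ord0 i| <= cdst a b)%R.
Proof.
move=> ab1.
have lift (L : R) : chn (coords (val a)) (coords (val b)) L -> (L < 1)%R ->
    (val b).1 = (val a).1 * flip K (offset (val a).2 (val b).2) /\
    forall i, (`|(val a).2 ord0 i - (val b).2 ord0 i| <= L)%R.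
  move=> hL L1; have [q [cq qb le fl]] := chain_lift hL (coverP a).
  by have <- : q = val b := coords_inj Kc cq (coverP b) qb; split=> //; exact: fl.
have [L hL L1] := cdist_lt (cover_conn a b) ab1.
split=> [|i]; first by have [] := lift L hL L1.
apply/ler_addgt0Pr => e e0.
have [|L' hL' L'1] := @cdist_lt _ _ _ _ _ _ (Num.min 1 (cdst a b + e))%R (cover_conn a b).
  by rewrite lt_min ab1 ltrDl.
move: L'1; rewrite lt_min => /andP[L'1 L'e].
by have [_ /(_ i) le] := lift L' hL' L'1; apply: le_trans le (ltW L'e).
Qed.

End BasePoint.
End CoverSpace.

(** * Covering dimension *)

Section CoverDimension.
Context {R : realType} {m : nat} (K : {set {set 'I_m}}).
Hypotheses (Kc : simplicial_complex K) (Kf : flag_complex K).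
Context (x0 : 'rV[R]_m) (x0K : inRK K x0).

Notation W := (racg (edge K)).
Notation X := (cover_space Kc x0K).
Notation near_pts := (@near_pts R m).
Implicit Types (w : W) (y z : 'rV[R]_m) (a b : cover K x0).

Lemma inRK_closed y : (forall e : R, 0 < e -> exists2 z, inRK K z &
  forall i, `|z ord0 i - y ord0 i| < e) -> inRK K y.
Proof.
move=> hy; split=> [i|].
  rewrite -ler_norml; apply/ler_addgt0Pr => e /hy[z [z1 _] /(_ i)].
  have := z1 i; rewrite -ler_norml distrC => zi yz.
  by have := ler_normD (y ord0 i - z ord0 i) (z ord0 i); rewrite subrK; lra.
pose e := \big[Num.min/1]_(i in supp y) Num.min `|1 - y ord0 i| `|-1 - y ord0 i|.
have e0 : 0 < e.
  apply: lt_bigmin => // i; rewrite inE => /andP[n1 n2].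
  by rewrite lt_min !normr_gt0 !subr_eq0 eq_sym n1 eq_sym n2.
have [z [_ zK] zy] := hy e e0; have [_ _ sub] := Kc.
apply: sub zK _; apply/fintype.subsetP => i iy; rewrite inE.
have ei : e <= Num.min `|1 - y ord0 i| `|-1 - y ord0 i| by exact: bigmin_le_cond.
have := lt_le_trans (zy i) ei.
rewrite lt_min => /andP[h1 h2]; apply/andP; split; apply/negP => /eqP zi.
  by rewrite zi ltxx in h1.
by rewrite zi ltxx in h2.
Qed.

Lemma cover_val a : val a = (((val a).1 : W), (val a).2). Proof. by case: (val a). Qed.

Lemma cdst_near a b (c : R) :
  (val b).1 = ((val a).1 * flip K (offset (val a).2 (val b).2))%g ->
  (forall i, `|(val a).2 ord0 i - (val b).2 ord0 i| <= c) -> 0 <= c < 1 ->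
  cdst a b <= 2 * m%:R * c.
Proof.
move=> bE hc c01; have [kb _] := coverP b.
have [_ le] := cover_near Kc (coverP a) kb hc c01.
by rewrite /cdst (cover_val b) bE.
Qed.

Definition chamber_sign w : pred 'I_m := fun i => ab w i (+) sgn x0 i.

Definition sec_pt w y : W * 'rV[R]_m :=
  ((w * flip K (fun i => chamber_sign w i (+) sgn y i))%g, y).

Lemma cover_sec w y : inRK K y -> cover_pt x0 (sec_pt w y).
Proof.
move=> yK; split=> // i /=; rewrite abM ab_flip /chamber_sign.
by case: (ab w i); case: (sgn x0 i); case: (sgn y i).
Qed.

(* The closed star of the chamber [w], slightly shrunk, projected to R_K. *)
Definition star w : set 'rV[R]_m :=
  [set y | inRK K y /\ forall i, - (1 / 2) <= sg (~~ chamber_sign w i) * y ord0 i].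

Definition sec w y : X :=
  if pselect (inRK K y) is left yK then mk_cover (cover_sec w yK) else mk_cover (cover_base x0K).

Lemma val_sec w y : inRK K y -> val (sec w y : cover K x0) = sec_pt w y.
Proof. by move=> yK; rewrite /sec; case: pselect. Qed.

(** The benefit of shrinking the star: a coordinate on the wrong side has absolute value at most
    1/2, so it is interior. *)
Lemma star_supp w y i : star w y -> chamber_sign w i (+) sgn y i -> i \in supp y.
Proof.
move=> [_ /(_ i)]; rewrite inE /sgn; case: (chamber_sign w i) => /=.
  rewrite mulN1r => h; case: ltP => // y0 _.
  by apply/andP; split; apply/eqP => yi; move: h y0; rewrite yi; lra.
rewrite mul1r => h; case: ltP => // y0 _.
by apply/andP; split; apply/eqP => yi; move: h y0; rewrite yi; lra.
Qed.

Lemma sec_near w y z : star w y -> inRK K z -> near_pts y z ->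
  (sec_pt w z).1 = ((sec_pt w y).1 * flip K (offset y z))%g.
Proof.
move=> sy zK yz; have [yK _] := sy; rewrite /= -mulgA; congr (_ * _)%g.
rewrite (@flipM _ _ Kc (supp y)) ?yK.2//.
- apply: flip_eq => i; rewrite /offset.
  by case: (chamber_sign w i); case: (sgn y i); case: (sgn z i).
- by move=> i; exact: star_supp sy.
- by move=> i; exact: (offset_supp (K := K)) yz.
Qed.

Lemma sec_dist w y z (c : R) : star w y -> inRK K z ->
  (forall i, `|y ord0 i - z ord0 i| <= c) -> 0 <= c < 1 ->
  cdst (sec w y : cover K x0) (sec w z) <= 2 * m%:R * c.
Proof.
move=> sy zK yz c01; have [yK _] := sy.
apply: cdst_near => //; rewrite !val_sec//.
by apply: sec_near => // i; apply: le_lt_trans (yz i) _; case/andP: c01.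
Qed.

Lemma star_closed w y : (forall e : R, 0 < e -> exists2 z, star w z &
  forall i, `|z ord0 i - y ord0 i| < e) -> star w y.
Proof.
move=> hy; split=> [|i].
  by apply: inRK_closed => e /hy[z [zK _] zy]; exists z.
apply/ler_addgt0Pr => e /hy[z [_ /(_ i) +] /(_ i)].
by case: (chamber_sign w i) => /=; rewrite ?mulN1r ?mul1r ltr_norml => h /andP[]; lra.
Qed.

Lemma star_compact w : compact (star w : set 'rV[R]_m).
Proof.
apply: (@subclosed_compact _ _ [set y : 'rV[R]_m | forall i, `[-1, 1]%classic (y ord0 i)]).
- move=> y cly; apply: star_closed => e e0.
  have [z [sz [_ yz]]] := cly _ (nbhsx_ballx y e e0).
  by exists z => // i; rewrite distrC; exact: yz.
- by apply: (@rV_compact R m (fun=> `[-1, 1]%classic)) => _; exact: segment_compact.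
- by move=> y [[y1 _] _] i; rewrite /= in_itv; exact: y1.
Qed.

Lemma sec_star_compact w : compact (sec w @` star w).
Proof.
apply: continuous_compact; last exact: star_compact.
apply/subspace_continuousP => y sy; apply/cvg_ballP => e e0.
pose c := Num.min (1 / 2) (e / (4 * m.+1%:R)).
have c0 : 0 < c by rewrite lt_min divr_gt0//= divr_gt0// mulr_gt0.
have ce : c <= e / (4 * m.+1%:R) by rewrite /c ge_min lexx orbT.
have c2 : c <= 1 / 2 by rewrite /c ge_min lexx.
apply: filterS (nbhsx_ballx y c c0) => z [_ yz] sz; have [zK _] := sz.
rewrite ballEmdist /=; apply: (@le_lt_trans _ _ (2 * m%:R * c)).
  apply: sec_dist => // [i|]; first by apply: ltW; exact: yz.
  by apply/andP; split; lra.
have : 4 * m.+1%:R * c <= e by rewrite mulrC -ler_pdivlMr// mulr_gt0.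
have Mc := mulr_ge0 (ler0n R m) (ltW c0).
by rewrite -(natr1 m) => ce4; lra.
Qed.

(** A Lebesgue number for the cover on the compact star, found by contradiction from a cluster point
    of bad points. *)
Lemma star_lebesgue w (C : set (set X)) : open_cover C -> exists2 del : R, 0 < del &
  forall y, star w y -> exists2 U, C U &
    forall z, star w z -> (forall i, `|y ord0 i - z ord0 i| < del) -> U (sec w z).
Proof.
move=> [Copen Ccov]; apply: contrapT => nodel.
have bad n : exists y, star w y /\ forall U, C U -> exists z, [/\ star w z,
    forall i, `|y ord0 i - z ord0 i| < n.+1%:R^-1 & ~ U (sec w z)].
  apply: contrapT => nb; apply: nodel; exists n.+1%:R^-1; first by rewrite invr_gt0.
  move=> y sy; apply: contrapT => nU; apply: nb; exists y; split=> // U CU.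
  apply: contrapT => nz; apply: nU; exists U => // z sz yz.
  by apply: contrapT => nUz; apply: nz; exists z.
have [u uP] := choice bad.
have [k i||f _ flim] := @cluster_point R 'I_m (enum 'I_m) (fun _ => 0) (fun n i => u n ord0 i).
- by have [[[u1 _] _] _] := uP k; exact: u1.
- by move=> k t; rewrite mem_enum.
pose y : 'rV[R]_m := \row_i f i.
have ylim (e : R) k0 : 0 < e -> exists2 k, (k0 <= k)%N & forall i, `|u k ord0 i - y ord0 i| < e.
  by move=> e0; have [k k0k hk] := flim e k0 e0; exists k => // i; rewrite mxE.
have sy : star w y.
  apply: star_closed => e e0; have [k _ hk] := ylim e 0%N e0.
  by exists (u k) => //; have [] := uP k.
have [yK _] := sy.
have [U CU Uy] : exists2 U, C U & U (sec w y).
  by have : [set: X] (sec w y) by []; rewrite -Ccov => -[U CU Uy]; exists U.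
have /nbhs_ballP[r /= r0 rU] : nbhs (sec w y) U by apply: open_nbhs_nbhs; split=> //; exact: Copen.
(* Both distances, from the limit to [u k] and from there to [z], are at most [c], so [sec_dist]
   applies to [2 * c]; [m.+1] avoids a division by 0. *)
pose c := Num.min (1 / 4) (r / (8 * (m.+1)%:R)).
have m0 : 0 < m.+1%:R :> R by [].
have c0 : 0 < c by rewrite lt_min divr_gt0//= divr_gt0// mulr_gt0.
have [k0 hk0] : exists k0, forall k, (k0 <= k)%N -> k.+1%:R^-1 <= c.
  exists (Num.truncn c^-1) => k hk.
  rewrite -[leRHS]invrK lef_pV2 ?posrE ?invr_gt0//.
  apply: le_trans (ltW (truncnS_gt _)) _.
  by rewrite ler_nat ltnS.
have [k k0k hk] := ylim c k0 c0.
have [_ /(_ U CU)[z [sz uz nUz]]] := uP k.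
apply: nUz; apply: rU; rewrite ballEmdist /=.
have yz i : `|y ord0 i - z ord0 i| <= 2 * c.
  have := hk i; have := uz i; have := hk0 k k0k => h1 h2 h3.
  apply: le_trans (ler_distD (u k ord0 i) _ _) _; rewrite mulrDl mul1r distrC.
  by apply: lerD; [exact: ltW|apply: le_trans (ltW h2) h1].
have c14 : c <= 1 / 4 by rewrite /c ge_min lexx.
have [zK _] := sz.
apply: le_lt_trans (sec_dist sy zK yz _) _; first by lra.
have cr : c <= r / (8 * m.+1%:R) by rewrite /c ge_min lexx orbT.
have : 8 * m.+1%:R * c <= r by rewrite mulrC -ler_pdivlMr// mulr_gt0.
have M0 : 0 <= m%:R :> R := ler0n _ _.
have Mc := mulr_ge0 M0 (ltW c0).
by rewrite -(natr1 m) => cr8; lra.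
Qed.

Definition open_star w : set X := [set p : cover K x0 |
  val p = sec_pt w (val p).2 /\
  forall i, - (1 / 2) < sg (~~ chamber_sign w i) * (val p).2 ord0 i].

Lemma open_starW w p : open_star w p -> star w (val (p : cover K x0)).2.
Proof. by move=> [_ h]; split=> [|i]; [have [] := coverP (p : cover K x0)|exact: ltW]. Qed.

Lemma open_star_sec w p : open_star w p -> p = sec w (val (p : cover K x0)).2.
Proof.
move=> op; have [e _] := op; apply: val_inj; rewrite val_sec//.
by have [] := coverP (p : cover K x0).
Qed.

(* Points of [open_star w] whose image lies in the open grid cube of side
   [2 * e] about [e * k]. *)
Definition cell w (e : R) (k : 'I_m -> int) : set X := [set p : cover K x0 |
  open_star w p /\ forall i, `|(val p).2 ord0 i - e * (k i)%:~R| < e].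

Lemma cell_open w e k : open (cell w e k).
Proof.
rewrite openE => p [op pk]; apply/nbhs_ballP.
pose s := \big[Num.min/1]_(i : 'I_m) Num.min
  (sg (~~ chamber_sign w i) * (val (p : cover K x0)).2 ord0 i + 1 / 2)
  (e - `|(val (p : cover K x0)).2 ord0 i - e * (k i)%:~R|).
have s0 : 0 < s.
  apply: lt_bigmin => // i _; rewrite lt_min subr_gt0 pk andbT.
  by have [_ /(_ i)] := op; lra.
exists s => //= q; rewrite ballEmdist /= => pq.
have s1 : s <= 1 by exact: bigmin_le_id.
have [qE pqi] := cdst_small Kc Kf x0K (lt_le_trans pq s1).
have sle i : Num.min (sg (~~ chamber_sign w i) * (val (p : cover K x0)).2 ord0 i + 1 / 2)
  (e - `|(val (p : cover K x0)).2 ord0 i - e * (k i)%:~R|) >= s by exact: bigmin_le_cond.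
have lt1 i := lt_le_trans (le_lt_trans (pqi i) pq) (sle i).
have sp := open_starW op; have [qK _] := coverP (q : cover K x0).
split; last first.
  move=> i; have := lt1 i; rewrite lt_min => /andP[_ h].
  have := ler_distD ((val (p : cover K x0)).2 ord0 i) ((val (q : cover K x0)).2 ord0 i)
    (e * (k i)%:~R).
  by rewrite (distrC ((val (q : cover K x0)).2 ord0 i) ((val (p : cover K x0)).2 ord0 i)); lra.
split.
  rewrite (cover_val (q : cover K x0)) qE; have [pE _] := op.
  have near : near_pts (val (p : cover K x0)).2 (val (q : cover K x0)).2.
    by move=> i; apply: le_lt_trans (pqi i) (lt_le_trans pq s1).
  by rewrite /= [sec_pt w _]surjective_pairing (sec_near sp qK near) -pE.
move=> i; have := lt1 i; rewrite lt_min => /andP[+ _].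
by case: (chamber_sign w i) => /=; rewrite ?mulN1r ?mul1r ltr_norml => /andP[]; lra.
Qed.

(** The cover [C] need not be invariant, so each star has its own mesh [e w]. A cell containing [p]
    is determined by the set [D] of walls between its chamber and that of [p], and by the set [E] of
    coordinates in which the cube index is the floor plus 1 instead of the floor. *)
Lemma cover_finite_dim : finite_dimensional X.
Proof.
pose T := ({set 'I_m} * {set 'I_m})%type.
exists #|{: T}| => C covC.
have [del delP] : exists del : W -> R, forall w, 0 < del w /\
    forall y, star w y -> exists2 U, C U & forall z, star w z ->
      (forall i, `|y ord0 i - z ord0 i| < del w) -> U (sec w z).
  have h w : exists d : R, 0 < d /\ forall y, star w y -> exists2 U, C U &
      forall z, star w z -> (forall i, `|y ord0 i - z ord0 i| < d) -> U (sec w z).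
    by have [d d0 dP] := star_lebesgue w covC; exists d.
  by have [del ?] := choice h; exists del.
pose e w := del w / 2.
have e0 w : 0 < e w by rewrite divr_gt0//; have [] := delP w.
pose grid (p : cover K x0) w i := Num.floor ((val p).2 ord0 i / e w).
have gridE (p : cover K x0) w (i : 'I_m) (k : int) :
    `|(val p).2 ord0 i - e w * k%:~R| < e w <-> `|(val p).2 ord0 i / e w - k%:~R| < 1.
  have -> : (val p).2 ord0 i - e w * k%:~R = e w * ((val p).2 ord0 i / e w - k%:~R).
    by rewrite mulrBr mulrCA mulfV ?mulr1// gt_eqF.
  by rewrite normrM gtr0_norm// -[X in _ < X]mulr1 ltr_pM2l.
have grid_in (p : cover K x0) w (i : 'I_m) : `|(val p).2 ord0 i - e w * (grid p w i)%:~R| < e w.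
  apply/gridE; rewrite /grid; set t := _ / _; have /andP[f1 f2] := floor_itv t.
  by rewrite ltr_norml; move: f2; rewrite intrD => f2; apply/andP; split; lra.
have grid_cases (p : cover K x0) w (i : 'I_m) (k : int) :
    `|(val p).2 ord0 i - e w * k%:~R| < e w -> k = grid p w i \/ k = grid p w i + 1.
  move=> /gridE; rewrite /grid; set t := _ / _; have /andP[f1 f2] := floor_itv t.
  rewrite ltr_norml => /andP[h1 h2].
  have a1 : (Num.floor t - 1)%:~R < k%:~R :> R by rewrite intrD; move: f1; lra.
  have a2 : k%:~R < (Num.floor t + 1 + 1)%:~R :> R by move: f2; rewrite !intrD; lra.
  by move: a1 a2; rewrite !ltr_int; lia.
(* Empty cells are left out: a point of the cell is needed to obtain [U] from the Lebesgue
   number. *)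
exists [set V | exists w k, V = cell w (e w) k /\ V !=set0]; split.
- split=> [V [w [k [-> _]]]|]; first exact: cell_open.
  apply/seteqP; split=> // p _.
  have [pK pab] := coverP (p : cover K x0).
  pose w := (val (p : cover K x0)).1.
  have pc : cell w (e w) (grid p w) p.
    have cs i : chamber_sign w i = sgn (val (p : cover K x0)).2 i by rewrite pab.
    split; last by move=> i; exact: grid_in.
    split=> [|i].
      rewrite /sec_pt flip0 ?mulg1 => [|i]; last by rewrite cs addbb.
      by rewrite -cover_val.
    rewrite cs /sgn; move: ((val (p : cover K x0)).2 ord0 i) => a.
    by case: (ltP a 0) => h /=; lra.
  by exists (cell w (e w) (grid p w)) => //; exists w, (grid p w); split=> //; exists p.
- move=> V [w [k [-> [p [op pk]]]]].
  have [U CU UP] := (delP w).2 _ (open_starW op).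
  exists U => // q [oq qk]; rewrite (open_star_sec oq); apply: UP; first exact: open_starW.
  move=> i; have := pk i; have := qk i; rewrite /e => h1 h2.
  have := ler_distD (del w / 2 * (k i)%:~R) ((val (p : cover K x0)).2 ord0 i)
    ((val (q : cover K x0)).2 ord0 i).
  by rewrite (distrC (del w / 2 * (k i)%:~R)); move: h1 h2; lra.
- move=> p; pose g (x : T) :=
    let w := ((val (p : cover K x0)).1 * (flip K (fun i => i \in x.1))^-1)%g in
    cell w (e w) (fun i => if i \in x.2 then grid p w i + 1 else grid p w i).
  pose h n := g (nth (finset.set0, finset.set0) (enum {: T}) n).
  apply: (@card_le_trans _ _ _ (h @` `I_#|{: T}|.+1)); last exact: card_image_le.
  apply: subset_card_le => V [[w [k [-> _]]] [op pk]].
  pose D := [set i | chamber_sign w i (+) sgn (val (p : cover K x0)).2 i]%SET.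
  pose E := [set i | k i != grid p w i]%SET.
  exists (index (D, E) (enum {: T})) => /=.
    by rewrite ltnS ltnW// cardE index_mem mem_enum.
  rewrite /h nth_index ?mem_enum// /g /=.
  have -> : ((val (p : cover K x0)).1 * (flip K (fun i => i \in D))^-1)%g = w.
    have [-> _] := op; rewrite /= (@flip_eq _ K _ (fun i => i \in D)) ?mulgK// => i.
    by rewrite inE.
  congr cell; apply/funext => i; rewrite inE.
  have [->|->] := grid_cases _ _ _ _ (pk i); first by rewrite eqxx.
  by case: eqP => //; lia.
Qed.

End CoverDimension.

(** * Path lifting *)

Section UniformContinuity.
Context {R : realType} {m : nat} (S : set 'rV[R]_m).
Notation I := (unit_itv R).
Notation T := (set_type S).

Lemma set_type_continuous (X : topologicalType) (F : X -> T) :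
  continuous (fun x => \val (F x) : 'rV[R]_m) -> continuous F.
Proof. exact: (@continuous_comp_initial _ X 'rV[R]_m set_val F). Qed.

Lemma continuous_set_val : continuous (fun x : T => \val x : 'rV[R]_m).
Proof. exact: initial_continuous. Qed.

Lemma clamp_lipschitz (a b : R) : `|itv_val (clamp a) - itv_val (clamp b)| <= `|a - b|.
Proof.
rewrite !clampE; wlog ab : a b / a <= b.
  move=> h; have [/h//|/ltW /h] := leP a b.
  by rewrite distrC (distrC b a).
rewrite distrC (distrC a b) [leRHS]ger0_norm ?subr_ge0//.
case: (leP 1 b) => ?; case: (leP 1 a) => ?; rewrite ?(max_r ler01);
  case: (leP 0 b) => ?; case: (leP 0 a) => ?;
  by rewrite ler_norml; apply/andP; split; lra.
Qed.

Lemma nbhs_itv (u : I) (d : R) : 0 < d -> nbhs u [set v | `|itv_val u - itv_val v| < d].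
Proof. by move=> d0; exact: (@continuous_val R u _ (nbhsx_ballx (itv_val u) d d0)). Qed.

Lemma square_continuousP (F : I * I -> T) : continuous F <->
  (forall (s t : I) (e : R), 0 < e -> exists2 d : R, 0 < d & forall s' t' : I,
    `|itv_val s - itv_val s'| < d -> `|itv_val t - itv_val t'| < d ->
    forall i, `|\val (F (s, t)) ord0 i - \val (F (s', t')) ord0 i| < e).
Proof.
split=> [cF s t e e0|h]; last first.
  apply: set_type_continuous => -[s t]; apply/cvg_ballP => e e0.
  have [d d0 hd] := h s t e e0.
  exists ([set s' | `|itv_val s - itv_val s'| < d], [set t' | `|itv_val t - itv_val t'| < d]).
    by split; exact: nbhs_itv.
  by move=> [s' t'] [/= hs ht]; split=> // j i; rewrite (ord1 j); exact: hd.
pose G (z : R * R) : 'rV[R]_m := \val (F (clamp z.1, clamp z.2)).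
have cG : continuous G.
  apply: (continuous_compf (a := fun z : R * R => F (clamp z.1, clamp z.2)) (b := fun x : T => \val x)).
    by apply: continuous_pair_clamp => //; [exact: continuous_fst|exact: continuous_snd].
  exact: continuous_set_val.
have /cvg_ballP/(_ e e0) [[U V] [/= /nbhs_ballP[d1 /= d10 dU] /nbhs_ballP[d2 /= d20 dV]] UV] :=
  cG (itv_val s, itv_val t).
exists (Num.min d1 d2); first by rewrite lt_min d10.
move=> s' t'; rewrite !lt_min => /andP[hs _] /andP[_ ht] i.
have [_ /(_ ord0 i)] : ball (G (itv_val s, itv_val t)) e (G (itv_val s', itv_val t')).
  by apply: UV; split => /=; [exact: dU|exact: dV].
by rewrite /G /= !clampK.
Qed.

(** The Heine-Cantor theorem; the pair of parameters is encoded as a function on [bool] so that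
    [cluster_point] applies. *)
Lemma square_uniform (F : I * I -> T) (e : R) : continuous F -> 0 < e ->
  exists2 d : R, 0 < d & forall s t s' t' : I,
    `|itv_val s - itv_val s'| < d -> `|itv_val t - itv_val t'| < d ->
    forall i, `|\val (F (s, t)) ord0 i - \val (F (s', t')) ord0 i| < e.
Proof.
move=> /square_continuousP cF e0; apply: contrapT => nod.
have bad n : exists z : (I * I) * (I * I), [/\ `|itv_val z.1.1 - itv_val z.2.1| < n.+1%:R^-1,
    `|itv_val z.1.2 - itv_val z.2.2| < n.+1%:R^-1 &
    ~ forall i, `|\val (F z.1) ord0 i - \val (F z.2) ord0 i| < e].
  apply: contrapT => nb; apply: nod; exists n.+1%:R^-1; first by rewrite invr_gt0.
  move=> s t s' t' hs ht; apply: contrapT => ni; apply: nb.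
  by exists ((s, t), (s', t')).
have [z zP] := choice bad.
have [k b||f _ flim] := @cluster_point R bool [:: true; false] (fun _ => 0)
    (fun n b => if b then itv_val (z n).1.1 else itv_val (z n).1.2).
- case: b; first by have /andP[] := unit_itvP (z k).1.1; lra.
  by have /andP[] := unit_itvP (z k).1.2; lra.
- by move=> k [].
pose s := clamp (f true); pose t := clamp (f false).
have [d d0 hd] := cF s t (e / 2) (divr_gt0 e0 (ltr0n R 2)).
pose k0 := Num.truncn (d / 2)^-1.
have [k k0k hk] := flim (d / 2) k0 (divr_gt0 d0 (ltr0n R 2)).
have kd : k.+1%:R^-1 <= d / 2.
  rewrite -[leRHS]invrK lef_pV2 ?posrE ?invr_gt0//; last by rewrite divr_gt0.
  by apply: le_trans (ltW (truncnS_gt _)) _; rewrite ler_nat ltnS.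
have [h1 h2] := zP k; apply; move: h1 h2; case: (z k) (hk) => -[s1 t1] [s2 t2] /= hk' h1 h2 i.
have hs : `|itv_val s - itv_val s1| < d / 2.
  rewrite distrC -[s1]clampK; apply: le_lt_trans (clamp_lipschitz _ _) _; exact: (hk' true).
have ht : `|itv_val t - itv_val t1| < d / 2.
  rewrite distrC -[t1]clampK; apply: le_lt_trans (clamp_lipschitz _ _) _; exact: (hk' false).
have hs2 : `|itv_val s - itv_val s2| < d.
  apply: le_lt_trans (ler_distD (itv_val s1) _ _) _; rewrite (splitr d); apply: ltrD => //.
  exact: lt_le_trans h1 kd.
have ht2 : `|itv_val t - itv_val t2| < d.
  apply: le_lt_trans (ler_distD (itv_val t1) _ _) _; rewrite (splitr d); apply: ltrD => //.
  exact: lt_le_trans h2 kd.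
have a1 : `|\val (F (s, t)) ord0 i - \val (F (s1, t1)) ord0 i| < e / 2.
  by apply: hd; [apply: lt_trans hs _|apply: lt_trans ht _]; lra.
have a2 : `|\val (F (s, t)) ord0 i - \val (F (s2, t2)) ord0 i| < e / 2 by apply: hd.
apply: le_lt_trans (ler_distD (\val (F (s, t)) ord0 i) _ _) _.
by rewrite (splitr e); apply: ltrD => //; rewrite distrC.
Qed.

Lemma path_uniform (f : I -> T) (e : R) : continuous f -> 0 < e ->
  exists2 d : R, 0 < d & forall a b : R, `|a - b| < d ->
    forall i, `|\val (extend f a) ord0 i - \val (extend f b) ord0 i| < e.
Proof.
move=> cf e0.
have [|d d0 hd] := @square_uniform (fun z => f z.1) e _ e0.
  by apply: continuous_compf => //; exact: continuous_fst.
exists d => // a b ab i; apply: (hd (clamp a) zero (clamp b) zero); rewrite ?subrr ?normr0//.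
exact: le_lt_trans (clamp_lipschitz _ _) ab.
Qed.

End UniformContinuity.

(** * Lifting paths by the chamber cocycle *)

Section Holonomy.
Context {R : realType} {m : nat} (K : {set {set 'I_m}}).
Hypotheses (Kc : simplicial_complex K) (Kf : flag_complex K).
Notation W := (racg (edge K)).
Notation near_pts := (@near_pts R m).
Implicit Types (y : R -> 'rV[R]_m) (w : R -> W) (u : W) (r : R).

(** Finitely many steps shorter than [d] join two reals; this replaces connectedness, as [A] carries
    no topology. *)
Lemma uniformly_locally_constant (A : Type) (v : R -> A) :
  (exists2 d : R, 0 < d & forall r r', `|r - r'| < d -> v r = v r') -> forall r r', v r = v r'.
Proof.
move=> [d d0 hd] r r'.
pose n := (Num.truncn (`|r - r'| / d)).+1.
have nd : `|r - r'| / n%:R < d.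
  by rewrite ltr_pdivrMr// mulrC -ltr_pdivrMr// truncnS_gt.
have step k : (k <= n)%N -> v r = v (r + (r' - r) / n%:R * k%:R).
  elim: k => [|k IH] kn; first by rewrite mulr0 addr0.
  rewrite IH ?(ltnW kn)//; apply: hd.
  rewrite -natr1 mulrDr mulr1 addrA opprD addrA subrr sub0r normrN normrM.
  by rewrite distrC ger0_norm// invr_ge0.
by rewrite (step n)// divfK ?pnatr_eq0// addrC subrK.
Qed.

Definition fine_path y : Prop := (forall r, inRK K (y r)) /\
  exists2 d : R, 0 < d & forall r r', `|r - r'| < d -> near_pts (y r) (y r').

(** A lift is recorded by its chambers alone, and its continuity by the cocycle rule at nearby
    times. *)
Definition lifts y w : Prop := exists2 d : R, 0 < d & forall r r', `|r - r'| < d ->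
  w r' = (w r * flip K (offset (y r) (y r')))%g.

Lemma lifts_mul y w u : lifts y w -> lifts y (fun r => u * w r)%g.
Proof. by move=> [d d0 hd]; exists d => // r r' /hd ->; rewrite mulgA. Qed.

Lemma lifts_comp y w (a : R -> R) : (forall r r', `|a r - a r'| <= `|r - r'|) ->
  lifts y w -> lifts (y \o a) (w \o a).
Proof.
move=> ha [d d0 hd]; exists d => // r r' rr'; apply: hd.
exact: le_lt_trans (ha r r') rr'.
Qed.

Lemma lifts_eq y y' w : y =1 y' -> lifts y w -> lifts y' w.
Proof. by move=> yy' [d d0 hd]; exists d => // r r' /hd ->; rewrite !yy'. Qed.

(** Both lifts change by the same factor on the right, so [w r * (w' r)^-1] is locally constant. *)
Lemma lifts_unique y w w' : lifts y w -> lifts y w' -> w 0 = w' 0 -> w =1 w'.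
Proof.
move=> [d d0 hd] [d' d'0 hd'] w0 r.
have /uniformly_locally_constant/(_ 0 r) : exists2 e : R, 0 < e & forall r r',
    `|r - r'| < e -> (w r * (w' r)^-1 = w r' * (w' r')^-1)%g.
  exists (Num.min d d'); first by rewrite lt_min d0.
  move=> s s'; rewrite lt_min => /andP[/hd -> /hd' ->].
  by rewrite invgM mulgA mulgK.
by rewrite w0 mulgV => h; rewrite -[w r](mulgVK (w' r)) -h mul1g.
Qed.

Lemma lifts_ab y w r i : lifts y w -> w 0 = 1%g -> ab (w r) i = sgn (y 0) i (+) sgn (y r) i.
Proof.
move=> [d d0 hd] w0.
have /uniformly_locally_constant/(_ 0 r) : exists2 e : R, 0 < e & forall r r',
    `|r - r'| < e -> ab (w r) i (+) sgn (y r) i = ab (w r') i (+) sgn (y r') i.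
  exists d => // s s' /hd ->; rewrite abM ab_flip /offset.
  by case: (ab _ _); case: (sgn (y s) i); case: (sgn (y s') i).
rewrite w0 ab1; case: (ab _ _); case: (sgn (y 0) i); case: (sgn (y r) i) => //=.
Qed.

(** The changes of chamber between consecutive nodes of mesh [e] are multiplied up to the last node
    before [r], followed by the change from that node to [r]. The mesh is [d / 2] so that
    neighbouring subintervals stay within [d]. *)
Lemma lifts_exists y : fine_path y -> (forall r, r <= 0 -> y r = y 0) ->
  exists2 w, lifts y w & w 0 = 1%g.
Proof.
move=> [yK [d d0 hd]] y0; pose e := d / 2.
have e0 : 0 < e by rewrite divr_gt0.
pose P n : W := iteri n (fun k u => u * flip K (offset (y (e * k%:R)%R) (y (e * k.+1%:R)%R)))%g 1%g.
pose N r := Num.truncn (r / e).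
pose w r : W := (P (N r) * flip K (offset (y (e * (N r)%:R)%R) (y r)))%g.
have ed : e < d by rewrite /e; lra.
have Nle r : 0 <= r -> e * (N r)%:R <= r < e * (N r).+1%:R.
  move=> r0; have /truncn_itv : 0 <= r / e by rewrite divr_ge0// ltW.
  by rewrite ler_pdivlMr// ltr_pdivrMr// ![_ * e]mulrC.
have Nnear r : near_pts (y (e * (N r)%:R)) (y r).
  (* For negative times [truncn] is 0, which is harmless because the path is constant there. *)
  have [r0|r0] := leP r 0.
    rewrite (_ : N r = 0%N) ?mulr0 ?(y0 r r0); first by move=> i; rewrite subrr normr0.
    apply/truncn0Pn; rewrite -ltNge; apply: le_lt_trans _ ltr01.
    by rewrite pmulr_lle0// invr_gt0.
  apply: hd; have /andP[h1] := Nle r (ltW r0).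
  rewrite -natr1 mulrDr mulr1 => h2.
  by rewrite ltr_norml; apply/andP; split; lra.
have cyc r1 r2 r3 : near_pts (y r1) (y r2) -> near_pts (y r2) (y r3) ->
    (flip K (offset (y r1) (y r2)) * flip K (offset (y r2) (y r3)) = flip K (offset (y r1) (y r3)))%g.
  exact: flip_near_cocycle.
exists w; last first.
  rewrite /w /N mul0r truncn0 mulr0 /P /= mul1g; exact: flip_offset_id.
exists e => // r r' rr'.
have key a b : (a <= b) -> `|a - b| < e -> w b = (w a * flip K (offset (y a) (y b)))%g.
  move=> ab abe; rewrite /w -mulgA cyc//; last first.
    by apply: hd; apply: lt_trans abe _; rewrite /e; lra.
  have [NN|NN] : N b = N a \/ N b = (N a).+1.
    have le1 : (N a <= N b)%N by apply: le_truncn; rewrite ler_pM2r// invr_gt0.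
    have le2 : (N b <= (N a).+1)%N.
      have := truncnS_gt (a / e); rewrite truncn_le_nat !ltr_pdivrMr// -[_.+2%:R]natr1 mulrDl mul1r.
      by move: abe; rewrite ltr_norml -/(N a) => /andP[]; lra.
    by lia.
  - by rewrite NN.
  - rewrite NN /P /= -/(P _) -mulgA -NN cyc//.
    rewrite NN; apply: hd; rewrite -mulrBr -natr1 opprD addrA subrr sub0r normrM normrN1.
    by rewrite mulr1 gtr0_norm.
have [/key ->//|/ltW r'r] := leP r r'.
rewrite (key r' r)// 1?distrC// -mulgA cyc.
- by rewrite flip_offset_id mulg1.
- by apply: hd; rewrite distrC; apply: lt_trans rr' _; rewrite /e; lra.
- by apply: hd; apply: lt_trans rr' _; rewrite /e; lra.
Qed.

End Holonomy.

Section PathHolonomy.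
Context {R : realType} {m : nat} (K : {set {set 'I_m}}).
Hypotheses (Kc : simplicial_complex K) (Kf : flag_complex K).
Notation W := (racg (edge K)).
Notation I := (unit_itv R).
Notation T := (set_type (real_moment_angle R K)).
Notation near_pts := (@near_pts R m).

Lemma val_inRK (x : T) : inRK K (\val x).
Proof. by apply/(inRKP Kc); exact: set_mem (valP x). Qed.

Definition trace (f : I -> T) (r : R) : 'rV[R]_m := \val (extend f r).

Lemma trace_fine (f : I -> T) : continuous f -> fine_path K (trace f).
Proof.
move=> cf; split=> [r|]; first exact: val_inRK.
have [d d0 hd] := path_uniform cf ltr01.
by exists d => // r r' rr' i; exact: hd.
Qed.

Definition path_lift (f : I -> T) : R -> W :=
  if pselect (exists w, lifts (trace f) w /\ w 0 = 1%g) is left h then projT1 (cid h) else fun=> 1%g.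

Lemma path_liftP (f : I -> T) : continuous f -> lifts (trace f) (path_lift f) /\ path_lift f 0 = 1%g.
Proof.
move=> cf; rewrite /path_lift; case: pselect => [h|nh]; first by case: (cid h).
case: nh; have [|w wl w0] := lifts_exists Kc (trace_fine cf); last by exists w.
by move=> r r0; rewrite /trace !extend_le0.
Qed.

Lemma path_lift_unique (f : I -> T) w : continuous f -> lifts (trace f) w -> w 0 = 1%g ->
  path_lift f =1 w.
Proof.
by move=> /path_liftP[fl f0] wl w0; apply: (lifts_unique fl wl); rewrite f0 w0.
Qed.

Definition hol (f : I -> T) : W := path_lift f 1.

(** The lift of one path of the homotopy, corrected by the offset to a neighbouring path, is a lift
    of the latter. At the fixed endpoints the correction is trivial, so [hol] is locally constant in
    [t]. *)
Lemma hol_homotopic (x y : T) (f g : {path I from x to y}) : path_homotopic f g -> hol f = hol g.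
Proof.
move=> [H [cH H0 H1 Hx Hy]].
pose Y (t : I) (s : I) : T := H (s, t).
have cY t : continuous (Y t).
  apply: (continuous_compf (a := fun s : I => (s, t))) => //.
  apply: (@continuous_pairf I I I id (fun=> t)) => s; first exact: cvg_id.
  exact: cst_continuous.
have [d d0 hd] := square_uniform cH ltr01.
have claim t t' : `|itv_val t - itv_val t'| < d -> hol (Y t') = hol (Y t).
  move=> tt'; have [[d1 d10 hd1] L0] := path_liftP (cY t).
  have [YK [d2 d20 hd2]] := trace_fine (cY t); have [YK' [d3 d30 hd3]] := trace_fine (cY t').
  have near r : near_pts (trace (Y t) r) (trace (Y t') r).
    by move=> i; apply: hd => //; rewrite subrr normr0.
  pose w r := (path_lift (Y t) r * flip K (offset (trace (Y t) r) (trace (Y t') r)))%g.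
  have wl : lifts (trace (Y t')) w.
    exists (Num.min d1 (Num.min d2 d3)); first by rewrite !lt_min d10 d20.
    move=> r r'; rewrite !lt_min => /and3P[rr1 rr2 rr3].
    rewrite /w (hd1 _ _ rr1) -!mulgA; congr (_ * _)%g.
    rewrite !(flip_near_cocycle Kc)//; [exact: hd3|exact: hd2].
  have Yend t1 : trace (Y t1) 0 = \val x /\ trace (Y t1) 1 = \val y.
    by rewrite /trace extend_le0// extend_ge1// /Y Hx Hy.
  have [[x1 y1] [x2 y2]] := (Yend t, Yend t').
  have wr r : trace (Y t) r = trace (Y t') r -> w r = path_lift (Y t) r.
    by move=> e; rewrite /w e flip_offset_id mulg1.
  rewrite /hol (path_lift_unique (cY t') wl) ?wr ?y1 ?y2 ?x1 ?x2//.
have -> : (f : I -> T) = Y zero by apply/funext => s; rewrite -H0.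
have -> : (g : I -> T) = Y one by apply/funext => s; rewrite -H1.
have /uniformly_locally_constant/(_ 0 1) : exists2 e : R, 0 < e & forall r r', `|r - r'| < e ->
    hol (Y (clamp r)) = hol (Y (clamp r')).
  exists d => // r r' rr'; apply/esym/claim; exact: le_lt_trans (clamp_lipschitz _ _) rr'.
by rewrite -itv_zeroE -itv_oneE.
Qed.

Lemma hol_concat (x y z : T) (f : {path I from x to y}) (g : {path I from y to z}) :
  hol (concat f g) = (hol f * hol g)%g.
Proof.
have cc : continuous (concat f g) by exact: cts_fun.
have [cl c0] := path_liftP cc; set L := path_lift _ in cl c0.
have trE r : trace (concat f g) r = if r <= 2^-1 then trace f (2 * r) else trace g (2 * r - 1).
  by rewrite /trace extend_concat; case: ifP.
(* The lift of the concatenation is stopped at 1/2 by the minimum, since [trace f] is constant after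
   time 1; the maximum below does the same for [g] before time 0. *)
have lf : lifts (trace f) (fun r => L (Num.min r 1 / 2)).
  apply: (lifts_eq _ (lifts_comp (a := fun r => Num.min r 1 / 2) _ cl)) => [r|r r'].
    rewrite /= trE ifT; last first.
      by rewrite ler_pdivrMr// mulVf// ge_min lexx orbT.
    rewrite mulrC divfK//; case: (leP r 1) => // r1.
    by rewrite /trace !extend_ge1// ltW.
  rewrite -mulrBl normrM [`|2^-1|]ger0_norm// ler_pdivrMr//.
  have n1 := ler_norm (r - r'); have := ler_norm (r' - r); rewrite distrC => n2.
  by case: (leP r 1) => ?; case: (leP r' 1) => ?; rewrite ler_norml; apply/andP; split; lra.
have lg : lifts (trace g) (fun r => (L (1 / 2)%R)^-1 * L ((1 + Num.max r 0) / 2)%R)%g.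
  apply: lifts_mul; apply: (lifts_eq _ (lifts_comp (a := fun r => (1 + Num.max r 0) / 2) _ cl)) => [r|r r'].
    rewrite /= trE; case: (leP r 0) => r0.
      rewrite addr0 ifT; last by lra.
      by rewrite /trace extend_ge1 ?extend_le0 ?path_one ?path_zero//; lra.
    by rewrite ifF; [congr trace; lra|lra].
  rewrite -mulrBl normrM [`|2^-1|]ger0_norm// ler_pdivrMr//.
  have n1 := ler_norm (r - r'); have := ler_norm (r' - r); rewrite distrC => n2.
  by case: (leP r 0) => ?; case: (leP r' 0) => ?; rewrite ler_norml; apply/andP; split; lra.
have cf : continuous f by exact: cts_fun.
have cg : continuous g by exact: cts_fun.
rewrite /hol (path_lift_unique cf lf) ?(path_lift_unique cg lg) /=.
- by rewrite minxx (max_l ler01) mulgA mulgV mul1g; congr L; lra.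
- by rewrite maxxx addr0 mulVg.
- by rewrite min_l ?ler01// mul0r.
Qed.

Lemma hol_ab (x y : T) (f : {path I from x to y}) i :
  ab (hol f) i = sgn (\val x) i (+) sgn (\val y) i.
Proof.
have cf : continuous f by exact: cts_fun.
have [fl f0] := path_liftP cf; rewrite (lifts_ab _ _ fl f0).
by rewrite /trace extend_le0// extend_ge1// path_zero path_one.
Qed.

End PathHolonomy.

(** * The action of the fundamental group *)

Section Deck.
Context {R : realType} {m : nat} (K : {set {set 'I_m}}).
Hypotheses (Kc : simplicial_complex K) (Kf : flag_complex K).
Notation W := (racg (edge K)).
Notation I := (unit_itv R).
Notation T := (set_type (real_moment_angle R K)).
Variable x0 : T.
Notation x0K := (val_inRK Kc x0).
Notation X := (cover_space Kc x0K).
Notation base := (mk_cover (cover_base x0K)).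

Definition to_RK (p : cover K (\val x0)) : T :=
  exist _ (val p).2 (mem_set ((inRKP Kc _).1 (coverP p).1)).

Lemma to_RK_base : to_RK base = x0. Proof. exact: val_inj. Qed.

Lemma lift_pt (f : I -> T) (r : R) : continuous f -> f zero = x0 ->
  cover_pt (\val x0) (path_lift f r, trace f r).
Proof.
move=> cf fz; split=> [|i]; first exact: val_inRK.
have [fl f0] := path_liftP Kc cf; rewrite (lifts_ab _ _ fl f0) /trace [extend f 0]extend_le0// fz.
by rewrite addbC addbA addbb.
Qed.

Lemma lift_continuous (f : I -> T) (cf : continuous f) (fz : f zero = x0) (e : R) : 0 < e ->
  exists2 d : R, 0 < d & forall r r', `|r - r'| < d ->
    cdst (mk_cover (lift_pt r cf fz)) (mk_cover (lift_pt r' cf fz)) < e.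
Proof.
move=> e0; have [[d1 d10 hd1] _] := path_liftP Kc cf.
pose c := Num.min (1 / 2) (e / (4 * m.+1%:R)).
have c0 : 0 < c by rewrite lt_min divr_gt0//= divr_gt0// mulr_gt0.
have [d2 d20 hd2] := path_uniform cf c0.
exists (Num.min d1 d2); first by rewrite lt_min d10.
move=> r r'; rewrite lt_min => /andP[rr1 rr2].
have ce : c <= e / (4 * m.+1%:R) by rewrite /c ge_min lexx orbT.
have c2 : c <= 1 / 2 by rewrite /c ge_min lexx.
apply: (@le_lt_trans _ _ (2 * m%:R * c)).
  apply: (cdst_near Kc); first exact: hd1.
    by move=> i; apply: ltW; exact: hd2.
  by apply/andP; split; lra.
have : 4 * m.+1%:R * c <= e by rewrite mulrC -ler_pdivlMr// mulr_gt0.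
have Mc := mulr_ge0 (ler0n R m) (ltW c0).
by rewrite -(natr1 m) => ce4; lra.
Qed.

Lemma to_RK_small (a b : cover K (\val x0)) (e : R) : cdst a b < Num.min 1 e ->
  forall i, `|\val (to_RK a) ord0 i - \val (to_RK b) ord0 i| < e.
Proof.
rewrite lt_min => /andP[ab1 abe] i.
by have [_ /(_ i) h] := cdst_small Kc Kf x0K ab1; exact: le_lt_trans h abe.
Qed.

Lemma hol_trivial (f : {path I from x0 to x0}) : hol f = 1%g -> path_homotopic f (const_path x0).
Proof.
move=> f1; have cf : continuous f by exact: cts_fun.
have fz : f zero = x0 by exact: path_zero.
pose P (r : R) : X := mk_cover (lift_pt r cf fz).
have [_ l0] := path_liftP Kc cf.
have P0 : P 0 = base.
  by apply: val_inj; rewrite /= l0 /trace extend_le0// fz.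
have P1 : P 1 = base.
  by apply: val_inj; rewrite /= -/(hol f) f1 /trace extend_ge1// path_one.
have [k [k0 k1 kb kd]] := stewart_contraction (cdst_stewart Kc Kf x0K : stewart_space (@mdist R X) setT) base.
have tB (t : I) : 0 <= 1 - itv_val t <= 1 by have /andP[] := unit_itvP t; lra.
(* Time is reversed: [k] is the identity at 1 and constant at 0. *)
exists (fun z => to_RK (k (P (itv_val z.1)) (1 - itv_val z.2))); split.
- apply/square_continuousP => s t e e0.
  pose e1 := Num.min 1 e; have e10 : 0 < e1 by rewrite lt_min ltr01.
  have [d1 d10 hd1] := lift_continuous cf fz (divr_gt0 e10 (ltr0n R 2)).
  pose D := mdist (base : X) (P (itv_val s)); have D0 : 0 <= D by exact: mdist_ge0.
  have D1 : 0 < D + 1 by lra.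
  (* [D] is taken at the fixed time [s], the speed of the contraction being that of its first
     argument; [D + 1] keeps the divisor positive. *)
  exists (Num.min d1 (e1 / 2 / (D + 1))).
    by rewrite lt_min d10 /= !divr_gt0.
  move=> s' t'; rewrite !lt_min => /andP[hs _] /andP[_ ht].
  apply: to_RK_small; apply: le_lt_trans (kd _ _ _ _ (tB t) (tB t')) _.
  rewrite -/D -/e1 (splitr e1); apply: ltr_leD; first exact: hd1.
  have -> : 1 - itv_val t - (1 - itv_val t') = - (itv_val t - itv_val t') by ring.
  rewrite normrN.
  apply: (@le_trans _ _ (e1 / 2 / (D + 1) * D)); first by rewrite ler_wpM2r// ltW.
  by rewrite mulrAC ler_pdivrMr// ler_wpM2l//; lra.
- move=> s; rewrite /= itv_zeroE val_clamp ?lexx ?ler01// subr0 k1.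
  by apply: val_inj; rewrite /= /trace -extendE.
- by move=> s; rewrite /= itv_oneE val_clamp ?lexx ?ler01// subrr k0 to_RK_base.
- by move=> t; rewrite /= itv_zeroE val_clamp ?lexx ?ler01// P0 kb// to_RK_base.
- by move=> t; rewrite /= itv_oneE val_clamp ?lexx ?ler01// P1 kb// to_RK_base.
Qed.

Lemma hol_surj (u : W) : (forall i, ab u i = false) ->
  exists f : {path I from x0 to x0}, hol f = u.
Proof.
move=> u0.
have cu : cover_pt (\val x0) (u, \val x0) by split=> [|i]; [exact: val_inRK|rewrite /= u0].
pose p : X := mk_cover cu.
have [k [k0 k1 kb kd]] := stewart_contraction (cdst_stewart Kc Kf x0K : stewart_space (@mdist R X) setT) base.
pose f (s : I) : T := to_RK (k p (itv_val s)).
pose D := mdist (base : X) p; have D0 : 0 <= D by exact: mdist_ge0.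
have D1 : 0 < D + 1 by lra.
have small (e : R) (s s' : I) : 0 < e -> `|itv_val s - itv_val s'| < e / (D + 1) ->
    mdist (k p (itv_val s)) (k p (itv_val s')) < e.
  move=> e0 ss'; apply: le_lt_trans (kd _ _ _ _ (unit_itvP s) (unit_itvP s')) _.
  rewrite mdistxx add0r -/D; apply: (@le_lt_trans _ _ (e / (D + 1) * D)).
    by rewrite ler_wpM2r// ltW.
  by rewrite mulrAC ltr_pdivrMr// ltr_pM2l//; lra.
have cf : continuous f.
  have cF : continuous (fun z : I * I => f z.1).
    apply/square_continuousP => s t e e0; exists (Num.min 1 e / (D + 1)).
      by rewrite divr_gt0// lt_min ltr01.
    by move=> s' t' hs _; apply: to_RK_small; apply: small => //; rewrite lt_min ltr01.
  move=> s; apply: (@continuous_comp I (I * I)%type T (fun s => (s, zero)) (fun z => f z.1)); last exact: cF.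
  apply: (@continuous_pairf I I I id (fun=> zero)) => r; first exact: cvg_id.
  exact: cst_continuous.
have f0 : f zero = x0 by rewrite /f itv_zeroE val_clamp ?lexx ?ler01// k0 to_RK_base.
have f1 : f one = x0 by apply: val_inj; rewrite /f itv_oneE val_clamp ?lexx ?ler01//= k1.
exists (mk_path cf f0 f1).
(* By [cdst_small] the chambers along the geodesic form a lift of its projection, and uniqueness
   identifies it with [path_lift]. *)
pose w (r : R) : W := (val (k p (itv_val (clamp r)) : cover K (\val x0))).1.
have wl : lifts (trace f) w.
  exists (1 / (D + 1)); first by rewrite divr_gt0.
  move=> r r' rr'.
  have := small 1 (clamp r) (clamp r') ltr01 (le_lt_trans (clamp_lipschitz _ _) rr').
  by move=> /(cdst_small Kc Kf x0K)[].
have w0 : w 0 = 1%g by rewrite /w val_clamp ?lexx ?ler01// k0.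
by rewrite /hol (path_lift_unique Kc cf wl w0) /w val_clamp ?lexx ?ler01// k1.
Qed.

Notation G := (pi1 R x0).

Definition deck (a : G) : W := hol (repr a).

Lemma deck_pi (f : {path I from x0 to x0}) : deck (\pi_(pi1 R x0)%qT f) = hol f.
Proof. exact: hol_homotopic Kc _ _ _ _ (pi1_repr f). Qed.

Lemma deckM (a b : G) : deck (a * b)%g = (deck a * deck b)%g.
Proof. by rewrite [LHS]deck_pi hol_concat. Qed.

Lemma deck1 : deck 1%g = 1%g.
Proof. by apply: (@mulgI _ (deck 1%g)); rewrite -deckM !mulg1. Qed.

Lemma deck_eq1 (a : G) : deck a = 1%g -> a = 1%g.
Proof. by move=> /hol_trivial h; rewrite -[a]reprK; exact/pi1_eqP. Qed.

Lemma deck_ab (a : G) i : ab (deck a) i = false.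
Proof. by rewrite [LHS](hol_ab Kc (repr a : {path I from x0 to x0})) addbb. Qed.

Lemma deck_surj (u : W) : (forall i, ab u i = false) -> exists a : G, deck a = u.
Proof. by move=> /hol_surj[f <-]; exists (\pi_(pi1 R x0)%qT f); exact: deck_pi. Qed.

End Deck.

(** * Translations are isometries *)

Section Translation.
Context {R : realType} {m : nat} (K : {set {set 'I_m}}).
Hypotheses (Kc : simplicial_complex K) (Kf : flag_complex K).
Notation W := (racg (edge K)).
Notation pt := (W * 'rV[R]_m)%type.
Notation eu := (@eucl R W).
Notation chn := (chain (@compat R W (@clause m K)) eu).
Implicit Types (u : W) (p q : pt).

Definition translate u p : pt := ((u * p.1)%g, p.2).

Lemma cube_step_translate u p q : cube_step p q -> cube_step (translate u p) (translate u q).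
Proof. by move=> [I [IK p1 q1 pq qE]]; exists I; split=> //=; rewrite qE mulgA. Qed.

(** The length of a cube step can be read off in R_K, so it does not depend on the chamber. *)
Lemma cube_step_edist p q : cube_step p q -> eu (coords p) (coords q) = Defs.edist p.2 q.2.
Proof.
move=> [I [IK p1 q1 pq qE]]; have [wE cpI cqI off] := cube_step_coords Kc IK pq qE.
rewrite (@euclE _ _ _ _ [seq wall p.1 i | i <- enum I]).
- rewrite big_map big_enum /=; congr Num.sqrt.
  rewrite [RHS](bigID (fun i => i \in I)) /= [X in _ = _ + X]big1 ?addr0.
    apply: eq_bigr => i iI; rewrite cpI// cqI// -mulrBr exprMn.
    by rewrite expr2 wall_sign_sq mul1r.
  by move=> i /pq[_ ->]; rewrite subrr expr0n.
- by rewrite map_inj_uniq ?enum_uniq//; exact: wall_inj.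
- move=> r rI; have [|-> ->//] := off r; move=> i iI; apply: contraNneq rI => <-.
  by apply: map_f; rewrite mem_enum.
Qed.

Variable x0 : 'rV[R]_m.

(** [translate] acts on pairs while chains run through coordinate functions, so each step is first
    lifted to the cover and then translated. *)
Lemma chain_translate u p (z : W -> R) L : chn (coords p) z L -> cover_pt x0 p ->
  exists q, [/\ cover_pt x0 q, coords q = z & chn (coords (translate u p)) (coords (translate u q)) L].
Proof.
move=> h; move E0: (coords p) h => f h; elim: h p E0 => {f z L} [f ff p pf cp|f z v L fz zv IH p pf cp].
  exists p; split=> //; apply: chain0.
  rewrite -pf in ff; have [q pq qf] := cube_step_lift Kc Kf ff cp.1.
  have qp : q = p by apply: (coords_inj Kc (cover_step Kc pq cp) cp); rewrite qf pf.
  rewrite qp in pq; apply: (cube_step_compat Kc); exact: cube_step_translate.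
rewrite -pf in fz; have [q pq qz] := cube_step_lift Kc Kf fz cp.1.
have [q' [cq' q'v hq']] := IH q qz (cover_step Kc pq cp).
exists q'; split=> //.
have -> : eu z f = eu (coords (translate u p)) (coords (translate u q)).
  by rewrite -pf -qz (cube_step_edist pq) (cube_step_edist (cube_step_translate u pq)).
by apply: chainS hq'; apply: (cube_step_compat Kc); exact: cube_step_translate.
Qed.

End Translation.

Section DeckAction.
Context {R : realType} {m : nat} (K : {set {set 'I_m}}).
Hypotheses (Kc : simplicial_complex K) (Kf : flag_complex K).
Notation W := (racg (edge K)).
Notation T := (set_type (real_moment_angle R K)).
Variable x0 : T.
Notation x0K := (val_inRK Kc x0).
Notation X := (cover_space Kc x0K).
Notation G := (pi1 R x0).

Lemma cover_translate (u : W) (p : cover K (\val x0)) : (forall i, ab u i = false) ->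
  cover_pt (\val x0) (translate u (val p)).
Proof. by move=> u0; have [pK pab] := coverP p; split=> // i; rewrite /= abM u0. Qed.

Lemma cdst_translate (u : W) (u0 : forall i, ab u i = false) (p q : cover K (\val x0)) :
  cdst (mk_cover (cover_translate p u0)) (mk_cover (cover_translate q u0)) = cdst p q.
Proof.
have le v (v0 : forall i, ab v i = false) (a b : cover K (\val x0)) :
    cdst (mk_cover (cover_translate a v0)) (mk_cover (cover_translate b v0)) <= cdst a b.
  apply: (cdist_ge (cover_conn Kc x0K a b)) => L hL; apply: cdist_le => //.
    exact: eucl_ge0.
  have [c [cc cb hc]] := chain_translate Kc Kf v hL (coverP a).
  by rewrite (coords_inj Kc cc (coverP b) cb) in hc.
apply/eqP; rewrite eq_le le /=.
have v0 i : ab u^-1%g i = false by rewrite abV u0.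
have inv (a : cover K (\val x0)) : mk_cover (cover_translate (mk_cover (cover_translate a u0)) v0) = a.
  by apply: val_inj => /=; rewrite /translate /= mulKg; case: (val a).
by rewrite -{1}(inv p) -{1}(inv q); exact: le.
Qed.

Definition deck_act (a : G) (p : X) : X := mk_cover (cover_translate p (deck_ab Kc a)).

Lemma val_deck_act (a : G) (p : cover K (\val x0)) :
  val (deck_act a p : cover K (\val x0)) = translate (deck a) (val p).
Proof. by []. Qed.

Lemma deck_left_action : left_action deck_act.
Proof.
split=> [p|a b p]; apply: val_inj; rewrite !val_deck_act /translate.
  by rewrite deck1// mul1g -surjective_pairing.
by rewrite deckM// mulgA.
Qed.

Lemma deck_isometric : isometric_action deck_act.
Proof. by move=> a p q; exact: cdst_translate. Qed.

(** Distinct points of one fibre are at distance at least 1, so only the identity moves a ball of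
    radius 1/2 to one that meets it. *)
Lemma deck_proper : proper_action deck_act.
Proof.
move=> x; exists (1 / 2); first by rewrite divr_gt0.
apply: (sub_finite_set _ (finite_set1 (1%g : G))) => a [_ [[y xy <-] xay]].
move: xy xay; rewrite !ballEmdist /= => xy xay.
have yay : cdst (y : cover K (\val x0)) (deck_act a y) < 1.
  have := metric_triangle y x (deck_act a y); rewrite (metric_sym y x) => h.
  by apply: le_lt_trans h _; rewrite (splitr 1); exact: ltrD.
have [e _] := cdst_small Kc Kf x0K yay; move: e; rewrite val_deck_act /= flip_offset_id mulg1.
by move=> e; apply: (deck_eq1 Kc Kf); apply: (@mulIg _ (val (y : cover K (\val x0))).1); rewrite mul1g.
Qed.

Lemma deck_cocompact : cocompact_action deck_act.
Proof.
(* [D] need not be a simplex: any element with class [D] in the abelianisation will do. *)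
pose w (D : {set 'I_m}) : W := flip K (fun i => i \in D).
exists (\big[setU/set0]_(D <- enum {: {set 'I_m}}) (sec Kc x0K (w D) @` star (\val x0) (w D))).
  by apply: bigsetU_compact => D _; exact: sec_star_compact.
apply/seteqP; split=> // p _; have [pK pab] := coverP (p : cover K (\val x0)).
pose D := [set i | ab (val (p : cover K (\val x0))).1 i]%SET.
have wD i : ab (w D) i = ab (val (p : cover K (\val x0))).1 i by rewrite ab_flip inE.
have cs i : chamber_sign (\val x0) (w D) i = sgn (val (p : cover K (\val x0))).2 i.
  by rewrite pab -wD.
have [a aE] : exists a : G, deck a = ((val (p : cover K (\val x0))).1 * (w D)^-1)%g.
  by apply: (deck_surj Kc Kf) => i; rewrite abM abV wD addbb.
exists a => //; exists (sec Kc x0K (w D) (val (p : cover K (\val x0))).2).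
  rewrite -bigcup_seq; exists D; first by rewrite /= mem_enum.
  exists (val (p : cover K (\val x0))).2 => //; split=> // i; rewrite cs /sgn.
  by case: (ltP ((val (p : cover K (\val x0))).2 ord0 i) 0) => h /=; lra.
apply: val_inj; rewrite val_deck_act val_sec// /translate /sec_pt /= aE.
rewrite flip0 ?mulg1 ?mulgVK; last by move=> i; rewrite cs addbb.
exact/esym/surjective_pairing.
Qed.

End DeckAction.

Theorem proposition3p2 (R : realType) (m : nat) (K : {set {set 'I_m}})
    (K_complex : simplicial_complex K) (K_flag : flag_complex K)
    (RK_closed_manifold : closed_manifold R (real_moment_angle R K))
    (x0 : real_moment_angle R K) :
  exists (X : metricType R) (act : pi1 R x0 -> X -> X),
    [/\ CAT0_space X /\ finite_dimensional X,
        left_action act,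
        proper_action act,
        cocompact_action act
      & isometric_action act].
Proof.
exists (cover_space K_complex (val_inRK K_complex x0)).
exists (@deck_act _ _ _ K_complex x0); split.
- split; first exact: cover_CAT0.
  exact: cover_finite_dim.
- exact: deck_left_action.
- exact: deck_proper.
- exact: deck_cocompact.
- exact: deck_isometric.
Qed.
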